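(* Let $K$ be a triangle with triangulation $\mathcal{T}^h$, and suppose $C_h$ is a real number such that $$\|u-\Pi_h^{FM}u\|_{\infty,K}\le C_h\,|u-\Pi_h^{FM}u|_{2,K}\qquad\text{for all } u\in V^L(K).$$ Then $$\lambda(K)\ge \frac{\lambda_h(K)}{1+C_h^2\,\lambda_h(K)}.$$
   Context: $K$ is a triangle with vertices $p_1,p_2,p_3$, and $\mathcal{T}^h$ is a (conforming) triangulation of $K$. $V^L(K):=\{u\in H^2(K): u(p_i)=0,\ i=1,2,3\}$. The Fujino--Morley finite element space $V_h^{FM}(K)$ is the set of piecewise functions $u_h$ with $u_h|_T\in P_2(T)$ (polynomials of degree at most 2) for all $T\in\mathcal{T}^h$, $u_h(p_i)=0$ for $i=1,2,3$, $u_h$ continuous at each vertex of $\mathcal{T}^h$, and $\int_e \frac{\partial u_h}{\partial n}\,ds$ continuous across each interior edge $e$ of $\mathcal{T}^h$ (the value from both sides agrees, for a fixed unit normal $n$ of $e$). For functions that are piecewise $H^2$ with respect to $\mathcal{T}^h$, set $\langle u,v\rangle_h:=\sum_{T\in\mathcal{T}^h}\int_T D^2u\cdot D^2v\,dT$ with $D^2u=(u_{xx},u_{xy},u_{yx},u_{yy})$, and $|u|_{2,K}:=\sqrt{\langle u,u\rangle_h}$ (for $u\in H^2(K)$ this is the usual $H^2$-seminorm). $\|\cdot\|_{\infty,K}$ is the $L^\infty(K)$-norm. For $u\in V^L(K)$, the Fujino--Morley interpolant $\Pi_h^{FM}u\in V_h^{FM}(K)$ is the function with $\Pi_h^{FM}u|_T\in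 P_2(T)$ for each $T\in\mathcal{T}^h$ and such that, for each $T\in\mathcal{T}^h$, $(u-\Pi_h^{FM}u)(q)=0$ at each vertex $q$ of $T$ and $\int_e\frac{\partial}{\partial n}(u-\Pi_h^{FM}u|_T)\,ds=0$ for each edge $e$ of $T$. Define (over nonzero functions) $$\lambda(K):=\inf_{u\in V^L(K)}\frac{|u|_{2,K}^2}{\|u\|_{\infty,K}^2},\qquad \lambda_h(K):=\min_{u_h\in V_h^{FM}(K)}\frac{|u_h|_{2,K}^2}{\|u_h\|_{\infty,K}^2}.$$ *)

(* Defs.v *)
From HB Require Import structures.
From mathcomp Require Import all_boot all_order all_algebra.
From mathcomp Require Import all_classical all_reals all_analysis.

Set Implicit Arguments.
Unset Strict Implicit.
Unset Printing Implicit Defensive.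
Import Order.TTheory GRing.Theory Num.Theory.
Import numFieldNormedType.Exports.
Local Open Scope classical_set_scope.
Local Open Scope ring_scope.

(* Geometry. A triangle is given by its three vertices. *)

Definition triangle (R : realType) := 'I_3 -> R * R.

Section Geometry.
Context {R : realType}.
Implicit Types (K : triangle R) (a b : R * R).

Definition nondegenerate_triangle K : Prop :=
  let a := K 0 in let b := K 1 in let c := K 2%:R in
  (b.1 - a.1) * (c.2 - a.2) - (b.2 - a.2) * (c.1 - a.1) != 0.

Definition hull K : set (R * R) :=
  [set x | exists l : 'I_3 -> R,
     [/\ forall i, 0 <= l i, \sum_i l i = 1,
         x.1 = \sum_i l i * (K i).1 & x.2 = \sum_i l i * (K i).2]].

(* Weak derivatives and integrals live on the open triangle; the boundary is
   Lebesgue-null. *)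
Definition inner K : set (R * R) := interior (hull K).

Definition on_segment a b (t : R) : R * R :=
  (a.1 + t * (b.1 - a.1), a.2 + t * (b.2 - a.2)).

Definition segment a b : set (R * R) := on_segment a b @` `[0, 1].

Definition edge_length a b : R :=
  Num.sqrt ((b.1 - a.1) ^+ 2 + (b.2 - a.2) ^+ 2).

(* The unit normal fixed by the orientation of the segment from a to b;
   direction 0 is x and direction 1 is y. *)
Definition unit_normal a b (i : 'I_2) : R :=
  (if i == 0 then b.2 - a.2 else a.1 - b.1) / edge_length a b.

(* The last condition is conformity: distinct elements are disjoint, or meet
   in exactly one common vertex, or in exactly one common edge. *)
Definition triangulation K (m : nat) (Th : 'I_m -> triangle R) : Prop :=
  [/\ forall T, nondegenerate_triangle (Th T),
      \bigcup_T hull (Th T) = hull K,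
      forall T S, T != S -> inner (Th T) `&` inner (Th S) = set0
    & forall T S, T != S ->
        [\/ hull (Th T) `&` hull (Th S) = set0,
            exists i j, Th T i = Th S j /\
              hull (Th T) `&` hull (Th S) = [set Th T i]
          | exists i i' j j',
              [/\ i != i', Th T i = Th S j, Th T i' = Th S j'
                & hull (Th T) `&` hull (Th S) = segment (Th T i) (Th T i')]]].

End Geometry.

Section Sobolev.
Context {R : realType}.
Implicit Types (D : set (R * R)) (u v w f : R * R -> R).

Definition area := (@lebesgue_measure R \x @lebesgue_measure R)%E.

Definition partial (i : 'I_2) f (p : R * R) : R :=
  if i == 0 then derive1 (fun x => f (x, p.2)) p.1
  else derive1 (fun y => f (p.1, y)) p.2.

Definition has_partial (i : 'I_2) f (p : R * R) : Prop :=
  if i == 0 then derivable (fun x => f (x, p.2)) p.1 1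
  else derivable (fun y => f (p.1, y)) p.2 1.

(* C^infinity on the whole plane. *)
Definition smooth f : Prop :=
  forall s : seq 'I_2, let g := foldr partial f s in
    continuous g /\ forall i p, has_partial i g p.

Definition test_function D f : Prop :=
  [/\ smooth f, compact (closure [set p | f p != 0])
    & closure [set p | f p != 0] `<=` D].

Definition L2 D f : Prop := f \_ D \in Lfun area 2%:E.

Definition weak_partial D (i : 'I_2) u v : Prop :=
  forall phi, test_function D phi ->
    \int[area]_(p in D) (u p * partial i phi p) =
    - \int[area]_(p in D) (v p * phi p).

(* The weak partial derivative in L^2(D), as a function; it is determined
   almost everywhere on D whenever it exists. *)
Definition wpartial D (i : 'I_2) u : R * R -> R :=
  xget (fun=> 0) [set v | L2 D v /\ weak_partial D i u v].

Definition H1 D u : Prop :=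
  L2 D u /\ forall i, exists v, L2 D v /\ weak_partial D i u v.

Definition H2 D u : Prop := H1 D u /\ forall i, H1 D (wpartial D i u).

Definition H1norm2 D u : R :=
  \int[area]_(p in D) (u p ^+ 2) +
  \sum_i \int[area]_(p in D) (wpartial D i u p ^+ 2).

(* Integral over D of D^2 u . D^2 v, where D^2 u = (u_xx, u_xy, u_yx, u_yy). *)
Definition hess_prod D u v : R :=
  \int[area]_(p in D) (\sum_i \sum_j
    wpartial D j (wpartial D i u) p * wpartial D j (wpartial D i v) p).

Definition H2seminorm D u : R := Num.sqrt (hess_prod D u u).

Definition Linf D u : R :=
  fine (Lnorm area +oo%E (EFin \o (u \_ D))).

(* The trace of w in H^1(T) on the edge [a, b] of T, parametrized by
   t in [0, 1]: the value at w of the continuous extension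
   H^1(T) -> L^2([a, b]) of the restriction of smooth functions. *)
Definition is_trace (T : triangle R) (a b : R * R) w (g : R -> R) : Prop :=
  g \_ `[0, 1] \in Lfun (@lebesgue_measure R) 2%:E /\
  exists phi : nat -> R * R -> R,
    [/\ forall k, smooth (phi k),
        (fun k => H1norm2 (inner T) (phi k \- w)) @ \oo --> (0 : R)
      & (fun k => \int[@lebesgue_measure R]_(t in `[0, 1])
            ((phi k (on_segment a b t) - g t) ^+ 2)) @ \oo --> (0 : R)].

Definition trace T a b w : R -> R := xget (fun=> 0) (is_trace T a b w).

(* The integral over e = [a, b] of du/dn with respect to arc length, with u
   regarded as a function on the triangle T. *)
Definition edge_flux (T : triangle R) (a b : R * R) u : R :=
  \int[@lebesgue_measure R]_(t in `[0, 1])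
    ((\sum_i unit_normal a b i * trace T a b (wpartial (inner T) i u) t)
     * edge_length a b).

End Sobolev.

Section FujinoMorley.
Context {R : realType}.
Variable K : triangle R.

(* H^2 functions are represented by their continuous representatives on the
   closed triangle (Sobolev embedding), which gives u (K i) its meaning. *)
Definition VL (u : R * R -> R) : Prop :=
  [/\ {within hull K, continuous u}, H2 (inner K) u & forall i, u (K i) = 0].

Definition lambda : R :=
  inf [set H2seminorm (inner K) u ^+ 2 / Linf (hull K) u ^+ 2
      | u in [set u | VL u /\ exists2 p, hull K p & u p != 0]].

Variables (m : nat) (Th : 'I_m -> triangle R).

(* A piecewise function is a family: w T is its restriction to the element
   Th T, so that it has one value per element at points of common edges. *)
Definition piecewise := 'I_m -> R * R -> R.

(* The a.e. defined function on K given by a piecewise function. *)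
Definition glued (w : piecewise) (p : R * R) : R :=
  \sum_T (w T \_ (inner (Th T))) p.

Definition prod_h (u v : piecewise) : R :=
  \sum_T hess_prod (inner (Th T)) (u T) (v T).

Definition seminorm_h (w : piecewise) : R := Num.sqrt (prod_h w w).

Definition P2 (T : triangle R) (f : R * R -> R) : Prop :=
  exists c0 c1 c2 c3 c4 c5 : R, forall p, hull T p ->
    f p = c0 + c1 * p.1 + c2 * p.2
        + c3 * p.1 ^+ 2 + c4 * (p.1 * p.2) + c5 * p.2 ^+ 2.

Definition VFM (w : piecewise) : Prop :=
  [/\ forall T, P2 (Th T) (w T),
      forall T i k, Th T i = K k -> w T (Th T i) = 0,
      forall T S i j, Th T i = Th S j -> w T (Th T i) = w S (Th S j)
    & forall T S i i' j j', T != S -> i != i' ->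
        Th T i = Th S j -> Th T i' = Th S j' ->
        edge_flux (Th T) (Th T i) (Th T i') (w T) =
        edge_flux (Th S) (Th T i) (Th T i') (w S)].

(* The infimum is a minimum, the space VFM being finite-dimensional. *)
Definition lambda_h : R :=
  inf [set seminorm_h w ^+ 2 / Linf (hull K) (glued w) ^+ 2
      | w in [set w | VFM w /\ exists T, exists2 p, hull (Th T) p & w T p != 0]].

Definition is_FM_interpolant (u : R * R -> R) (w : piecewise) : Prop :=
  [/\ VFM w,
      forall T i, u (Th T i) - w T (Th T i) = 0
    & forall T i j, i != j ->
        edge_flux (Th T) (Th T i) (Th T j) (u \- w T) = 0].

Definition FM_interpolant (u : R * R -> R) : piecewise :=
  xget (fun _ _ => 0) (is_FM_interpolant u).

Definition FM_error (u : R * R -> R) : piecewise :=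
  fun T => u \- FM_interpolant u T.

End FujinoMorley.

(* Main.v *)
From HB Require Import structures.
Require Import Defs.
From mathcomp Require Import all_boot all_order all_algebra.
From mathcomp Require Import all_classical all_reals all_analysis.
From mathcomp Require Import measurable_realfun ess_sup_inf.
From mathcomp Require Import ring lra.

Set Implicit Arguments.
Unset Strict Implicit.
Unset Printing Implicit Defensive.
Import Order.TTheory GRing.Theory Num.Theory.
Import numFieldNormedType.Exports.
Local Open Scope classical_set_scope.
Local Open Scope ring_scope.

(** Let [w] be the interpolant of [u], with [e = u - w] the error. The second
    derivatives of [e] have mean value zero on every element [T], and those of [w] are
    constant on [T], so that [D^2 e] and [D^2 w] are orthogonal and
    [|u|^2 = |w|^2 + |e|^2] on each element. With [|u|_oo <= |w|_oo + |e|_oo], the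
    assumption on [e] and the definition of [lambda_h] on [w], this bounds [|u|_oo]
    in terms of [|u|]; optimizing by the Cauchy-Schwarz inequality
    ([combine_bounds]) gives the stated quotient. If [u] has no interpolant, the
    default value [w = 0] satisfies the same relations ([interpolant_cases]).

    The substance is the vanishing of the mean values of [D^2 e]
    ([hessian_mean_eq0]). By the divergence theorem they are combinations of the mean
    values of the first derivatives of [e] over the edges. On an edge the mean of the
    normal derivative is the flux, which is zero for the interpolation error, and
    the mean of the tangential derivative is the difference of the values of [e] at the
    endpoints, which are zero.

    As the first derivatives of [e] are only in [H^1] and the traces in the flux are
    limits of restrictions of smooth functions, this needs density of smooth functions
    and a trace inequality. For the former, [e] is contracted towards the centroid
    of the triangle and then convolved with a smooth kernel of small support
    ([approx]). The result is smooth on the whole plane. At the points of the closed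
    triangle the kernels are test functions, so that its derivatives there are the
    mollified weak derivatives up to the contraction factor ([partial_approx]), and
    everything converges in square mean ([mollify_cvg]) because composition with small
    homotheties is continuous in square mean ([perturb_L2]). The same kernels show
    that weak derivatives are unique up to null sets ([weak_partial_unique]). The trace
    inequality ([trace_inequality]) is the divergence theorem for the square of a
    function times a barycentric coordinate; together with completeness
    ([square_integrable_complete]) it yields the existence of traces and the convergence
    of their integrals ([trace_integral_cvg]). *)

(** * Lebesgue measure on the plane *)

Section Plane.
Context {R : realType}.
Notation mu := (@lebesgue_measure R).

(** The rescaled pushforward agrees with Lebesgue measure on intervals, hence everywhere. *)
Lemma lebesgue_measure_affine (a b : R) (A : set R) : a != 0 -> measurable A ->
  mu ((fun x => a * x + b) @^-1` A) = (`|a|^-1%:E * mu A)%E.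
Proof.
move=> a0 mA.
pose phi : measurableTypeR R -> measurableTypeR R := fun x => a * x + b.
have mphi : measurable_fun setT phi.
  by apply: measurable_funD => //; exact: measurable_funM.
have ha : 0 <= `|a| by [].
have a_gt0 : 0 < `|a| by rewrite normr_gt0.
pose P0 := (Measure.clone _ _ _ (pushforward mu phi) _).
pose P : {measure set (measurableTypeR R) -> \bar R} := P0 mphi.
have E : mu A = mscale (NngNum ha) P A.
  apply: lebesgue_measure_unique mA => X [[u v]] _ <-.
  change (mu `]u, v]%classic = `|a|%:E * mu (phi @^-1` `]u, v]%classic))%E.
  have [uv|vu] := ltP u v; last first.
    by rewrite set_itv_ge ?bnd_simp -?leNgt// preimage_set0 !measure0 mule0.
  have [a1|a1] := ltP 0 a.
    have -> : phi @^-1` `]u, v]%classic = `](u - b) / a, (v - b) / a]%classic.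
      apply/seteqP; split=> x; rewrite /= !in_itv/= ltr_pdivrMr// ler_pdivlMr//;
        by rewrite mulrC ltrBlDr lerBrDr.
    rewrite !lebesgue_measure_itv/= !lte_fin uv ltr_pM2r ?invr_gt0// ltrD2r uv.
    rewrite -!EFinB -EFinM gtr0_norm//; congr EFin; field.
    by rewrite gt_eqF.
  have {}a1 : a < 0 by rewrite lt_neqAle a0.
  have -> : phi @^-1` `]u, v]%classic = `[(v - b) / a, (u - b) / a[%classic.
    apply/seteqP; split=> x; rewrite /= !in_itv/= ltr_ndivlMr// ler_ndivrMr//;
      by rewrite (mulrC x) ltrBlDr lerBrDr andbC.
  rewrite !lebesgue_measure_itv/= !lte_fin uv ltr_nM2r ?invr_lt0// ltrD2r uv.
  rewrite -!EFinB -EFinM ltr0_norm//; congr EFin; field.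
  by rewrite lt_eqF.
rewrite E /mscale/= muleA -EFinM mulVf ?mul1e//.
by rewrite gt_eqF.
Qed.

Lemma ge0_integral_affine (a b : R) (f : R -> \bar R) : a != 0 ->
  measurable_fun [set: R] f -> (forall x, 0 <= f x)%E ->
  (\int[mu]_x f (a * x + b)%R = (`|a|^-1)%:E * \int[mu]_x f x)%E.
Proof.
move=> a0 mf f0.
pose phi : measurableTypeR R -> measurableTypeR R := fun x => a * x + b.
have mphi : measurable_fun setT phi.
  by apply: measurable_funD => //; exact: measurable_funM.
have ha : 0 <= `|a|^-1 by rewrite invr_ge0.
have := @ge0_integral_pushforward _ _ _ _ _ phi mphi mu setT f measurableT mf.
rewrite preimage_setT /= => <-; last by move=> x _; exact: f0.
transitivity (\int[mscale (NngNum ha) mu]_x f x)%E.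
  by apply: eq_measure_integral => //= A mA _; exact: lebesgue_measure_affine.
by rewrite ge0_integral_mscale.
Qed.

Lemma measurable_affine2 (a b c d e f : R) :
  measurable_fun [set: R * R]
    (fun p : R * R => (a * p.1 + b * p.2 + e, c * p.1 + d * p.2 + f)).
Proof.
by apply/measurable_fun_pair => /=; apply: measurable_funD => //;
  apply: measurable_funD; apply: measurable_funM.
Qed.

(** One substitution in each variable, after a shear, when the corner entry of
    the matrix does not vanish; otherwise the two variables are swapped first. *)
Lemma ge0_integral_area_affine (a b c d e f : R) (F : R * R -> \bar R) :
  a * d - b * c != 0 ->
  measurable_fun [set: R * R] F -> (forall x, 0 <= F x)%E ->
  (\int[area]_p F (a * p.1 + b * p.2 + e, c * p.1 + d * p.2 + f)%R =
   (`|a * d - b * c|^-1)%:E * \int[area]_p F p)%E.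
Proof.
move=> D0 mF F0.
have key : forall (a b c d e f : R) (G : R * R -> \bar R),
  a * d - b * c != 0 -> a != 0 ->
  measurable_fun [set: R * R] G -> (forall x, 0 <= G x)%E ->
  (\int[mu]_y \int[mu]_x G (a * x + b * y + e, c * x + d * y + f)%R =
   (`|a * d - b * c|^-1)%:E * \int[area]_p G p)%E.
  move=> {D0 mF F0} {}a {}b {}c {}d {}e {}f G D0 a0 mG G0.
  pose D := (a * d - b * c) / a.
  have D1 : D != 0 by rewrite mulf_neq0// invr_eq0.
  pose k := f - c * e / a.
  pose H (p : R * R) := G (p.1, (c / a) * p.1 + D * p.2 + k).
  have mH : measurable_fun [set: R * R] H.
    apply: measurableT_comp => //.
    under eq_fun do rewrite -[X in (X, _)]addr0 -[X in (X + 0, _)]addr0.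
    have := measurable_affine2 1 0 (c / a) D 0 k.
    by under eq_fun do rewrite mul1r mul0r.
  have H0 p : (0 <= H p)%E by exact: G0.
  transitivity (\int[mu]_y ((`|a|^-1)%:E * \int[mu]_x H (x, y)))%E.
    apply: eq_integral => y _.
    rewrite -(@ge0_integral_affine a (b * y + e) (fun x => H (x, y)))//; last first.
      by apply: measurableT_comp => //; exact: measurable_pair2.
    apply: eq_integral => x _; rewrite /H/=; congr (G (_, _)).
      by rewrite addrA.
    by rewrite /D /k; field.
  rewrite ge0_integralZl//; last 2 first.
    by apply: measurable_fun_fubini_tonelli_G.
    by move=> y _; exact: integral_ge0.
  rewrite -(@fubini_tonelli2 _ _ _ _ _ mu mu H)//.
  rewrite fubini_tonelli1//.
  transitivity ((`|a|^-1)%:E * \int[mu]_x ((`|D|^-1)%:E * \int[mu]_y G (x, y)))%E.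
    congr (_ * _)%E; apply: eq_integral => x _.
    rewrite -(@ge0_integral_affine D (c / a * x + k) (fun y => G (x, y)))//; last first.
      by apply: measurableT_comp => //; exact: measurable_pair1.
    apply: eq_integral => y _; rewrite /H/=; congr (G (_, _)).
    by rewrite -addrA addrCA.
  rewrite ge0_integralZl//; last 2 first.
    by apply: measurable_fun_fubini_tonelli_F.
    by move=> y _; exact: integral_ge0.
  rewrite -fubini_tonelli1// muleA -EFinM /D normrM normfV invfM invrK.
  by rewrite mulrCA mulVf ?mulr1// normr_eq0.
have mF1 : measurable_fun [set: R * R]
    (fun p : R * R => F (a * p.1 + b * p.2 + e, c * p.1 + d * p.2 + f)).
  by apply: measurableT_comp => //; exact: measurable_affine2.
have [a0|a0] := eqVneq a 0; last first.
  by rewrite /area fubini_tonelli2//= key.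
have b0 : b != 0 by apply: contra D0 => /eqP ->; rewrite a0 !mul0r subrr.
rewrite /area fubini_tonelli1//=.
transitivity (\int[mu]_x \int[mu]_y F (b * y + a * x + e, d * y + c * x + f)%R)%E.
  by apply: eq_integral => x _; apply: eq_integral => y _; congr (F (_, _)); congr (_ + _); rewrite addrC.
rewrite key//; last by rewrite -oppr_eq0 opprB mulrC (mulrC d).
by rewrite -normrN opprB.
Qed.

(** An open set is the countable union of the boxes with rational corners that it contains. *)
Lemma open_measurable2 (A : set (R * R)) : open A -> measurable A.
Proof.
move=> oA.
pose box (q : (rat * rat) * (rat * rat)) : set (R * R) :=
  `](ratr q.1.1), (ratr q.1.2)[%classic `*` `](ratr q.2.1), (ratr q.2.2)[%classic.
have -> : A = \bigcup_(q in [set q | box q `<=` A]) box q.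
  apply/seteqP; split => [[x y] Axy|p [q /= qA qp]]; last exact: qA.
  have [[U V] /= [nU nV] UV] : nbhs (x, y) A by apply: open_nbhs_nbhs; split.
  have H (z : R) (W : set R) : nbhs z W -> exists q : rat * rat,
      `](ratr q.1), (ratr q.2)[%classic `<=` W /\ `](ratr q.1), (ratr q.2)[%classic z.
    move=> /nbhs_ballP[e /= e0 eW].
    have [|q1 /andP[q1a q1b]] := @rat_in_itvoo R (z - e) z; first by rewrite ltrBlDr ltrDl.
    have [|q2 /andP[q2a q2b]] := @rat_in_itvoo R z (z + e); first by rewrite ltrDl.
    exists (q1, q2); split => [w|] /=; rewrite in_itv/=;
      last by move: q1b q2a; rewrite !bnd_simp => -> ->.
    move=> /andP[w1 w2]; apply: eW; rewrite /ball/= ltr_norml.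
    move: q1a q2b; rewrite !bnd_simp => q1a q2b; apply/andP; split; lra.
  have [q1 [q1U q1x]] := H x U nU; have [q2 [q2V q2y]] := H y V nV.
  exists (q1, q2) => //= -[a b] [/= a1 b1]; apply: UV; split => /=.
    exact: q1U.
  exact: q2V.
rewrite bigcup_mkcond; apply: countable_bigcupT_measurable => // q.
case: ifPn => // _; apply: measurableX; exact: measurable_itv.
Qed.

Lemma continuous_measurable_fun2 (f : R * R -> R) :
  continuous f -> measurable_fun [set: R * R] f.
Proof.
move=> /continuousP cf; apply: (measurability _ (RGenOpens.measurableE R)).
move=> _ [_ [a [b ->] <-]]; rewrite setTI; apply: open_measurable2.
exact/cf/interval_open.
Qed.

Lemma area_setX (A B : set R) : measurable A -> measurable B ->
  area (A `*` B) = (mu A * mu B)%E.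
Proof. by move=> mA mB; exact: product_measure1E. Qed.

Lemma area_indic (A : set (R * R)) : measurable A ->
  area A = (\int[area]_p (\1_A p)%:E)%E.
Proof. by move=> mA; rewrite /area integral_indic// setIT. Qed.

Lemma area_le (A B : set (R * R)) : measurable A -> measurable B -> A `<=` B ->
  (area A <= area B)%E.
Proof. by move=> mA mB AB; apply: le_measure; rewrite ?inE. Qed.

Lemma area_setU (A B : set (R * R)) : measurable A -> measurable B ->
  (area (A `|` B) <= area A + area B)%E.
Proof. by move=> mA mB; exact: measureU2. Qed.

(** A vertical line is the product of a point and the real line; any other line meets each
    vertical line in one point. *)
Lemma area_line0 (a b c : R) : (a != 0) || (b != 0) ->
  area [set p : R * R | a * p.1 + b * p.2 + c = 0] = 0%E.
Proof.
move=> ab.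
pose L := [set p : R * R | a * p.1 + b * p.2 + c = 0].
rewrite -/L; have [b0|b0] := eqVneq b 0.
  have a0 : a != 0 by move: ab; rewrite b0 eqxx orbF.
  have -> : L = [set - c / a] `*` [set: R].
    apply/seteqP; split => -[x y]; rewrite /L/= b0 mul0r addr0.
      move=> xy; split => //; apply: (mulfI a0); rewrite mulrCA mulfV// mulr1.
      by apply/eqP; rewrite -addr_eq0 xy.
    by move=> [-> _]; rewrite mulrCA mulfV// mulr1 addNr.
  by rewrite area_setX// lebesgue_measure_set1 mul0e.
rewrite /area /product_measure1/= integral0_eq// => x _.
rewrite [X in mu X](_ : _ = [set - (a * x + c) / b]); first exact: lebesgue_measure_set1.
apply/seteqP; split => y; rewrite /xsection/= inE /=.
  move=> xy; apply: (mulfI b0); rewrite mulrCA mulfV// mulr1.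
  by rewrite /L/= in xy; lra.
by move=> ->; rewrite /L/=; field.
Qed.

End Plane.

(** * Square integrable functions *)

Section SquareIntegrable.
Context d (T : measurableType d) (R : realType).
Variables (mu : {measure set T -> \bar R}) (D : set T).
Hypothesis mD : measurable D.
Implicit Types f g h : T -> R.

Notation rint f := (mu.-integrable D (EFin \o f)).

Definition square_integrable f :=
  measurable_fun D f /\ rint (fun x => f x ^+ 2).

Lemma rint_measurable f : rint f -> measurable_fun D f.
Proof. by move=> /measurable_int /measurable_EFinP. Qed.

Lemma rint_cst0 : rint (fun=> 0).
Proof. exact: integrable0. Qed.

Lemma rintD f g : rint f -> rint g -> rint (fun x => f x + g x).
Proof. by move=> rf rg; exact: (integrableD mD rf rg). Qed.

Lemma rintB f g : rint f -> rint g -> rint (fun x => f x - g x).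
Proof. by move=> rf rg; exact: (integrableB mD rf rg). Qed.

Lemma rintZ (c : R) f : rint f -> rint (fun x => c * f x).
Proof. by move=> rf; exact: (integrableZl mD c rf). Qed.

Lemma rint_le f g : measurable_fun D f -> (forall x, D x -> `|f x| <= g x) ->
  rint g -> rint f.
Proof.
move=> mf fg rg; apply: (le_integrable mD _ _ rg); first exact/measurable_EFinP.
by move=> x Dx; rewrite /= lee_fin (le_trans (fg _ Dx))// ler_norm.
Qed.

Lemma rint_big (I : Type) (r : seq I) (F : I -> T -> R) : (forall i, rint (F i)) ->
  rint (fun x => \sum_(i <- r) F i x).
Proof.
move=> rF; elim: r => [|i r IH].
  by under [_ \o _]eq_fun do rewrite /= big_nil; exact: rint_cst0.
by under [_ \o _]eq_fun do rewrite /= big_cons; exact: rintD.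
Qed.

Lemma Rintegral_sum (I : finType) (F : I -> T -> R) : (forall i, rint (F i)) ->
  \int[mu]_(x in D) (\sum_i F i x) = \sum_i \int[mu]_(x in D) F i x.
Proof.
move=> rF.
elim: (index_enum I) => [|i r IH].
  by rewrite big_nil; under eq_Rintegral do rewrite big_nil; rewrite Rintegral_cst// mul0r.
rewrite big_cons -IH -RintegralD//; last exact: rint_big.
by apply: eq_Rintegral => x _; rewrite big_cons.
Qed.

Lemma Rintegral_linear (x y : R) f g : rint f -> rint g ->
  \int[mu]_(t in D) (x * f t + y * g t) = x * \int[mu]_(t in D) f t + y * \int[mu]_(t in D) g t.
Proof.
by move=> rf rg; rewrite RintegralD ?RintegralZl//; exact: rintZ.
Qed.

Lemma square_integrable_mul f g :
  square_integrable f -> square_integrable g -> rint (fun x => f x * g x).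
Proof.
move=> [mf rf] [mg rg]; apply: rint_le (rintD rf rg); first exact: measurable_funM.
move=> x _; rewrite ler_norml; apply/andP; split; nra.
Qed.

Lemma square_integrableD f g : square_integrable f -> square_integrable g ->
  square_integrable (fun x => f x + g x).
Proof.
move=> [mf rf] [mg rg]; split; first exact: measurable_funD.
apply: rint_le (rintZ 2 (rintD rf rg)).
  by apply: measurable_funX; exact: measurable_funD.
move=> x _; rewrite ger0_norm ?sqr_ge0// -subr_ge0.
by rewrite (_ : _ - _ = (f x - g x) ^+ 2) ?sqr_ge0//; ring.
Qed.

Lemma square_integrableZ (c : R) f : square_integrable f ->
  square_integrable (fun x => c * f x).
Proof.
move=> [mf rf]; split; first exact: measurable_funM.
by under [_ \o _]eq_fun do rewrite /= exprMn; exact: rintZ.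
Qed.

Lemma square_integrableB f g : square_integrable f -> square_integrable g ->
  square_integrable (fun x => f x - g x).
Proof.
move=> sf sg.
have := square_integrableD sf (square_integrableZ (-1) sg).
by under eq_fun do rewrite mulN1r.
Qed.

Lemma square_integrable_rint f : (mu D < +oo)%E -> square_integrable f -> rint f.
Proof.
move=> Dfin [mf rf].
have r1 : rint (fun=> 1).
  by apply: measurable_bounded_integrable => //; exact: bounded_cst.
apply: rint_le (rintD r1 rf) => // x _.
rewrite ler_norml; apply/andP; split; nra.
Qed.

Lemma bounded_square_integrable f (M : R) : (mu D < +oo)%E ->
  measurable_fun D f -> (forall x, D x -> `|f x| <= M) -> square_integrable f.
Proof.
move=> Dfin mf fM; split => //.
have r1 : rint (fun=> M ^+ 2).
  by apply: measurable_bounded_integrable => //; exact: bounded_cst.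
apply: rint_le r1; first exact: measurable_funX.
by move=> x Dx; rewrite normrX ler_sqr ?nnegrE// ?fM// (le_trans _ (fM _ Dx)).
Qed.

(** The quadratic form in (t, s) given by the square mean of t f + s g is nonnegative, so its
    discriminant is not positive. *)
Lemma cauchy_schwarz f g : square_integrable f -> square_integrable g ->
  (\int[mu]_(x in D) (f x * g x)) ^+ 2 <=
  \int[mu]_(x in D) (f x ^+ 2) * \int[mu]_(x in D) (g x ^+ 2).
Proof.
move=> sf sg; set A := \int[mu]_(x in D) (f x ^+ 2).
set B := \int[mu]_(x in D) (g x ^+ 2); set C := \int[mu]_(x in D) (f x * g x).
have rf := sf.2; have rg := sg.2; have rfg := square_integrable_mul sf sg.
have q (t s : R) : 0 <= t ^+ 2 * A + (2 * t * s) * C + s ^+ 2 * B.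
  rewrite -!RintegralZl// -?RintegralD//.
  - apply: Rintegral_ge0 => x _.
    have -> : t ^+ 2 * f x ^+ 2 + 2 * t * s * (f x * g x) + s ^+ 2 * g x ^+ 2 =
      (t * f x + s * g x) ^+ 2 by ring.
    exact: sqr_ge0.
  - by apply: rintD; apply: rintZ.
  - exact: rintZ.
  - exact: rintZ.
  - exact: rintZ.
have A0 : 0 <= A by apply: Rintegral_ge0 => x _; exact: sqr_ge0.
have B0 : 0 <= B by apply: Rintegral_ge0 => x _; exact: sqr_ge0.
have [B1|B1] := eqVneq B 0.
  have [->|C0] := eqVneq C 0; first by rewrite expr0n mulr_ge0.
  exfalso; have := q 1 (- (A + 1) / (2 * C)).
  rewrite B1 mulr0 addr0 expr1n mul1r mulr1.
  have -> : 2 * (- (A + 1) / (2 * C)) * C = - (A + 1) by field.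
  by lra.
have {}B1 : 0 < B by rewrite lt_neqAle eq_sym B1.
have := q B (- C).
have -> : B ^+ 2 * A + 2 * B * - C * C + (- C) ^+ 2 * B = B * (A * B - C ^+ 2) by ring.
by rewrite pmulr_rge0// subr_ge0.
Qed.

Lemma square_integral_add f g : square_integrable f -> square_integrable g ->
  \int[mu]_(x in D) ((f x + g x) ^+ 2) <=
  2 * \int[mu]_(x in D) (f x ^+ 2) + 2 * \int[mu]_(x in D) (g x ^+ 2).
Proof.
move=> sf sg; have rf := sf.2; have rg := sg.2.
rewrite -!RintegralZl// -RintegralD//; try exact: rintZ.
apply: le_Rintegral => //.
- exact: (square_integrableD sf sg).2.
- by apply: rintD; exact: rintZ.
- move=> x _; rewrite -subr_ge0.
  by rewrite (_ : _ - _ = (f x - g x) ^+ 2) ?sqr_ge0//; ring.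
Qed.

Lemma square_integral_sub f g : square_integrable f -> square_integrable g ->
  \int[mu]_(x in D) ((f x - g x) ^+ 2) <=
  2 * \int[mu]_(x in D) (f x ^+ 2) + 2 * \int[mu]_(x in D) (g x ^+ 2).
Proof.
move=> sf sg.
have := square_integral_add sf (square_integrableZ (-1) sg).
under eq_Rintegral do rewrite mulN1r.
by under [X in _ <= _ + _ * X]eq_Rintegral do rewrite mulN1r sqrrN.
Qed.

Lemma square_integral_eq0 f : square_integrable f ->
  \int[mu]_(x in D) (f x ^+ 2) = 0 -> {ae mu, forall x, D x -> f x = 0}.
Proof.
move=> [mf rf] f0.
have : ae_eq mu D (fun x => (f x ^+ 2)%:E) (cst 0%E).
  apply/(ae_eq_integral_abs mu mD); first by apply/measurable_EFinP; exact: measurable_funX.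
  under eq_integral do rewrite /= ger0_norm ?sqr_ge0//.
  rewrite -[LHS]fineK; first by rewrite [fine _]f0.
  exact: (integrable_fin_num mD rf).
by apply: filterS => x /= + Dx => /(_ Dx) [] /eqP; rewrite expf_eq0/= => /eqP.
Qed.

Lemma ae_eq_Rintegral f g : measurable_fun D f -> measurable_fun D g ->
  {ae mu, forall x, D x -> f x = g x} ->
  \int[mu]_(x in D) f x = \int[mu]_(x in D) g x.
Proof.
move=> mf mg fg; congr fine; apply: ae_eq_integral => //; try exact/measurable_EFinP.
by apply: filterS fg => x /= + Dx => /(_ Dx) ->.
Qed.

(** Square-mean convergence passes to the integrals against a square
    integrable function, by the Cauchy-Schwarz inequality. *)
Lemma cvg_Rintegral_mul (F : nat -> T -> R) f g :
  (forall k, square_integrable (F k)) -> square_integrable f ->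
  square_integrable g ->
  \int[mu]_(x in D) ((F k x - f x) ^+ 2) @[k --> \oo] --> (0 : R) ->
  \int[mu]_(x in D) (F k x * g x) @[k --> \oo] --> \int[mu]_(x in D) (f x * g x).
Proof.
move=> sF sf sg Ff; apply/cvgrPdist_lt => e e0.
set B := \int[mu]_(x in D) (g x ^+ 2).
have B0 : 0 <= B by apply: Rintegral_ge0 => x _; exact: sqr_ge0.
have e1 : 0 < e ^+ 2 / (B + 1) by rewrite divr_gt0 ?exprn_gt0// ltr_wpDl.
move/cvgrPdist_lt : Ff => /(_ _ e1); apply: filterS => k.
rewrite sub0r normrN ger0_norm; last by apply: Rintegral_ge0 => x _; exact: sqr_ge0.
move=> H; rewrite distrC -RintegralB//; try exact: square_integrable_mul.
have sd := square_integrableB (sF k) sf.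
rewrite (@eq_Rintegral _ _ _ _ _ (fun x => (F k x - f x) * g x)); last first.
  by move=> x _; rewrite mulrBl.
suff h : (\int[mu]_(x in D) ((F k x - f x) * g x)) ^+ 2 < e ^+ 2.
  by move: h; rewrite -[X in X < _]real_normK ?num_real// ltr_sqr ?nnegrE// ltW.
apply: le_lt_trans (cauchy_schwarz sd sg) _; rewrite -/B.
apply: (@le_lt_trans _ _ (\int[mu]_(x in D) (F k x - f x) ^+ 2 * (B + 1))).
  by rewrite ler_wpM2l ?lerDl// Rintegral_ge0// => x _; exact: sqr_ge0.
by rewrite -ltr_pdivlMr// ltr_wpDl.
Qed.

Lemma square_integrable_cst1 : (mu D < +oo)%E -> square_integrable (fun=> 1).
Proof.
by move=> Dfin; apply: (@bounded_square_integrable _ 1) => // x _; rewrite normr1.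
Qed.

Lemma cvg_Rintegral_L2 (F : nat -> T -> R) f : (mu D < +oo)%E ->
  (forall k, square_integrable (F k)) -> square_integrable f ->
  \int[mu]_(x in D) ((F k x - f x) ^+ 2) @[k --> \oo] --> (0 : R) ->
  \int[mu]_(x in D) F k x @[k --> \oo] --> \int[mu]_(x in D) f x.
Proof.
move=> Dfin sF sf Ff.
have := cvg_Rintegral_mul sF sf (square_integrable_cst1 Dfin) Ff.
under eq_Rintegral do rewrite mulr1.
by under [X in X @ _]eq_fun do under eq_Rintegral do rewrite mulr1.
Qed.

(** Extension by zero turns the integrals over [D] into integrals over the whole space, on
    which the L^2 spaces are defined. *)
Lemma Lfun2P f : (f \_ D \in Lfun mu 2%:E) <-> square_integrable f.
Proof.
have sqE : (fun x => (f \_ D) x ^+ 2) = (fun x => f x ^+ 2) \_ D.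
  by apply/funext => x; rewrite !patchE; case: ifPn => //; rewrite expr0n.
have rE : rint (fun x => f x ^+ 2) <->
    mu.-integrable setT (EFin \o (fun x => (f \_ D) x ^+ 2)).
  by rewrite sqE -restrict_EFin -(integrable_restrict mu mD measurableT) setTI.
split=> [fL|[mf /rE rf]].
  split; last by apply/rE; exact: Lfun2_integrable_sqr.
  apply/(measurable_restrictT f mD).
  by move: fL; rewrite inE => /andP[]; rewrite inE.
have mf' := (measurable_restrictT f mD).1 mf.
rewrite inE; apply/andP; split; rewrite inE//= /finite_norm unlock poweR_lty//.
under eq_integral => x _ do
  rewrite /= (_ : `|(f \_ D) x| `^ 2 = (f \_ D) x ^+ 2)%R ?powR_mulrn ?real_normK ?num_real//.
by apply: integrable_lty.
Qed.

End SquareIntegrable.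

(** * Smooth functions on the plane *)

Section FlatFunction.
Context {R : realType}.
Implicit Types (P : {poly R}) (t x : R).

(** The family P(1/t) exp(-1/t), extended by 0 to t <= 0, is closed under
    differentiation, which makes all its members infinitely differentiable. *)
Definition flat P t : R := if 0 < t then P.[t^-1] * expR (- t^-1) else 0.

Lemma flat_le0 P t : t <= 0 -> flat P t = 0.
Proof. by move=> t0; rewrite /flat ltNge t0. Qed.

Lemma flat_gt0 P t : 0 < t -> flat P t = P.[t^-1] * expR (- t^-1).
Proof. by move=> t0; rewrite /flat t0. Qed.

(** The exponential of 1/t dominates every power of 1/t; this linear bound is what
    differentiability at 0 requires. *)
Lemma flat_bound P : exists2 C : R, 0 <= C & forall t, `|flat P t| <= C * `|t|.
Proof.
exists (\sum_(i < size P) `|P`_i| * (i.+1)`!%:R).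
  by apply: sumr_ge0 => i _; rewrite mulr_ge0.
move=> t; have [t0|t0] := ltP 0 t; last by rewrite flat_le0// normr0 mulr_ge0// sumr_ge0// => i _; rewrite mulr_ge0.
rewrite flat_gt0// horner_coef mulr_suml (le_trans (ler_norm_sum _ _ _))// mulr_suml.
apply: ler_sum => i _; rewrite !normrM -!mulrA ler_wpM2l//.
rewrite (ger0_norm (expR_ge0 _)) (gtr0_norm t0) ger0_norm; last by rewrite exprn_ge0// invr_ge0 ltW.
have s0 : 0 < t^-1 by rewrite invr_gt0.
have H : t^-1 ^+ i.+1 / (i.+1)`!%:R <= expR t^-1.
  by apply: le_trans (expR_ge1Dxn i (ltW s0)); rewrite lerDr.
rewrite ler_pdivrMr ?ltr0n ?fact_gt0// in H.
rewrite expRN ler_pdivrMr ?expR_gt0// -(ler_pM2r s0) -exprSr.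
apply: le_trans H _; rewrite mulrC -!mulrA ler_wpM2l//.
by rewrite mulrCA divff ?mulr1// gt_eqF.
Qed.

Lemma is_derive_flat P t : is_derive t (1 : R) (flat P) (flat ('X^2 * (P - P^`())) t).
Proof.
have [t0|t0|<-] := ltgtP 0 t; last first.
- rewrite flat_le0//.
  have H : h^-1 *: (flat P (h *: 1 + 0) - flat P 0) @[h --> 0^'] --> (0 : R).
    have [C C0 HC] := flat_bound ('X * P).
    apply/cvgrPdist_le => e e0.
    have d0 : 0 < e / (C + 1) by rewrite divr_gt0// ltr_wpDl.
    near=> h.
    rewrite sub0r normrN addr0 (flat_le0 P (lexx 0)) subr0 /GRing.scale/= mulr1.
    apply: (@le_trans _ _ (C * `|h|)).
      apply: le_trans (HC h).
      have [h0|h0] := ltP 0 h; last by rewrite !flat_le0// mulr0 normr0.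
      by rewrite !flat_gt0// hornerM hornerX mulrA.
    apply: (@le_trans _ _ ((C + 1) * `|h|)); first by rewrite ler_wpM2r// lerDl.
    rewrite mulrC -ler_pdivlMr; last by rewrite ltr_wpDl.
    near: h; apply: dnbhs0_le; exact: d0.
  by apply: DeriveDef; [apply/cvg_ex; exists 0|apply: cvg_lim].
- rewrite flat_le0; last exact: ltW.
  apply: (@near_eq_is_derive R R R (cst 0) (flat P) t 1 0).
  by apply: filterS (lt_nbhsl t0) => s s0; rewrite flat_le0// ltW.
- rewrite flat_gt0//.
  apply: (@near_eq_is_derive R R R (fun s => P.[s^-1] * expR (- s^-1))
    (flat P) t 1).
    by apply: filterS (lt_nbhsr t0) => s s0; rewrite flat_gt0.
  have t1 : t != 0 by rewrite gt_eqF.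
  have dV : is_derive t (1 : R) (fun s : R => s^-1) (- t ^- 2 *: 1).
    by apply: is_deriveV => //; exact: is_derive_id.
  have dP := @is_derive1_comp _ (horner P) (fun s : R => s^-1) t _ _ (is_derive_poly P t^-1) dV.
  have dE := @is_derive1_comp _ expR (fun s : R => - s^-1) t _ _ (is_derive_expR (- t^-1)) (is_deriveN dV).
  apply: is_derive_eq (is_deriveM dP dE) _.
  rewrite /GRing.scale/= hornerM hornerXn hornerD hornerN.
  by field.
Unshelve. all: by end_near. Qed.

End FlatFunction.

Section Smooth.
Context {R : realType}.
Implicit Types (f g : R * R -> R) (p : R * R) (i : 'I_2).

(** The partial derivatives are derivatives of such one-variable functions at the point [coord],
    so that both directions can be treated at once. *)
Definition slice i f p : R -> R :=
  fun t => if i == 0 then f (t, p.2) else f (p.1, t).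

Definition coord i p : R := if i == 0 then p.1 else p.2.

Lemma slice_coord i f p : slice i f p (coord i p) = f p.
Proof. by case: p => x y; rewrite /slice /coord; case: (i == 0). Qed.

Lemma has_partialE i f p : has_partial i f p = derivable (slice i f p) (coord i p) 1.
Proof. by rewrite /has_partial /slice /coord; case: ifP. Qed.

Lemma partialE i f p : partial i f p = derive1 (slice i f p) (coord i p).
Proof. by rewrite /partial /slice /coord; case: ifP. Qed.

Lemma is_derive_partial i f p d : is_derive (coord i p) (1 : R) (slice i f p) d ->
  has_partial i f p /\ partial i f p = d.
Proof. by move=> [df dE]; rewrite has_partialE partialE derive1E. Qed.

Lemma partial_is_derive i f p : has_partial i f p ->
  is_derive (coord i p) (1 : R) (slice i f p) (partial i f p).
Proof. by rewrite has_partialE partialE derive1E => h; exact: DeriveDef. Qed.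

(** All partial derivatives of a member of the class are again members, by induction on the order. *)
Lemma smooth_coind (P : (R * R -> R) -> Prop) :
  (forall f, P f -> [/\ continuous f, forall i p, has_partial i f p
                      & forall i, P (partial i f)]) ->
  forall f, P f -> smooth f.
Proof.
move=> HP f Pf s.
have : P (foldr partial f s) by elim: s => //= i s /HP[_ _]; exact.
by move=> /HP[].
Qed.

Lemma smooth_continuous f : smooth f -> continuous f.
Proof. by move=> /(_ [::])[]. Qed.

Lemma smooth_has_partial f i p : smooth f -> has_partial i f p.
Proof. by move=> /(_ [::])[]. Qed.

Lemma smooth_partial f i : smooth f -> smooth (partial i f).
Proof. by move=> sf s; have := sf (rcons s i); rewrite foldr_rcons. Qed.

Lemma smooth_cst (c : R) : smooth (fun=> c).
Proof.
apply: (@smooth_coind (fun f => exists c, f = fun=> c)); last by exists c.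
move=> _ [{}c ->]; have D i p : is_derive (coord i p) (1 : R) (slice i (fun=> c) p) 0.
  rewrite (_ : slice _ _ _ = cst c); first exact: is_derive_cst.
  by apply/funext => t; rewrite /slice; case: ifP.
split; first exact: cst_continuous.
  by move=> i p; have [] := is_derive_partial (D i p).
move=> i; exists 0; apply/funext => p.
by have [] := is_derive_partial (D i p).
Qed.

Lemma affine_continuous (a b c : R) : continuous (fun p : R * R => a * p.1 + b * p.2 + c).
Proof.
move=> p; apply: cvgD; last exact: cvg_cst.
by apply: cvgD; apply: cvgM; (try exact: cvg_cst); [exact: cvg_fst|exact: cvg_snd].
Qed.

Lemma is_derive_affine (a b x : R) : is_derive x (1 : R) (fun t : R => a * t + b) a.
Proof.
apply: is_derive_eq; rewrite /GRing.scale/=; ring.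
Qed.

Lemma affine_slice i p (a b c : R) t :
  slice i (fun p : R * R => a * p.1 + b * p.2 + c) p t =
  (if i == 0 then a else b) * t + (if i == 0 then b * p.2 + c else a * p.1 + c).
Proof. by rewrite /slice; case: ifP => _ /=; ring. Qed.

Lemma smooth_affine (a b c : R) : smooth (fun p : R * R => a * p.1 + b * p.2 + c).
Proof.
apply: (@smooth_coind (fun f => exists a b c, f = fun p => a * p.1 + b * p.2 + c));
  last by exists a, b, c.
move=> _ [{}a [{}b [{}c ->]]].
have D i p : is_derive (coord i p) (1 : R)
    (slice i (fun p : R * R => a * p.1 + b * p.2 + c) p) (if i == 0 then a else b).
  rewrite (funext (affine_slice i p a b c)); exact: is_derive_affine.
split; first exact: affine_continuous.
  by move=> i p; have [] := is_derive_partial (D i p).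
move=> i; exists 0, 0, (if i == 0 then a else b); apply/funext => p.
have [_ ->] := is_derive_partial (D i p); by rewrite !mul0r !add0r.
Qed.

Lemma smooth_flat (P : {poly R}) (a b c : R) :
  smooth (fun p : R * R => flat P (a * p.1 + b * p.2 + c)).
Proof.
apply: (@smooth_coind (fun f => exists P k, f =
  fun p => k * flat P (a * p.1 + b * p.2 + c))); last first.
  by exists P, 1; apply/funext => p; rewrite mul1r.
move=> _ [{}P [k ->]].
have D i p : is_derive (coord i p) (1 : R)
    (slice i (fun p : R * R => k * flat P (a * p.1 + b * p.2 + c)) p)
    (k * (if i == 0 then a else b) * flat ('X^2 * (P - P^`())) (a * p.1 + b * p.2 + c)).
  rewrite (_ : slice _ _ _ = k \*: (flat P \o slice i (fun p : R * R => a * p.1 + b * p.2 + c) p)).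
    have d1 := is_derive_flat P (slice i (fun p : R * R => a * p.1 + b * p.2 + c) p (coord i p)).
    have d2 := is_derive_affine (if i == 0 then a else b)
      (if i == 0 then b * p.2 + c else a * p.1 + c) (coord i p).
    rewrite -(funext (affine_slice i p a b c)) in d2.
    apply: is_derive_eq (is_deriveZ k (is_derive1_comp d1 d2)) _.
    by rewrite slice_coord /GRing.scale/=; ring.
  by apply/funext => t; rewrite /slice; case: ifP.
split.
- move=> p; apply: cvgM; first exact: cvg_cst.
  apply: (@continuous_comp _ _ _ (fun p : R * R => a * p.1 + b * p.2 + c) (flat P)).
    exact: affine_continuous.
  have [+ _] := is_derive_flat P (a * p.1 + b * p.2 + c).
  by move=> /derivable1_diffP/differentiable_continuous.
- by move=> i p; have [] := is_derive_partial (D i p).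
- move=> i; exists ('X^2 * (P - P^`())), (k * (if i == 0 then a else b)).
  by apply/funext => p; have [] := is_derive_partial (D i p).
Qed.

(** Differentiability of order n, by recursion on n: Leibniz' rule needs the
    order to decrease, which the predicate smooth does not show. *)
Fixpoint Ck (n : nat) f : Prop :=
  if n is n'.+1 then
    (continuous f /\ forall i p, has_partial i f p) /\ forall i, Ck n' (partial i f)
  else continuous f /\ forall i p, has_partial i f p.

Lemma Ck0 n f : Ck n f -> continuous f /\ forall i p, has_partial i f p.
Proof. by case: n => [|n] // []. Qed.

Lemma smooth_Ck f : smooth f -> forall n, Ck n f.
Proof.
move=> sf n; elim: n f sf => [|n IH] f sf; first exact: (sf [::]).
by split; [exact: (sf [::])|move=> i; apply: IH; exact: smooth_partial].
Qed.

Lemma Ck_smooth f : (forall n, Ck n f) -> smooth f.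
Proof.
apply: (@smooth_coind (fun f => forall n, Ck n f)) => {}f fC.
have [cf df] := fC 0%N; split; [exact: cf|exact: df|move=> i n].
exact: (fC n.+1).2.
Qed.

Lemma CkS n f : Ck n.+1 f -> Ck n f.
Proof.
elim: n f => [|n IH] f [cf pf]; first exact: cf.
by split; [exact: cf|move=> i; apply: IH; exact: pf].
Qed.

Lemma partialD f g i p : has_partial i f p -> has_partial i g p ->
  has_partial i (fun p => f p + g p) p /\
  partial i (fun p => f p + g p) p = partial i f p + partial i g p.
Proof.
move=> /partial_is_derive df /partial_is_derive dg; apply: is_derive_partial.
rewrite (_ : slice _ _ _ = slice i f p + slice i g p); first exact: is_deriveD.
by apply/funext => t; rewrite /slice fctE; case: ifP.
Qed.

Lemma partialM f g i p : has_partial i f p -> has_partial i g p ->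
  has_partial i (fun p => f p * g p) p /\
  partial i (fun p => f p * g p) p = partial i f p * g p + f p * partial i g p.
Proof.
move=> /partial_is_derive df /partial_is_derive dg; apply: is_derive_partial.
rewrite (_ : slice _ _ _ = slice i f p * slice i g p).
  apply: is_derive_eq (is_deriveM df dg) _; rewrite !slice_coord /GRing.scale/=; ring.
by apply/funext => t; rewrite /slice fctE; case: ifP.
Qed.

Lemma CkD n f g : Ck n f -> Ck n g -> Ck n (fun p => f p + g p).
Proof.
elim: n f g => [|n IH] f g Cf Cg; have [cf df] := Ck0 Cf; have [cg dg] := Ck0 Cg;
  have C0 : continuous (fun p => f p + g p) /\
      forall i p, has_partial i (fun p => f p + g p) p.
- by split=> [p|i p]; [apply: cvgD; [exact: cf|exact: cg]|exact: (partialD _ _).1].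
- exact: C0.
- by split=> [p|i p]; [apply: cvgD; [exact: cf|exact: cg]|exact: (partialD _ _).1].
- split=> [|i]; first exact: C0.
  rewrite (_ : partial _ _ = fun p => partial i f p + partial i g p).
    by apply: IH; [exact: Cf.2|exact: Cg.2].
  by apply/funext => p; exact: (partialD _ _).2.
Qed.

Lemma CkM n f g : Ck n f -> Ck n g -> Ck n (fun p => f p * g p).
Proof.
elim: n f g => [|n IH] f g Cf Cg; have [cf df] := Ck0 Cf; have [cg dg] := Ck0 Cg;
  have C0 : continuous (fun p => f p * g p) /\
      forall i p, has_partial i (fun p => f p * g p) p.
- by split=> [p|i p]; [apply: cvgM; [exact: cf|exact: cg]|exact: (partialM _ _).1].
- exact: C0.
- by split=> [p|i p]; [apply: cvgM; [exact: cf|exact: cg]|exact: (partialM _ _).1].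
- split=> [|i]; first exact: C0.
  rewrite (_ : partial _ _ = fun p => partial i f p * g p + f p * partial i g p).
    apply: CkD; apply: IH; [exact: Cf.2|exact: CkS|exact: CkS|exact: Cg.2].
  by apply/funext => p; exact: (partialM _ _).2.
Qed.

Lemma smoothD f g : smooth f -> smooth g -> smooth (fun p => f p + g p).
Proof. by move=> sf sg; apply: Ck_smooth => n; apply: CkD; exact: smooth_Ck. Qed.

Lemma smoothM f g : smooth f -> smooth g -> smooth (fun p => f p * g p).
Proof. by move=> sf sg; apply: Ck_smooth => n; apply: CkM; exact: smooth_Ck. Qed.

Lemma smooth_scale (c : R) f : smooth f -> smooth (fun p => c * f p).
Proof. by move=> sf; apply: smoothM; [exact: smooth_cst|exact: sf]. Qed.

Lemma partial_scale (c : R) f i p : has_partial i f p ->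
  has_partial i (fun p => c * f p) p /\ partial i (fun p => c * f p) p = c * partial i f p.
Proof.
move=> hf; have hc := smooth_has_partial i p (smooth_cst c).
have [h1 h2] := partialM hc hf; split => //; rewrite h2.
have [_ ->] : has_partial i (fun=> c) p /\ partial i (fun=> c) p = 0.
  apply: is_derive_partial; rewrite (_ : slice _ _ _ = cst c); first exact: is_derive_cst.
  by apply/funext => t; rewrite /slice; case: ifP.
by rewrite mul0r add0r.
Qed.

Lemma smoothB f g : smooth f -> smooth g -> smooth (fun p => f p - g p).
Proof.
move=> sf sg; rewrite (_ : (fun p => f p - g p) = fun p => f p + -1 * g p).
  by apply: smoothD; [exact: sf|exact: smooth_scale].
by apply/funext => p; rewrite mulN1r.
Qed.

Definition homothety (a s b t : R) p : R * R := (s * p.1 + a, t * p.2 + b).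

Lemma partial_homothety f a s b t i p : has_partial i f (homothety a s b t p) ->
  has_partial i (f \o homothety a s b t) p /\
  partial i (f \o homothety a s b t) p =
    (if i == 0 then s else t) * partial i f (homothety a s b t p).
Proof.
move=> /partial_is_derive df; apply: is_derive_partial.
have d2 := is_derive_affine (if i == 0 then s else t) (if i == 0 then a else b) (coord i p).
have e : coord i (homothety a s b t p) = (if i == 0 then s else t) * coord i p + (if i == 0 then a else b).
  by rewrite /coord; case: ifP.
rewrite e in df.
rewrite (_ : slice _ _ _ = slice i f (homothety a s b t p) \o
   (fun x => (if i == 0 then s else t) * x + (if i == 0 then a else b))).
  rewrite mulrC; exact: (@is_derive1_comp _ _ (fun x => (if i == 0 then s else t) * x +
    (if i == 0 then a else b)) _ _ _ df d2).
by apply/funext => x; rewrite /slice /homothety/=; case: ifP.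
Qed.

Lemma homothety_continuous a s b t : continuous (homothety a s b t).
Proof.
move=> p; apply: (@cvg_pair _ _ _ _ (nbhs (s * p.1 + a)) (nbhs (t * p.2 + b))).
  apply: cvgD; last exact: cvg_cst.
  by apply: cvgM; [exact: cvg_cst|exact: cvg_fst].
apply: cvgD; last exact: cvg_cst.
by apply: cvgM; [exact: cvg_cst|exact: cvg_snd].
Qed.

Lemma smooth_homothety f a s b t : smooth f -> smooth (f \o homothety a s b t).
Proof.
move=> sf; apply: (@smooth_coind (fun g => exists f k, smooth f /\
  g = fun p => k * f (homothety a s b t p))); last first.
  by exists f, 1; split => //; apply/funext => p; rewrite mul1r.
move=> _ [{sf}f [k [sf ->]]].
have D i p := partial_homothety (smooth_has_partial i (homothety a s b t p) sf).
have D2 i p := partial_scale k (D i p).1.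
split.
- move=> p; apply: cvgM; first exact: cvg_cst.
  apply: (@continuous_comp _ _ _ (homothety a s b t) f); first exact: homothety_continuous.
  exact: smooth_continuous.
- by move=> i p; have [] := D2 i p.
- move=> i; exists (partial i f), (k * (if i == 0 then s else t)).
  split; first exact: smooth_partial.
  by apply/funext => p; rewrite (D2 i p).2 (D i p).2 mulrA.
Qed.

End Smooth.

(** * Sets moved by small homotheties *)

Section Vanish.
Context {R : realType}.
Implicit Types I J : nat -> \bar R.

(** Convergence to 0 for nonnegative sequences, in a form that asks for no finiteness. *)
Definition vanish I := forall e : R, 0 < e -> \forall k \near \oo, (I k <= e%:E)%E.

Lemma vanish_le I J : (\forall k \near \oo, (I k <= J k)%E) -> vanish J -> vanish I.
Proof.
move=> IJ vJ e e0; have := vJ e e0; apply: filterS2 IJ => k; exact: le_trans.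
Qed.

Lemma vanishD I J : vanish I -> vanish J -> vanish (fun k => I k + J k)%E.
Proof.
move=> vI vJ e e0; have e2 : 0 < e / 2 by rewrite divr_gt0.
have := vI _ e2; have := vJ _ e2; apply: filterS2 => k Jk Ik.
by rewrite [e]splitr EFinD leeD.
Qed.

Lemma vanishZ (c : R) I : 0 <= c -> vanish I -> vanish (fun k => c%:E * I k)%E.
Proof.
move=> c0 vI e e0; have e2 : 0 < e / (c + 1) by rewrite divr_gt0// ltr_wpDl.
have := vI _ e2; apply: filterS => k Ik.
apply: (@le_trans _ _ (c%:E * (e / (c + 1))%:E)%E); first exact: lee_wpmul2l.
rewrite -EFinM lee_fin mulrCA ger_pMr// ler_pdivrMr ?ltr_wpDl//; lra.
Qed.

Lemma vanish0 : vanish (fun=> 0%E).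
Proof. by move=> e e0; near=> k; rewrite lee_fin ltW. Unshelve. all: by end_near. Qed.

Lemma vanish_approx I : (forall e : R, 0 < e ->
  exists2 J, vanish J & \forall k \near \oo, (I k <= J k + e%:E)%E) -> vanish I.
Proof.
move=> H e e0; have e2 : 0 < e / 2 by rewrite divr_gt0.
have [J vJ IJ] := H _ e2; have := vJ _ e2; apply: filterS2 IJ => k Ik Jk.
by rewrite (le_trans Ik)// [e]splitr EFinD leeD// -splitr.
Qed.

Lemma cvg_vanish I : I @ \oo --> 0%E -> vanish I.
Proof.
move=> I0 e e0; have : \forall k \near \oo, (I k < e%:E)%E.
  apply: (I0 [set x | (x < e%:E)%E]); apply: open_nbhs_nbhs; split => /=; last by rewrite lte_fin.
  exact: open_ereal_lt_ereal.
by apply: filterS => k /ltW.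
Qed.

Lemma vanish_cvg_fine I : (forall k, 0 <= I k)%E -> vanish I ->
  fine (I k) @[k --> \oo] --> (0 : R).
Proof.
move=> I0 vI; apply/cvgrPdist_le => e e0; have := vI e e0; apply: filterS => k Ik.
rewrite sub0r normrN ger0_norm ?fine_ge0// -lee_fin fineK//.
by rewrite ge0_fin_numE// (le_lt_trans Ik) ?ltry.
Qed.

End Vanish.

Section Box.
Context {R : realType}.
Notation mu := (@lebesgue_measure R).

Definition box (M : R) : set (R * R) := `[(- M), M] `*` `[(- M), M].

Lemma measurable_box M : measurable (box M).
Proof. by apply: measurableX; exact: measurable_itv. Qed.

Lemma area_box M : 0 <= M -> area (box M) = ((M *+ 2) ^+ 2)%:E.
Proof.
move=> M0; rewrite /box area_setX; [|exact: measurable_itv..].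
have MM : (- M)%:E \is a fin_num by [].
rewrite !lebesgue_measure_itv/= lte_fin; case: ltP => [_|MM']; last first.
  have -> : M = 0 by lra.
  by rewrite mul0rn expr0n mul0e.
by rewrite -EFinB opprK -EFinM expr2 mulr2n.
Qed.

Lemma area_box_lty M : (area (box M) < +oo)%E.
Proof.
have [M0|M0] := ltP M 0.
  rewrite /box set_itv_ge; first by rewrite set0X /area measure0 ltry.
  by rewrite bnd_simp -ltNge; lra.
by rewrite area_box// ltry.
Qed.

Lemma area_homothety (a s b t : R) (A : set (R * R)) : s * t != 0 -> measurable A ->
  area (homothety a s b t @^-1` A) = (`|s * t|^-1%:E * area A)%E.
Proof.
move=> st mA.
have mh : measurable_fun [set: R * R] (homothety a s b t).
  have := measurable_affine2 s 0 0 t a b.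
  by under eq_fun do rewrite !mul0r addr0 add0r.
rewrite !area_indic//; last by rewrite -[_ @^-1` _]setTI; exact: mh.
have := @ge0_integral_area_affine _ s 0 0 t a b (fun p => (\1_A p)%:E).
rewrite mulr0 subr0 => <- //; last by apply/measurable_EFinP; exact: measurable_indic.
by apply: eq_integral => p _; rewrite !mul0r addr0 add0r.
Qed.

End Box.

Section Perturb.
Context {R : realType}.
Variables a s b : nat -> R.
Hypothesis s1 : s k @[k --> \oo] --> (1 : R).
Hypothesis a0 : a k @[k --> \oo] --> (0 : R).
Hypothesis b0 : b k @[k --> \oo] --> (0 : R).
Implicit Types A : set (R * R).

Notation mu := (@lebesgue_measure R).
Notation B k := (homothety (a k) (s k) (b k) (s k)).

Lemma near_perturb : \forall k \near \oo,
  [/\ 1 / 2 <= s k, s k <= 2, `|a k| <= 1 & `|b k| <= 1].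
Proof.
have h2 : 0 < 1 / 2 :> R by rewrite divr_gt0.
move/cvgrPdist_le : s1 => /(_ _ h2) H1.
move/cvgrPdist_le : a0 => /(_ _ ltr01) H2.
move/cvgrPdist_le : b0 => /(_ _ ltr01) H3.
apply: filterS3 H1 H2 H3 => k; rewrite ler_norml !sub0r !normrN => /andP[u v] ? ?.
by split => //; lra.
Qed.

Lemma measurable_homothety (x t y u : R) : measurable_fun [set: R * R] (homothety x t y u).
Proof.
have := measurable_affine2 t 0 0 u x y.
by under eq_fun do rewrite !mul0r addr0 add0r.
Qed.

Lemma measurable_homothety_preimage (x t y u : R) A : measurable A ->
  measurable (homothety x t y u @^-1` A).
Proof. by move=> mA; rewrite -[_ @^-1` _]setTI; exact: measurable_homothety. Qed.

Lemma boxP (M : R) p : box M p <-> `|p.1| <= M /\ `|p.2| <= M.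
Proof. by rewrite /box /= !in_itv/= !ler_norml. Qed.

Lemma homothety_box k (M : R) p : [/\ 1 / 2 <= s k, s k <= 2, `|a k| <= 1 & `|b k| <= 1] ->
  box M p -> box (2 * M + 1) (B k p).
Proof.
move=> [l u ha hb] /boxP[p1 p2]; apply/boxP; rewrite /homothety/=; split.
  apply: le_trans (ler_normD _ _) _; apply: lerD => //.
  by rewrite normrM ler_pM// ger0_norm//; lra.
apply: le_trans (ler_normD _ _) _; apply: lerD => //.
by rewrite normrM ler_pM// ger0_norm//; lra.
Qed.

Lemma area_box_preimage k (M : R) A : measurable A ->
  [/\ 1 / 2 <= s k, s k <= 2, `|a k| <= 1 & `|b k| <= 1] ->
  (area (box M `&` B k @^-1` A) <= 4%:E * area (box (2 * M + 1) `&` A))%E.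
Proof.
move=> mA Hk; have [l u ha hb] := Hk.
have mBA : measurable (box (2 * M + 1) `&` A) by apply: measurableI => //; exact: measurable_box.
apply: (@le_trans _ _ (area (B k @^-1` (box (2 * M + 1) `&` A)))).
  apply: area_le.
  - by apply: measurableI; [exact: measurable_box|exact: measurable_homothety_preimage].
  - exact: measurable_homothety_preimage.
  - by move=> p [Mp Ap]; split => //; exact: homothety_box.
have ss : 1 / 4 <= s k * s k by nra.
rewrite area_homothety//; last by rewrite gt_eqF//; lra.
rewrite lee_wpmul2r ?measure_ge0// lee_fin ger0_norm; last by lra.
by rewrite -[4]invrK lef_pV2 ?posrE; lra.
Qed.

Definition perturb_diff k A := (A `\` B k @^-1` A) `|` (B k @^-1` A `\` A).

Lemma measurable_perturb_diff k A : measurable A -> measurable (perturb_diff k A).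
Proof.
move=> mA; have mB := measurable_homothety_preimage (a k) (s k) (b k) (s k) mA.
by apply: measurableU; exact: measurableD.
Qed.

(** The homotheties [B k] tend to the identity. This property of [A] is the mean continuity of
    its indicator function; it holds for all measurable sets because the sets with it form a sigma-algebra. *)
Definition perturb_stable A := measurable A /\
  forall M, vanish (fun k => area (box M `&` perturb_diff k A)).

Lemma perturb_stable0 : perturb_stable set0.
Proof.
split=> // M; rewrite (_ : (fun _ => _) = fun=> 0%E); first exact: vanish0.
apply/funext => k; rewrite /perturb_diff preimage_set0 setD0 setU0 setI0.
by rewrite /area measure0.
Qed.

Lemma perturb_stableC A : perturb_stable A -> perturb_stable (~` A).
Proof.
move=> [mA vA]; split => [|M]; first exact: measurableC.
rewrite (_ : (fun _ => _) = (fun k => area (box M `&` perturb_diff k A)))//.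
apply/funext => k; congr (area (_ `&` _)).
rewrite /perturb_diff preimage_setC !setDE !setCK setUC setIC; congr (_ `|` _).
by rewrite setIC.
Qed.

Lemma perturb_stableU A A' : perturb_stable A -> perturb_stable A' ->
  perturb_stable (A `|` A').
Proof.
move=> [mA vA] [mA' vA']; split => [|M]; first exact: measurableU.
apply: vanish_le (vanishD (vA M) (vA' M)); near=> k.
apply: (@le_trans _ _ (area ((box M `&` perturb_diff k A) `|` (box M `&` perturb_diff k A')))).
  apply: area_le.
  - apply: measurableI; first exact: measurable_box.
    by apply: measurable_perturb_diff; exact: measurableU.
  - apply: measurableU; apply: measurableI; try exact: measurable_box;
    exact: measurable_perturb_diff.
  - rewrite -setIUr; apply: setIS => p; rewrite /perturb_diff/=.
    by case=> -[]; rewrite ?not_orP => -[] ? []; tauto.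
apply: area_setU; apply: measurableI; try exact: measurable_box;
  exact: measurable_perturb_diff.
Unshelve. all: by end_near. Qed.

(** By continuity of the measure the sets with large index contribute little area, both in a box
    and in a larger box that contains its image by [B k]; the others form a finite union. *)
Lemma perturb_stable_bigcup (F : (set (R * R))^nat) : (forall n, perturb_stable (F n)) ->
  perturb_stable (\bigcup_n F n).
Proof.
move=> sF; have mF n := (sF n).1.
pose G N := \bigcup_(n < N) F n.
have sG N : perturb_stable (G N).
  elim: N => [|N IH]; first by rewrite /G bigcup_mkord big_ord0; exact: perturb_stable0.
  by rewrite /G bigcup_mkord big_ord_recr -bigcup_mkord/=; exact: perturb_stableU.
have mU : measurable (\bigcup_n F n) by exact: bigcupT_measurable.
split => // M.
pose M' := 2 * M + 1.
pose T N := \bigcup_n F n `\` G N.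
have mT N : measurable (T N) by apply: measurableD => //; exact: (sG N).1.
have mbT m N : measurable (box m `&` T N) by apply: measurableI => //; exact: measurable_box.
have T0 m : vanish (fun N => area (box m `&` T N)).
  apply: cvg_vanish.
  have <- : area (\bigcap_N (box m `&` T N)) = 0%E.
    rewrite (_ : \bigcap_N _ = set0); first by rewrite /area measure0.
    apply/seteqP; split => // p H.
    have [_ [[n _ Fnp] _]] := H 0%N I.
    by have [_ [_]] := H n.+1 I; apply; exists n => //=.
  apply: (@nonincreasing_cvg_mu _ _ _ area) => //.
  - apply: le_lt_trans (area_box_lty m); apply: area_le => //; first exact: measurable_box.
  - by move=> N; exact: mbT.
  - by apply: bigcapT_measurable => N; exact: mbT.
  - apply/nonincreasing_seqP => N; apply/subsetPset; apply: setIS; apply: setDS => p [n /= nN Fnp].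
    by exists n => //=; exact: ltnW.
apply: vanish_approx => e e0.
have e5 : 0 < e / 5 by rewrite divr_gt0.
have [N [T1 T2]] : exists N, (area (box M `&` T N) <= (e / 5)%:E)%E /\
    (area (box M' `&` T N) <= (e / 5)%:E)%E.
  have := filterI (T0 M _ e5) (T0 M' _ e5) => -[N _ HN]; exists N; exact: HN (leqnn N).
exists (fun k => area (box M `&` perturb_diff k (G N))); first exact: (sG N).2.
apply: filterS near_perturb => k Hk.
pose X := box M `&` perturb_diff k (G N).
pose Y := box M `&` T N.
pose Z := box M `&` B k @^-1` T N.
have mX : measurable X.
  by apply: measurableI; [exact: measurable_box|apply: measurable_perturb_diff; exact: (sG N).1].
have mZ : measurable Z.
  by apply: measurableI; [exact: measurable_box|exact: measurable_homothety_preimage].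
apply: (@le_trans _ _ (area (X `|` (Y `|` Z)))).
  apply: area_le.
  - by apply: measurableI; [exact: measurable_box|exact: measurable_perturb_diff].
  - apply: measurableU; [exact: mX|apply: measurableU; [exact: mbT|exact: mZ]].
  - rewrite /X /Y /Z -!setIUr; apply: setIS => p; rewrite /perturb_diff /T/=.
    have sub q : G N q -> (\bigcup_n F n) q by move=> [n _ Fnq]; exists n.
    have := sub p; have := sub (B k p).
    have := pselect (G N p); have := pselect (G N (B k p)); rewrite /setD/=; tauto.
have -> : e = e / 5 + 4 * (e / 5) by field.
rewrite EFinD; apply: le_trans (area_setU mX (measurableU _ _ (mbT M N) mZ)) _.
apply: leeD; first by []; apply: le_trans (area_setU (mbT M N) mZ) _.
apply: leeD; first exact: T1; apply: le_trans (area_box_preimage M (mT N) Hk) _.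
by rewrite EFinM; apply: lee_wpmul2l.
Qed.

(** Inside the box of half-width [M] a homothety close to the identity moves points by at most
    [h], so only the points in a strip of width 2 h along the edge can change sides. *)
Lemma perturb_stable_halfplane (i : 'I_2) (c : R) :
  perturb_stable [set p | c < coord i p].
Proof.
have mH : measurable [set p : R * R | c < coord i p].
  have mc : measurable_fun [set: R * R] (coord i).
    by rewrite /coord; case: (i == 0); [exact: measurable_fst|exact: measurable_snd].
  have := mc measurableT _ (measurable_itv `]c, +oo[).
  rewrite setTI (_ : coord i @^-1` _ = [set p | c < coord i p])//.
  by apply/seteqP; split => p /=; rewrite in_itv/= andbT.
split => // M; have [M0|M0] := ltP M 0.
  rewrite (_ : (fun _ => _) = fun=> 0%E); first exact: vanish0.
  apply/funext => k; rewrite /box set_itv_ge; last by rewrite bnd_simp -ltNge; lra.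
  by rewrite set0X set0I /area measure0.
move=> e e0.
pose dl := e / (4 * (M + 1) ^+ 2).
have M1 : 0 < (M + 1) ^+ 2 by rewrite exprn_gt0//; lra.
have d0 : 0 < dl by rewrite divr_gt0// mulr_gt0.
have dE : 4 * (M + 1) ^+ 2 * dl = e by rewrite /dl; field; lra.
move/cvgrPdist_le : s1 => /(_ _ d0) H1.
move/cvgrPdist_le : a0 => /(_ _ d0) H2.
move/cvgrPdist_le : b0 => /(_ _ d0) H3.
apply: filterS3 H1 H2 H3 => k; rewrite !sub0r !normrN => hs ha hb.
pose h := dl * (M + 1).
have h0 : 0 <= h by rewrite mulr_ge0//; lra.
pose I1 := `[c - h, c + h]%classic; pose I2 := `[(- M), M]%classic.
pose S := if i == 0 then I1 `*` I2 else I2 `*` I1.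
have mS : measurable S by rewrite /S; case: ifP => _; apply: measurableX; exact: measurable_itv.
have aS : (area S <= e%:E)%E.
  have e1 : (mu I1 <= (2 * h)%:E)%E.
    rewrite lebesgue_measure_itv/= lte_fin; case: ifP => _; by rewrite ?lee_fin; lra.
  have e2 : (mu I2 <= (2 * M)%:E)%E.
    rewrite lebesgue_measure_itv/= lte_fin; case: ifP => _; by rewrite ?lee_fin; lra.
  have e3 : (mu I1 * mu I2 <= e%:E)%E.
    apply: (@le_trans _ _ ((2 * h)%:E * (2 * M)%:E)%E); first by apply: lee_pmul.
    by rewrite -EFinM lee_fin -dE /h; nra.
  have mI1 : measurable I1 by exact: measurable_itv.
  have mI2 : measurable I2 by exact: measurable_itv.
  rewrite /S; case: ifP => _; first by rewrite (area_setX mI1 mI2).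
  by rewrite (area_setX mI2 mI1) muleC.
apply: le_trans aS; apply: area_le => //.
  by apply: measurableI; [exact: measurable_box|exact: measurable_perturb_diff].
have key (x t : R) : `|x| <= M -> `|t| <= dl ->
    (c < x /\ ~ (c < s k * x + t)) \/ (c < s k * x + t /\ ~ (c < x)) ->
    c - h <= x <= c + h.
  move=> xM td Hx.
  have : `|x - (s k * x + t)| <= h.
    rewrite (_ : x - _ = (1 - s k) * x - t); last by ring.
    apply: le_trans (ler_normB _ _) _; rewrite normrM /h mulrDr mulr1.
    by apply: lerD => //; rewrite ler_pM.
  rewrite ler_norml => /andP[u v].
  by case: Hx => -[/ltW w /negP]; rewrite -leNgt => z; apply/andP; split; lra.
move=> p [/boxP[p1 p2]]; rewrite /perturb_diff /S /I1 /I2 /coord /homothety/=.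
case: (i == 0) => /= H; rewrite !in_itv/=; split => //=; rewrite ?in_itv/= -?ler_norml//.
  exact: (key _ (a k)).
exact: (key _ (b k)).
Qed.

(** Stability is inherited by the sigma-algebra generated by half-planes. *)
Lemma measurable_perturb_stable A : measurable A -> perturb_stable A.
Proof.
have SP : sigma_algebra setT perturb_stable.
  split; first exact: perturb_stable0.
    by move=> X; rewrite setTD; exact: perturb_stableC.
  exact: perturb_stable_bigcup.
have key (i : 'I_2) (X : set R) : measurable X -> perturb_stable (coord i @^-1` X).
  move=> mX0; have mX : (@RGenOInfty.G R).-sigma.-measurable X.
    by rewrite -RGenOInfty.measurableE.
  pose Q := [set Y : set R | perturb_stable (coord i @^-1` Y)].
  have SQ : sigma_algebra setT Q.
    split; rewrite /Q/=.
    - by rewrite preimage_set0; exact: perturb_stable0.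
    - by move=> Y; rewrite setTD preimage_setC; exact: perturb_stableC.
    - by move=> F HF; rewrite preimage_bigcup; exact: perturb_stable_bigcup.
  apply: (smallest_sub SQ _ mX) => Y [x ->]; rewrite /Q/=.
  rewrite (_ : _ @^-1` _ = [set p | x < coord i p]); first exact: perturb_stable_halfplane.
  by apply/seteqP; split => p /=; rewrite in_itv/= andbT.
move=> mA; apply: (smallest_sub SP _ mA) => Y [[X mX <-]|[X mX <-]]; rewrite setTI.
- exact: (key 0).
- exact: (key 1).
Qed.

End Perturb.

Import HBSimple.

(** * Mean continuity under small homotheties *)

Section PerturbFun.
Context {R : realType}.
Implicit Types (f g G : R * R -> R) (D : set (R * R)).

Lemma ge0_integral_homothety (a s b t : R) (F : R * R -> \bar R) : s * t != 0 ->
  measurable_fun [set: R * R] F -> (forall p, 0 <= F p)%E ->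
  (\int[area]_p F (homothety a s b t p) = `|s * t|^-1%:E * \int[area]_p F p)%E.
Proof.
move=> st mF F0.
have := @ge0_integral_area_affine _ s 0 0 t a b F.
rewrite mulr0 subr0 => <- //.
by apply: eq_integral => p _; rewrite !mul0r addr0 add0r.
Qed.

Lemma area_integral_le D f g : measurable D -> measurable_fun [set: R * R] f ->
  measurable_fun [set: R * R] g -> (forall p, D p -> 0 <= f p <= g p) ->
  (\int[area]_(p in D) (f p)%:E <= \int[area]_(p in D) (g p)%:E)%E.
Proof.
move=> mD mf mg fg; apply: ge0_le_integral => //.
- by move=> p /fg /andP[? _]; rewrite lee_fin.
- by apply/measurable_EFinP; exact: measurable_funTS.
- by apply/measurable_EFinP; exact: measurable_funTS.
- by move=> p /fg /andP[_ ?]; rewrite lee_fin.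
Qed.

Lemma area_integralD D f g : measurable D -> measurable_fun [set: R * R] f ->
  measurable_fun [set: R * R] g -> (forall p, D p -> 0 <= f p) -> (forall p, D p -> 0 <= g p) ->
  (\int[area]_(p in D) (f p + g p)%:E =
   \int[area]_(p in D) (f p)%:E + \int[area]_(p in D) (g p)%:E)%E.
Proof.
move=> mD mf mg f0 g0.
rewrite -ge0_integralD//.
- by apply/measurable_EFinP; exact: measurable_funTS.
- by apply/measurable_EFinP; exact: measurable_funTS.
Qed.

Lemma area_integralZ D f (c : R) : measurable D -> measurable_fun [set: R * R] f ->
  0 <= c -> (forall p, D p -> 0 <= f p) ->
  (\int[area]_(p in D) (c * f p)%:E = c%:E * \int[area]_(p in D) (f p)%:E)%E.
Proof.
move=> mD mf c0 f0; rewrite -ge0_integralZl//.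
by apply/measurable_EFinP; exact: measurable_funTS.
Qed.

Lemma area_integral_ge0 D f : (forall p, D p -> 0 <= f p) ->
  (0 <= \int[area]_(p in D) (f p)%:E)%E.
Proof. by move=> f0; apply: integral_ge0 => p /f0; rewrite lee_fin. Qed.

Lemma area_integral_sub D f : measurable D -> measurable_fun [set: R * R] f ->
  (forall p, 0 <= f p) ->
  (\int[area]_(p in D) (f p)%:E <= \int[area]_p (f p)%:E)%E.
Proof.
move=> mD mf f0; apply: ge0_subset_integral => //; first exact/measurable_EFinP.
by move=> p _; rewrite lee_fin.
Qed.

Variables a s b : nat -> R.
Hypothesis s1 : s k @[k --> \oo] --> (1 : R).
Hypothesis a0 : a k @[k --> \oo] --> (0 : R).
Hypothesis b0 : b k @[k --> \oo] --> (0 : R).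

Notation B k := (homothety (a k) (s k) (b k) (s k)).

Lemma near_integral_homothety (F : R * R -> R) : measurable_fun [set: R * R] F ->
  (forall p, 0 <= F p) ->
  \forall k \near \oo, (\int[area]_p (F (B k p))%:E <= 4%:E * \int[area]_p (F p)%:E)%E.
Proof.
move=> mF F0; apply: filterS (near_perturb s1 a0 b0) => k [l u _ _].
have ss : 1 / 4 <= s k * s k by nra.
rewrite (@ge0_integral_homothety _ _ _ _ (fun p => (F p)%:E)); last 3 first.
- by rewrite gt_eqF//; lra.
- exact/measurable_EFinP.
- by move=> p; rewrite lee_fin.
rewrite lee_wpmul2r ?area_integral_ge0// lee_fin ger0_norm; last by lra.
by rewrite -[4]invrK lef_pV2 ?posrE; lra.
Qed.

Lemma measurable_perturb f k : measurable_fun [set: R * R] f ->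
  measurable_fun [set: R * R] (fun p => f (B k p)).
Proof. by move=> mf; apply: (measurableT_comp mf); exact: measurable_homothety. Qed.

Definition perturb_L1 f := measurable_fun [set: R * R] f /\
  forall M, vanish (fun k => \int[area]_(p in box M) (`|f (B k p) - f p|)%:E)%E.

Lemma measurable_perturb_dist f k : measurable_fun [set: R * R] f ->
  measurable_fun [set: R * R] (fun p => `|f (B k p) - f p|).
Proof.
move=> mf; apply: measurableT_comp => //; apply: measurable_funB => //.
exact: measurable_perturb.
Qed.

Lemma perturb_L1_indic (A : set (R * R)) : measurable A -> perturb_L1 (\1_A).
Proof.
move=> mA; split; first exact: measurable_indic.
move=> M; apply: vanish_le ((measurable_perturb_stable s1 a0 b0 mA).2 M).
apply: nearW => k.
have mP := measurable_perturb_diff a s b k mA.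
have -> : area (box M `&` perturb_diff a s b k A) =
    (\int[area]_(p in box M) (\1_(perturb_diff a s b k A) p)%:E)%E.
  by rewrite setIC /area integral_indic//; exact: measurable_box.
rewrite le_eqVlt; apply/orP; left; apply/eqP; apply: eq_integral => p _.
congr EFin; rewrite !indicE /perturb_diff.
case: (boolP (B k p \in A)); case: (boolP (p \in A)) => /= p1 p2.
- rewrite subrr normr0 memNset// => -[[_ h]|[_ h]]; apply: h; exact: set_mem.
- rewrite subr0 normr1 mem_set//; right; split; first exact: set_mem.
  by move=> /mem_set; exact/negP.
- rewrite sub0r normrN normr1 mem_set//; left; split; first exact: set_mem.
  by move=> /mem_set; exact/negP.
- rewrite subrr normr0 memNset// => -[[/mem_set h _]|[/mem_set h _]].
    by rewrite h in p1.
  by move/negP: p2; apply.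
Qed.

Lemma perturb_L1D f g : perturb_L1 f -> perturb_L1 g -> perturb_L1 (fun p => f p + g p).
Proof.
move=> [mf vf] [mg vg]; split; first exact: measurable_funD.
move=> M; apply: vanish_le (vanishD (vf M) (vg M)); apply: nearW => k.
have h1 := measurable_perturb_dist k mf; have h2 := measurable_perturb_dist k mg.
have mM := @measurable_box R M.
rewrite -area_integralD//; apply: area_integral_le => //.
- by apply: measurable_perturb_dist; exact: measurable_funD.
- exact: measurable_funD.
- move=> p _; rewrite normr_ge0/=.
  rewrite (_ : f _ + _ - _ = (f (B k p) - f p) + (g (B k p) - g p)); last by ring.
  exact: ler_normD.
Qed.

Lemma perturb_L1Z (c : R) f : perturb_L1 f -> perturb_L1 (fun p => c * f p).
Proof.
move=> [mf vf]; split; first exact: measurable_funM.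
move=> M; apply: vanish_le (vanishZ (normr_ge0 c) (vf M)); apply: nearW => k.
rewrite -area_integralZ//; [|exact: measurable_box|exact: measurable_perturb_dist].
rewrite le_eqVlt; apply/orP; left; apply/eqP; apply: eq_integral => p _.
by rewrite -normrM mulrBr.
Qed.

Lemma perturb_L1_sum (I : Type) (r : seq I) (F : I -> R * R -> R) :
  (forall i, perturb_L1 (F i)) -> perturb_L1 (fun p => \sum_(i <- r) F i p).
Proof.
move=> HF; elim: r => [|i r IH].
  have := perturb_L1Z 0 (perturb_L1_indic measurableT).
  by congr perturb_L1; apply/funext => p; rewrite big_nil mul0r.
have := perturb_L1D (HF i) IH.
by congr perturb_L1; apply/funext => p; rewrite big_cons.
Qed.

(** Simple functions are dense, and composition with the homotheties multiplies integrals of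
    nonnegative functions by at most 4. *)
Lemma perturb_L1_integrable f : measurable_fun [set: R * R] f ->
  area.-integrable setT (EFin \o f) -> perturb_L1 f.
Proof.
move=> mf intf; split => // M.
have [g [_ _ g0]] := approximation_sfun_integrable measurableT intf.
have mg n : measurable_fun [set: R * R] (g n : R * R -> R) by exact: (measurable_funPT (g n)).
have Pg n : perturb_L1 (g n : R * R -> R).
  rewrite (_ : (g n : R * R -> R) = fun p => \sum_(y <- finmap.enum_fset (fset_set (range (g n))))
      y * \1_((g n : R * R -> R) @^-1` [set y]) p).
    apply: perturb_L1_sum => y; apply: perturb_L1Z; apply: perturb_L1_indic.
    by rewrite -[_ @^-1` _]setTI; exact: mg.
  apply/funext => p; rewrite [LHS]fimfunE fsbig_finite//; exact: fimfunP.
apply: vanish_approx => e e0.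
have e6 : 0 < e / 5 by rewrite divr_gt0.
have [N _ HN] := cvg_vanish g0 e6.
have {}HN : (\int[area]_p (`|f p - g N p|)%:E <= (e / 5)%:E)%E by exact: HN (leqnn N).
exists (fun k => \int[area]_(p in box M) (`|g N (B k p) - g N p|)%:E)%E; first exact: (Pg N).2.
have md : measurable_fun [set: R * R] (fun p => `|f p - g N p|).
  by apply: measurableT_comp => //; exact: measurable_funB.
apply: filterS (near_integral_homothety md (fun p => normr_ge0 _)) => k Hk.
have mM := @measurable_box R M.
have mdk := measurable_perturb k md.
have mdg := measurable_perturb_dist k (mg N).
apply: (@le_trans _ _ (\int[area]_(p in box M) (`|g N (B k p) - g N p| +
   (`|f (B k p) - g N (B k p)| + `|f p - g N p|))%:E)%E).
  apply: area_integral_le => //.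
  - exact: measurable_perturb_dist.
  - by apply: measurable_funD => //; exact: measurable_funD.
  - move=> p _; rewrite normr_ge0/=.
    rewrite (_ : f _ - _ = (g N (B k p) - g N p) + ((f (B k p) - g N (B k p)) - (f p - g N p))); last by ring.
    by rewrite (le_trans (ler_normD _ _))// lerD2l ler_normB.
rewrite area_integralD; [|exact: mM|exact: mdg|exact: measurable_funD|by []|
  by move=> p _; exact: addr_ge0].
apply: leeD => //; rewrite area_integralD//.
have -> : e = 4 * (e / 5) + e / 5 by field.
rewrite [leRHS]EFinD; apply: leeD; last first.
  by apply: le_trans HN; exact: area_integral_sub.
apply: (@le_trans _ _ (4%:E * (e / 5)%:E)%E); last by rewrite -EFinM.
apply: le_trans (area_integral_sub mM mdk (fun p => normr_ge0 _)) _.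
by apply: le_trans Hk _; apply: lee_wpmul2l.
Qed.

(** Truncation reduces the square mean to the mean: for a function bounded by
    n, the square of an increment is at most 2n times the increment. *)
Lemma perturb_L2 G (M0 : R) : measurable_fun [set: R * R] G ->
  area.-integrable setT (EFin \o (fun p => G p ^+ 2)) ->
  (forall p, ~ box M0 p -> G p = 0) ->
  forall M, vanish (fun k => \int[area]_(p in box M) ((G (B k p) - G p) ^+ 2)%:E)%E.
Proof.
move=> mG iG G0 M.
pose h (n : nat) p := G p * \1_[set q | `|G q| <= n%:R] p.
have hle n p : `|G p| <= n%:R -> h n p = G p.
  by move=> Gn; rewrite /h indicE mem_set// mulr1.
have hgt n p : ~ (`|G p| <= n%:R) -> h n p = 0.
  by move=> Gn; rewrite /h indicE memNset// mulr0.
have hn n p : `|h n p| <= n%:R.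
  have [Gn|Gn] := pselect (`|G p| <= n%:R); first by rewrite hle.
  by rewrite hgt// normr0.
have mh n : measurable_fun [set: R * R] (h n).
  apply: measurable_funM => //; apply: measurable_indic.
  rewrite (_ : [set q | _] = (fun p => `|G p|) @^-1` `]-oo, n%:R]); last first.
    by apply/seteqP; split => p /=; rewrite in_itv.
  rewrite -[_ @^-1` _]setTI.
  have : measurable_fun setT (fun p => `|G p|) by exact: measurableT_comp.
  by apply => //; exact: measurable_itv.
have hG n p : (G p - h n p) ^+ 2 <= G p ^+ 2.
  have [Gn|Gn] := pselect (`|G p| <= n%:R).
    by rewrite hle// subrr expr0n sqr_ge0.
  by rewrite hgt// subr0.
have mGh n : measurable_fun [set: R * R] (fun p => (G p - h n p) ^+ 2).
  by apply: measurable_funX; exact: measurable_funB.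
have vh : vanish (fun n => \int[area]_p ((G p - h n p) ^+ 2)%:E)%E.
  apply: cvg_vanish.
  have := @dominated_cvg _ _ _ area setT measurableT
    (fun n p => ((G p - h n p) ^+ 2)%:E) (cst 0%E) (EFin \o (fun p => G p ^+ 2)).
  rewrite integral0; apply => //.
  - by move=> n; apply/measurable_EFinP; exact: mGh.
  - move=> p _; apply: cvg_near_cst.
    have [N _ HN] := nbhs_infty_ger `|G p|.
    exists N => // n /= Nn; rewrite hle ?subrr ?expr0n//.
    exact: (HN n Nn).
  - by move=> n p _; rewrite lee_fin ger0_norm ?sqr_ge0.
have Ph n : perturb_L1 (h n).
  apply: perturb_L1_integrable => //.
  have h0 p : ~ box M0 p -> h n p = 0 by move=> /G0 Gp; rewrite /h Gp mul0r.
  rewrite (_ : EFin \o h n = (EFin \o h n) \_ (box M0)); last first.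
    apply/funext => p; rewrite patchE; case: ifPn => // /negP pM; rewrite /= h0//.
    by move=> /mem_set.
  apply/(integrable_restrict area (measurable_box M0) measurableT).
  rewrite setTI; apply: measurable_bounded_integrable; first exact: measurable_box.
  - exact: area_box_lty.
  - exact: (measurable_funTS (mh n)).
  - exists n%:R; split; first exact: num_real.
    by move=> x nx p _ /=; rewrite (le_trans (hn n p))// ltW.
apply: vanish_approx => e e0.
have e15 : 0 < e / 15 by rewrite divr_gt0.
have [n _ Hn] := vh _ e15; have {}Hn := Hn n (leqnn n); rewrite /= in Hn.
exists (fun k => (3 * (2 * n%:R))%:E * \int[area]_(p in box M) (`|h n (B k p) - h n p|)%:E)%E.
  by apply: vanishZ; [rewrite !mulr_ge0|exact: (Ph n).2].
apply: filterS (near_integral_homothety (mGh n) (fun p => sqr_ge0 _)) => k Hk.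
have mM := @measurable_box R M.
have mdk := measurable_perturb k (mGh n).
have mdg := measurable_perturb_dist k (mh n).
have n0 : 0 <= 3 * (2 * n%:R) :> R by rewrite !mulr_ge0.
have m1 : measurable_fun [set: R * R] (fun p => 3 * (G (B k p) - h n (B k p)) ^+ 2).
  exact: measurable_funM.
have m2 : measurable_fun [set: R * R] (fun p => 3 * (G p - h n p) ^+ 2).
  exact: measurable_funM.
have m3 : measurable_fun [set: R * R] (fun p => 3 * (2 * n%:R) * `|h n (B k p) - h n p|).
  exact: measurable_funM.
apply: (@le_trans _ _ (\int[area]_(p in box M) (3 * (2 * n%:R) * `|h n (B k p) - h n p| +
   (3 * (G (B k p) - h n (B k p)) ^+ 2 + 3 * (G p - h n p) ^+ 2))%:E)%E).
  apply: area_integral_le => //.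
  - by apply: measurable_funX; apply: measurable_funB => //; exact: measurable_perturb.
  - by apply: measurable_funD => //; exact: measurable_funD.
  - move=> p _; rewrite sqr_ge0/=.
    set x := G (B k p) - h n (B k p); set y := G p - h n p.
    set z := h n (B k p) - h n p.
    have zz : z ^+ 2 <= 2 * n%:R * `|z|.
      rewrite -real_normK ?num_real// expr2 ler_wpM2r//.
      rewrite (le_trans (ler_normB _ _))// mulr_natl mulr2n; exact: lerD.
    rewrite (_ : G (B k p) - G p = x - y + z); last by rewrite /x /y /z; ring.
    have := sqr_ge0 (x + y); have := sqr_ge0 (x - z); have := sqr_ge0 (y + z).
    rewrite -mulrA; nra.
have p1 p : 0 <= 3 * (G (B k p) - h n (B k p)) ^+ 2 by rewrite mulr_ge0// sqr_ge0.
have p2 p : 0 <= 3 * (G p - h n p) ^+ 2 by rewrite mulr_ge0// sqr_ge0.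
rewrite area_integralD; [|exact: mM|exact: m3|exact: measurable_funD|
  by move=> p _; rewrite mulr_ge0|by move=> p _; exact: addr_ge0].
apply: leeD; first by rewrite area_integralZ.
rewrite area_integralD// !area_integralZ//; try by move=> p _; exact: sqr_ge0.
have -> : e = 3 * (4 * (e / 15)) + 3 * (e / 15) by field.
rewrite [leRHS]EFinD; apply: leeD; last first.
  rewrite EFinM; apply: lee_wpmul2l => //.
  by apply: le_trans Hn; apply: area_integral_sub => // p; exact: sqr_ge0.
rewrite [leRHS]EFinM; apply: lee_wpmul2l => //.
apply: le_trans (area_integral_sub mM mdk (fun p => sqr_ge0 _)) _.
by apply: le_trans Hk _; rewrite [leRHS]EFinM; apply: lee_wpmul2l.
Qed.

End PerturbFun.

(** * Bump functions and convolution *)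

Section Support.
Context {R : realType}.
Implicit Types (f g : R * R -> R) (p q : R * R).

(** Unlike smooth functions in general, these are bounded and Lipschitz, and so are their
    derivatives. *)
Definition box_smooth f := smooth f /\ exists M, forall p, ~ box M p -> f p = 0.

Lemma continuous_box_bounded f M : continuous f ->
  exists2 C : R, 0 <= C & forall p, box M p -> `|f p| <= C.
Proof.
move=> cf; have cB : compact (box M) by apply: compact_setX; exact: segment_compact.
have cfM : {within box M, continuous f} by exact: continuous_subspaceT.
have /compact_bounded[N [_ HN]] := continuous_compact cfM cB.
exists (`|N| + 1); first by rewrite addr_ge0.
move=> p Mp; apply: (HN (`|N| + 1)); last by exists p.
by rewrite (le_lt_trans (ler_norm N))// ltrDl.
Qed.

Lemma box_smooth_bounded f : box_smooth f -> exists2 C : R, 0 <= C & forall p, `|f p| <= C.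
Proof.
move=> [sf [M fM]]; have [C C0 HC] := continuous_box_bounded M (smooth_continuous sf).
exists C => // p; have [Mp|Mp] := pselect (box M p); first exact: HC.
by rewrite fM// normr0.
Qed.

Lemma slice_box i M p : `|coord i p| > M -> ~ box M p.
Proof.
by rewrite /coord => h /boxP[h1 h2]; move: h; case: ifP => _; rewrite ltNge => /negP; apply.
Qed.

Lemma box_smooth_partial f i : box_smooth f -> box_smooth (partial i f).
Proof.
move=> [sf [M fM]]; split; first exact: smooth_partial.
exists M => p Mp.
have : is_derive (coord i p) (1 : R) (slice i f p) 0.
  apply: (@near_eq_is_derive R R R (cst 0) (slice i f p) (coord i p) 1 0).
  have [Mi|Mi] := ltP M `|coord i p|.
    have : \forall t \near coord i p, M < `|t|.
      have /(_ (coord i p)) c : continuous (fun t : R => `|t|) by exact: norm_continuous.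
      by apply: (c [set t | M < t]); exact: lt_nbhsr.
    apply: filterS => t Mt.
    have -> : slice i f p t = f (if i == 0 then (t, p.2) else (p.1, t)).
      by rewrite /slice; case: ifP.
    rewrite fM//; apply: (@slice_box i); rewrite (_ : coord i _ = t)//.
    by rewrite /coord; case: (i == 0).
  apply: filterE => t; apply/esym.
  move: Mi; rewrite /slice /coord; case: (i == 0) => Mi; apply: fM => /boxP[h1 h2];
    by apply: Mp; apply/boxP.
by move=> /is_derive_partial[].
Qed.

Lemma lipschitz1 (f : R -> R) (C : R) : (forall x, derivable f x 1) ->
  (forall x, `|derive1 f x| <= C) -> forall x y, `|f x - f y| <= C * `|x - y|.
Proof.
move=> df fC.
have key x y : x < y -> `|f y - f x| <= C * `|y - x|.
  move=> xy.
  have [||c _ ->] := @MVT R f (derive1 f) x y xy.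
  - by move=> z _; rewrite derive1E; exact: DeriveDef.
  - apply: continuous_subspaceT => z.
    exact/differentiable_continuous/derivable1_diffP.
  - by rewrite normrM ler_wpM2r.
move=> x y; have [xy|xy|->] := ltgtP x y; last by rewrite !subrr normr0 mulr0.
  by rewrite distrC [`|x - y|]distrC; exact: key.
exact: key.
Qed.

(** The partial derivatives are bounded, and a segment parallel to an axis joins each of two
    points to a common corner. *)
Lemma box_smooth_lipschitz f : box_smooth f -> exists2 C : R, 0 <= C &
  forall p q, `|f p - f q| <= C * (`|p.1 - q.1| + `|p.2 - q.2|).
Proof.
move=> bf.
have [C1 C10 H1] := box_smooth_bounded (box_smooth_partial 0 bf).
have [C2 C20 H2] := box_smooth_bounded (box_smooth_partial 1 bf).
exists (Num.max C1 C2); first by rewrite le_max C10.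
move=> [x y] [x' y'] /=.
have L1 := @lipschitz1 (fun t => f (t, y)) C1
  (fun t => smooth_has_partial 0 (t, y) bf.1) (fun t => H1 (t, y)) x x'.
have L2 := @lipschitz1 (fun t => f (x', t)) C2
  (fun t => smooth_has_partial 1 (x', t) bf.1) (fun t => H2 (x', t)) y y'.
rewrite (_ : f (x, y) - f (x', y') = (f (x, y) - f (x', y)) + (f (x', y) - f (x', y'))); last by ring.
rewrite (le_trans (ler_normD _ _))// mulrDr; apply: lerD.
  by rewrite (le_trans L1)// ler_wpM2r// le_max lexx.
by rewrite (le_trans L2)// ler_wpM2r// le_max lexx orbT.
Qed.

Lemma smooth_measurable f : smooth f -> measurable_fun [set: R * R] f.
Proof. by move=> sf; apply: continuous_measurable_fun2; exact: smooth_continuous. Qed.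

End Support.

Section Bump.
Context {R : realType}.
Implicit Types p : R * R.

(** Positive exactly on the open square of half-width 1. The trivial coefficients give the
    arguments the affine form for which [flat] is known to be smooth. *)
Definition bump p : R := (flat 1 (1 * p.1 + 0 * p.2 + 1) * flat 1 (- 1 * p.1 + 0 * p.2 + 1)) *
  (flat 1 (0 * p.1 + 1 * p.2 + 1) * flat 1 (0 * p.1 + - 1 * p.2 + 1)).

Lemma flat1_ge0 (t : R) : 0 <= flat 1 t.
Proof. by rewrite /flat; case: ifP => // _; rewrite hornerC mul1r expR_ge0. Qed.

Lemma flat1_gt0 (t : R) : (0 < flat 1 t) = (0 < t).
Proof.
by have [t0|t0] := ltP 0 t; [rewrite flat_gt0// hornerC mul1r expR_gt0|rewrite flat_le0// ltxx].
Qed.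

Lemma bump_ge0 p : 0 <= bump p.
Proof. by rewrite !mulr_ge0// flat1_ge0. Qed.

Lemma bump_smooth : smooth bump.
Proof. by apply: smoothM; apply: smoothM; exact: smooth_flat. Qed.

Lemma bump_neq0 p : bump p != 0 <-> `|p.1| < 1 /\ `|p.2| < 1.
Proof.
have E (x y : R) : (flat 1 x * flat 1 y != 0) = (0 < x) && (0 < y).
  by rewrite mulf_eq0 negb_or -[0 < x]flat1_gt0 -[0 < y]flat1_gt0 !lt0r !flat1_ge0 !andbT.
rewrite /bump mulf_eq0 negb_or !E !ltr_norml.
split; first by move=> /andP[/andP[h1 h2] /andP[h3 h4]]; split; apply/andP; split; lra.
by move=> [/andP[h1 h2] /andP[h3 h4]]; apply/andP; split; apply/andP; split; lra.
Qed.

Lemma box_smooth_bump : box_smooth bump.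
Proof.
split; first exact: bump_smooth.
exists 1 => p Mp; apply/eqP; apply: contra_notT Mp => /bump_neq0[h1 h2].
by apply/boxP; split; exact: ltW.
Qed.

Definition bump_mass : R := \int[area]_p bump p.

Lemma bump_integrable : area.-integrable setT (EFin \o bump).
Proof.
have [sb [M bM]] := box_smooth_bump; have [C _ bC] := box_smooth_bounded box_smooth_bump.
rewrite (_ : EFin \o bump = (EFin \o bump) \_ (box M)); last first.
  apply/funext => p; rewrite patchE; case: ifPn => // /negP pM; rewrite /= bM//.
  by move=> /mem_set.
apply/(integrable_restrict area (measurable_box M) measurableT).
rewrite setTI; apply: measurable_bounded_integrable; first exact: measurable_box.
- exact: area_box_lty.
- exact: (measurable_funTS (smooth_measurable sb)).
- exists C; split; first exact: num_real.
  by move=> x nx p _ /=; rewrite (le_trans (bC p))// ltW.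
Qed.

Lemma bump_mass_gt0 : 0 < bump_mass.
Proof.
rewrite lt_neqAle Rintegral_ge0 ?andbT; last by move=> p _; exact: bump_ge0.
apply/eqP => m0.
have mb := smooth_measurable bump_smooth.
have : (\int[area]_p `|(bump p)%:E| = 0)%E.
  under eq_integral do rewrite gee0_abs ?lee_fin ?bump_ge0//.
  by rewrite -(fineK (integrable_fin_num measurableT bump_integrable)) [fine _](esym m0).
move=> /(ae_eq_integral_abs area measurableT ((measurable_EFinP _ _).2 mb)) [N [mN N0 HN]].
have : (area (`](- 1 : R)%R, 1%R[ `*` `](- 1 : R)%R, 1%R[) <= area N)%E.
  apply: area_le => //; first by apply: measurableX; exact: measurable_itv.
  move=> p [/= p1 p2]; apply: HN => /= /(_ I) [] /eqP.
  apply/negP/bump_neq0; rewrite !ltr_norml.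
  by move: p1 p2; rewrite !in_itv.
have -> : area N = 0%E := N0.
rewrite area_setX; [|exact: measurable_itv..].
rewrite !lebesgue_measure_itv/= lte_fin ifT; last by lra.
by rewrite -EFinB -EFinM lee_fin; lra.
Qed.

Definition rho p : R := bump_mass^-1 * bump p.

Lemma box_smooth_rho : box_smooth rho.
Proof.
have [sb [M bM]] := box_smooth_bump; split; first exact: smooth_scale.
by exists M => p /bM pM; rewrite /rho pM mulr0.
Qed.

Lemma rho_ge0 p : 0 <= rho p.
Proof. by rewrite mulr_ge0 ?bump_ge0// invr_ge0 ltW// bump_mass_gt0. Qed.

Lemma rho_eq0 p : ~ (`|p.1| < 1 /\ `|p.2| < 1) -> rho p = 0.
Proof.
move=> h; rewrite /rho (_ : bump p = 0) ?mulr0//.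
by apply/eqP; apply: contra_notT h => /bump_neq0.
Qed.

Lemma rho_integrable : area.-integrable setT (EFin \o rho).
Proof. by apply: rintZ => //; exact: bump_integrable. Qed.

Lemma rho_mass : (\int[area]_p (rho p)%:E = 1)%E.
Proof.
rewrite -(fineK (integrable_fin_num measurableT rho_integrable)); congr EFin.
rewrite [LHS](@RintegralZl _ _ _ area)//; last exact: bump_integrable.
by rewrite mulVf// gt_eqF// bump_mass_gt0.
Qed.

End Bump.

Section Convolution.
Context {R : realType}.
Variables (D : set (R * R)) (g : R * R -> R) (lam e1 e2 : R).
Hypothesis mD : measurable D.
Hypothesis ig : area.-integrable D (EFin \o g).
Implicit Types (th : R * R -> R) (x y : R * R).

(** The convolution of [g] and [th] at the image of [x] by the homothety of ratio [lam] and
    translation ([e1], [e2]). *)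
Definition conv th x : R :=
  \int[area]_(y in D) (g y * th (homothety (e1 - y.1) lam (e2 - y.2) lam x)).

Let mker th x : smooth th ->
  measurable_fun [set: R * R] (fun y => th (homothety (e1 - y.1) lam (e2 - y.2) lam x)).
Proof.
move=> sth; have := measurable_affine2 (-1) 0 0 (-1) (lam * x.1 + e1) (lam * x.2 + e2).
move=> /(measurableT_comp (smooth_measurable sth)).
by congr measurable_fun; apply/funext => y; rewrite /homothety/=; congr (th (_, _)); ring.
Qed.

Lemma conv_integrable th x : box_smooth th ->
  area.-integrable D (EFin \o (fun y => g y * th (homothety (e1 - y.1) lam (e2 - y.2) lam x))).
Proof.
move=> bth; have [C C0 HC] := box_smooth_bounded bth.
apply: (@rint_le _ _ _ area D mD _ (fun y => C * `|g y|)).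
- apply: measurable_funM; first exact: (rint_measurable ig).
  exact: (measurable_funTS (mker x bth.1)).
- by move=> y _; rewrite normrM mulrC ler_wpM2r.
- apply: rintZ => //; exact: (integrable_norm ig).
Qed.

(** The integrand is Lipschitz in [x] with a constant proportional to [g]. *)
Lemma conv_continuous th : box_smooth th -> continuous (conv th).
Proof.
move=> bth x; have [C C0 HC] := box_smooth_lipschitz bth.
pose N := \int[area]_(y in D) `|g y|.
have N0 : 0 <= N by apply: Rintegral_ge0.
have key x' : `|conv th x - conv th x'| <= N * (C * (`|lam| * (`|x.1 - x'.1| + `|x.2 - x'.2|))).
  rewrite /conv -RintegralB//; try exact: conv_integrable.
  have ii : area.-integrable D (EFin \o (fun y => g y * th (homothety (e1 - y.1) lam (e2 - y.2) lam x) -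
      g y * th (homothety (e1 - y.1) lam (e2 - y.2) lam x'))).
    by apply: rintB => //; exact: conv_integrable.
  apply: le_trans (@le_normr_Rintegral _ _ _ area D _ mD ii) _.
  rewrite mulrC -RintegralZl//; last exact: (integrable_norm ig).
  apply: le_Rintegral => //.
  - exact: (integrable_norm ii).
  - apply: rintZ => //; exact: (integrable_norm ig).
  - move=> y _; rewrite -mulrBr normrM mulrC ler_wpM2r//.
    rewrite (le_trans (HC _ _))// ler_wpM2l// /homothety/=.
    have E (u v w : R) : lam * u + w - (lam * v + w) = lam * (u - v) by ring.
    by rewrite !E !normrM mulrDr.
apply/cvgrPdist_le => eps eps0.
pose B := N * (C * `|lam|) + 1.
have B0 : 0 < B by rewrite ltr_wpDl// !mulr_ge0.
have d0 : 0 < eps / (2 * B) by rewrite divr_gt0// mulr_gt0.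
have h1 : \forall x' \near x, `|x.1 - x'.1| <= eps / (2 * B).
  have c1 : x'.1 @[x' --> x] --> x.1 by exact: cvg_fst.
  by move/cvgrPdist_le : c1 => /(_ _ d0).
have h2 : \forall x' \near x, `|x.2 - x'.2| <= eps / (2 * B).
  have c2 : x'.2 @[x' --> x] --> x.2 by exact: cvg_snd.
  by move/cvgrPdist_le : c2 => /(_ _ d0).
apply: filterS2 h1 h2 => x' h1 h2; apply: le_trans (key x') _.
rewrite !mulrA -[N * C * `|lam|]mulrA.
apply: (@le_trans _ _ (B * (eps / (2 * B) + eps / (2 * B)))).
  by apply: ler_pM; [rewrite !mulr_ge0|exact: addr_ge0|rewrite /B lerDl|exact: lerD].
by rewrite le_eqVlt; apply/orP; left; apply/eqP; field; rewrite gt_eqF.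
Qed.

(** Differentiation under the integral sign, the derivatives of [th] being bounded. *)
Lemma conv_partial th i x : box_smooth th ->
  has_partial i (conv th) x /\ partial i (conv th) x = lam * conv (partial i th) x.
Proof.
move=> bth; have bp := box_smooth_partial i bth.
have [C C0 HC] := box_smooth_bounded bp.
pose X (t : R) : R * R := if i == 0 then (t, x.2) else (x.1, t).
pose f (t : R) y : R := g y * th (homothety (e1 - y.1) lam (e2 - y.2) lam (X t)).
have cX t : coord i (X t) = t by rewrite /coord /X; case: (i == 0).
have df t y : is_derive t (1 : R) (f ^~ y)
    (g y * (lam * partial i th (homothety (e1 - y.1) lam (e2 - y.2) lam (X t)))).
  have [hp pE] := partial_homothety (smooth_has_partial i (homothety (e1 - y.1) lam (e2 - y.2) lam (X t)) bth.1).
  have := partial_is_derive hp; rewrite cX pE if_same => d1.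
  rewrite (_ : f ^~ y = g y \*: slice i (th \o homothety (e1 - y.1) lam (e2 - y.2) lam) (X t)).
    by apply: is_derive_eq (is_deriveZ (g y) d1) _.
  by apply/funext => u; rewrite /f /slice /X; case: (i == 0).
have Xx : X (coord i x) = x by rewrite /X /coord; case: (i == 0); rewrite -surjective_pairing.
have D1 := @cvg_differentiation_under_integral _ _ _ area f D mD (coord i x)
  (coord i x - 1) (coord i x + 1) _ (fun t _ => conv_integrable (X t) bth)
  (fun t y _ _ => @ex_derive _ _ _ _ _ _ _ (df t y)) (fun y => C * `|lam| * `|g y|) _ _ _.
apply: is_derive_partial.
rewrite (_ : slice i (conv th) x = fun t => \int[area]_(y in D) f t y); last first.
  by apply/funext => t; rewrite /slice /conv /f /X; case: (i == 0).
have E : \int[area]_(y in D) (partial1of2 f) (coord i x) y = lam * conv (partial i th) x.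
  rewrite -RintegralZl//; last exact: conv_integrable.
  apply: eq_Rintegral => y _; rewrite partial1of2E.
  by have [_ ->] := df (coord i x) y; rewrite Xx mulrCA.
rewrite -E; apply: DeriveDef.
  apply/cvg_ex => /=; eexists; under eq_fun do rewrite scaler1.
  apply: D1.
  - by rewrite /= in_itv/=; apply/andP; split; lra.
  - by move=> y; rewrite !mulr_ge0.
  - by apply: rintZ => //; exact: (integrable_norm ig).
  - move=> t y _ _; rewrite partial1of2E; have [_ ->] := df t y.
    by rewrite normrM mulrC ler_wpM2r// normrM mulrC ler_wpM2r.
apply/cvg_lim => //; under eq_fun do rewrite scaler1.
apply: D1.
- by rewrite /= in_itv/=; apply/andP; split; lra.
- by move=> y; rewrite !mulr_ge0.
- by apply: rintZ => //; exact: (integrable_norm ig).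
- move=> t y _ _; rewrite partial1of2E; have [_ ->] := df t y.
  by rewrite normrM mulrC ler_wpM2r// normrM mulrC ler_wpM2r.
Qed.

Lemma conv_smooth th : box_smooth th -> smooth (conv th).
Proof.
move=> bth; apply: (@smooth_coind _ (fun f => exists c th, box_smooth th /\
  f = fun x => c * conv th x)); last first.
  by exists 1, th; split => //; apply/funext => x; rewrite mul1r.
move=> _ [c [{bth}th [bth ->]]]; split.
- by move=> x; apply: cvgM; [exact: cvg_cst|exact: conv_continuous].
- by move=> i x; have [] := partial_scale c (conv_partial i x bth).1.
- move=> i; exists (c * lam), (partial i th); split; first exact: box_smooth_partial.
  apply/funext => x; have [h1 h2] := conv_partial i x bth.
  by rewrite (partial_scale c h1).2 h2 mulrA.
Qed.

End Convolution.

Section Mollify.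
Context {R : realType}.
Implicit Types (g h : R * R -> R) (x y z : R * R).

Definition mollifier (r : R) : R * R -> R :=
  fun z => r^-1 ^+ 2 * rho (homothety 0 r^-1 0 r^-1 z).

Lemma box_smooth_mollifier (r : R) : 0 < r -> box_smooth (mollifier r).
Proof.
move=> r0; have [srho [M rM]] := @box_smooth_rho R; split.
  apply: smooth_scale; exact: (smooth_homothety 0 r^-1 0 r^-1 srho).
exists (r * M) => z zM; rewrite /mollifier rM ?mulr0// => /boxP[].
have ri : 0 < r^-1 by rewrite invr_gt0.
rewrite /homothety/= !addr0 !normrM (gtr0_norm ri) => h1 h2.
by apply: zM; apply/boxP; split; rewrite -ler_pdivrMl.
Qed.

Lemma mollifier_ge0 (r : R) z : 0 <= mollifier r z.
Proof. by rewrite mulr_ge0 ?rho_ge0// sqr_ge0. Qed.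

Lemma mollifier_eq0 (r : R) z : 0 < r -> ~ (`|z.1| < r /\ `|z.2| < r) -> mollifier r z = 0.
Proof.
move=> r0 zr; rewrite /mollifier rho_eq0 ?mulr0// /homothety/= !addr0 !normrM.
have ri : 0 < r^-1 by rewrite invr_gt0.
by rewrite (gtr0_norm ri) !ltr_pdivrMl// mulr1.
Qed.

Section Kernel.
Variables (s r e1 e2 : R).
Hypothesis r0 : 0 < r.

Definition kernel x y := mollifier r (homothety (e1 - y.1) s (e2 - y.2) s x).

(** The substitution that turns the kernel at [x] into [rho]. *)
Definition sample x z := homothety (s * x.1 + e1) (- r) (s * x.2 + e2) (- r) z.

Lemma kernel_ge0 x y : 0 <= kernel x y.
Proof. exact: mollifier_ge0. Qed.

Lemma kernel_sample x z : kernel x (sample x z) = r^-1 ^+ 2 * rho z.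
Proof.
rewrite /kernel /mollifier /sample /homothety/= !addr0; congr (_ * rho _).
by case: z => z1 z2 /=; congr (_, _); field; rewrite gt_eqF.
Qed.

Lemma measurable_kernel x : measurable_fun [set: R * R] (kernel x).
Proof.
have := measurable_affine2 (-1) 0 0 (-1) (s * x.1 + e1) (s * x.2 + e2).
move=> /(measurableT_comp (smooth_measurable (box_smooth_mollifier r0).1)).
congr measurable_fun; apply/funext => y; rewrite /kernel /homothety /=.
have -> : -1 * y.1 + 0 * y.2 + (s * x.1 + e1) = s * x.1 + (e1 - y.1) by ring.
by have -> : 0 * y.1 + -1 * y.2 + (s * x.2 + e2) = s * x.2 + (e2 - y.2) by ring.
Qed.

(** Integrating against the kernel is averaging over points near the image of x
    under the contraction. *)
Lemma integral_kernel x h : measurable_fun [set: R * R] h -> (forall y, 0 <= h y) ->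
  (\int[area]_y (kernel x y * h y)%:E = \int[area]_z (rho z * h (sample x z))%:E)%E.
Proof.
move=> mh h0; have rr : - r * - r != 0 by rewrite mulf_neq0// oppr_eq0 gt_eqF.
have mkh : measurable_fun [set: R * R] (fun y => (kernel x y * h y)%:E).
  by apply/measurable_EFinP; apply: measurable_funM => //; exact: measurable_kernel.
have := ge0_integral_homothety (s * x.1 + e1) (s * x.2 + e2) rr mkh
  (fun y => mulr_ge0 (kernel_ge0 x y) (h0 y)).
under eq_integral do rewrite -/(sample x _) kernel_sample -mulrA EFinM.
have msh : measurable_fun [set: R * R] (fun z => rho z * h (sample x z)).
  apply: measurable_funM; first exact: (smooth_measurable (@box_smooth_rho R).1).
  apply: (measurableT_comp mh); exact: measurable_homothety.
have r2 : 0 < r^-1 ^+ 2 by rewrite exprn_gt0// invr_gt0.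
rewrite ge0_integralZl//; last 3 first.
- exact/measurable_EFinP.
- by move=> z _; rewrite lee_fin mulr_ge0// rho_ge0.
- by rewrite lee_fin ltW.
have -> : `|- r * - r|^-1 = r^-1 ^+ 2 by rewrite mulrNN -expr2 ger0_norm ?sqr_ge0// exprVn.
by move=> /(congr1 (fun t => (r^-1 ^+ 2)^-1%:E * t))%E; rewrite !muleA -!EFinM mulVf ?mul1e ?gt_eqF.
Qed.

Lemma kernel_mass x : (\int[area]_y (kernel x y)%:E = 1)%E.
Proof.
have := integral_kernel x (measurable_cst (1 : R)) (fun=> ler01).
have -> : (fun y => (kernel x y * cst 1 y)%:E) = (fun y => (kernel x y)%:E).
  by apply/funext => y; rewrite mulr1.
have -> : (fun z => (rho z * cst 1 (sample x z))%:E) = (fun z => (rho z)%:E).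
  by apply/funext => y; rewrite mulr1.
by rewrite rho_mass.
Qed.

Lemma kernel_bounded : exists2 C : R, 0 <= C & forall x y, kernel x y <= C.
Proof.
have [C C0 HC] := box_smooth_bounded (box_smooth_mollifier r0).
by exists C => // x y; rewrite (le_trans (ler_norm _))// HC.
Qed.

Lemma kernel_integrable x : area.-integrable setT (EFin \o kernel x).
Proof.
apply/integrableP; split; first by apply/measurable_EFinP; exact: measurable_kernel.
under eq_integral do rewrite /= ger0_norm ?kernel_ge0//.
by rewrite kernel_mass ltry.
Qed.

Lemma kernel_mul_integrable x h : measurable_fun [set: R * R] h ->
  area.-integrable setT (EFin \o (fun y => h y ^+ 2)) ->
  area.-integrable setT (EFin \o (fun y => kernel x y * h y)) /\
  area.-integrable setT (EFin \o (fun y => kernel x y * h y ^+ 2)).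
Proof.
move=> mh ih; have [C C0 HC] := kernel_bounded; have mk := measurable_kernel x.
have i2 : area.-integrable setT (EFin \o (fun y => kernel x y * h y ^+ 2)).
  apply: (@rint_le _ _ _ area setT measurableT _ (fun y => C * h y ^+ 2)).
  - by apply: measurable_funM => //; exact: measurable_funX.
  - by move=> y _; rewrite normrM ![`|_|]ger0_norm ?kernel_ge0 ?sqr_ge0//; apply: ler_wpM2r; [exact: sqr_ge0|exact: HC].
  - exact: (rintZ measurableT).
split => //.
apply: (@rint_le _ _ _ area setT measurableT _ (fun y => kernel x y + kernel x y * h y ^+ 2)).
- exact: measurable_funM.
- move=> y _; rewrite normrM ger0_norm ?kernel_ge0// -[X in X + _]mulr1 -mulrDr.
  by rewrite ler_wpM2l ?kernel_ge0// ler_norml; apply/andP; split; nra.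
- by apply: (rintD measurableT) => //; exact: kernel_integrable.
Qed.

(** Jensen's inequality for the square: the kernel is a probability density, and the variance
    of [h] with respect to it is nonnegative. *)
Lemma kernel_jensen x h c : measurable_fun [set: R * R] h ->
  area.-integrable setT (EFin \o (fun y => h y ^+ 2)) ->
  (((\int[area]_y (h y * kernel x y) - c) ^+ 2)%:E <=
   \int[area]_z (rho z * (h (sample x z) - c) ^+ 2)%:E)%E.
Proof.
move=> mh ih; have [i1 i2] := kernel_mul_integrable x mh ih.
have i0 := kernel_integrable x.
rewrite -(@integral_kernel x (fun y => (h y - c) ^+ 2)); last 2 first.
- by apply: measurable_funX; exact: measurable_funB.
- by move=> y; exact: sqr_ge0.
have K1 : \int[area]_y kernel x y = 1 by rewrite /Rintegral kernel_mass.
set m := \int[area]_y (h y * kernel x y).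
have mE : m = \int[area]_y (kernel x y * h y) by apply: eq_Rintegral => y _; rewrite mulrC.
have E (t : R) : area.-integrable setT (EFin \o (fun y => kernel x y * (h y - t) ^+ 2)) /\
  \int[area]_y (kernel x y * (h y - t) ^+ 2) =
  \int[area]_y (kernel x y * h y ^+ 2) - 2 * t * m + t ^+ 2.
  have eqf : (fun y => kernel x y * (h y - t) ^+ 2) = (fun y =>
     kernel x y * h y ^+ 2 - (2 * t) * (kernel x y * h y) + t ^+ 2 * kernel x y).
    by apply/funext => y; ring.
  have j1 := rintZ measurableT (2 * t) i1; have j0 := rintZ measurableT (t ^+ 2) i0.
  have j21 := rintB measurableT i2 j1.
  rewrite eqf; split; first exact: (rintD measurableT).
  rewrite RintegralD// RintegralB//; congr (_ - _ + _).
    by rewrite mE; exact: RintegralZl.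
  by rewrite -[RHS]mulr1 -K1; exact: RintegralZl.
have [ic cE] := E c; have [_ mE2] := E m.
rewrite -(fineK (integrable_fin_num measurableT ic)) lee_fin [leRHS]cE.
have : 0 <= \int[area]_y (kernel x y * (h y - m) ^+ 2).
  by apply: Rintegral_ge0 => y _; rewrite mulr_ge0 ?kernel_ge0 ?sqr_ge0.
rewrite mE2; nra.
Qed.

End Kernel.
End Mollify.

(** * Convergence of mollifications in square mean *)

Lemma vanish_cvg {R : realType} (I : nat -> \bar R) : (forall k, 0 <= I k)%E ->
  vanish I -> I @ \oo --> 0%E.
Proof.
move=> I0 vI; have := vI 1 ltr01 => -[N _ HN].
have fI : \forall k \near \oo, I k \is a fin_num.
  exists N => // k /= Nk; rewrite ge0_fin_numE//; apply: le_lt_trans (HN k Nk) _.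
  exact: ltry.
apply/fine_cvgP; split => //; exact: vanish_cvg_fine.
Qed.

Section ProductTonelli.
Context d (T : measurableType d) (R : realType).
Variable m : {sigma_finite_measure set T -> \bar R}.

Let mm := (m \x m)%E.

HB.instance Definition _ := Measure.on mm.

Let mm_sigma_finite : sigma_finite setT mm.
Proof.
have /sigma_finiteP[F [TF ndF Foo]] := sigma_finiteT m.
exists (fun n => F n `*` F n).
  rewrite -setXTT TF predeqE => -[x y]; split.
    move=> [/= [n _ Fnx] [k _ Fky]]; exists (maxn n k) => //; split.
    - by move: x Fnx; exact/subsetPset/ndF/leq_maxl.
    - by move: y Fky; exact/subsetPset/ndF/leq_maxr.
  by move=> [n _ []/= ? ?]; split; exists n.
move=> k; have [? ?] := Foo k.
split; first exact: measurableX.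
by rewrite /mm product_measure1E// lte_mul_pinfty// ge0_fin_numE.
Qed.

HB.instance Definition _ := Measure_isSigmaFinite.Build _ _ _ mm mm_sigma_finite.

Variable F : (T * T) * (T * T) -> \bar R.
Hypothesis F0 : forall xz, (0 <= F xz)%E.
Hypothesis mF : measurable_fun setT F.

(** The product of the measure with itself is sigma-finite, so Tonelli's theorem applies to it
    as a factor. *)
Lemma product_tonelli : (\int[m \x m]_x \int[m \x m]_z F (x, z) =
  \int[m \x m]_z \int[m \x m]_x F (x, z))%E.
Proof. exact: (@fubini_tonelli _ _ _ _ R mm mm F mF F0). Qed.

Lemma measurable_product_tonelli1 : measurable_fun setT (fun x => \int[m \x m]_z F (x, z))%E.
Proof. exact: (@measurable_fun_fubini_tonelli_F _ _ _ _ R mm F mF F0). Qed.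

Lemma measurable_product_tonelli2 : measurable_fun setT (fun z => \int[m \x m]_x F (x, z))%E.
Proof. exact: (@measurable_fun_fubini_tonelli_G _ _ _ _ R mm F mF F0). Qed.

End ProductTonelli.

Section MollifyL2.
Context {R : realType}.
Variables (D : set (R * R)) (M0 : R) (g : R * R -> R).
Hypothesis mD : measurable D.
Hypothesis DM : D `<=` box M0.
Hypothesis sg : square_integrable area D g.
Variables (q : R * R) (s r : nat -> R).
Hypothesis s_bd : forall k, 1 / 2 <= s k <= 1.
Hypothesis r_gt0 : forall k, 0 < r k.
Hypothesis s1 : s k @[k --> \oo] --> (1 : R).
Hypothesis r0 : r k @[k --> \oo] --> (0 : R).

Let e1 k := (1 - s k) * q.1.
Let e2 k := (1 - s k) * q.2.

(** The contraction towards [q] leaves room for the supports of the kernels inside a convex open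
    set containing [q]. *)
Definition mollify k : R * R -> R := conv D g (s k) (e1 k) (e2 k) (mollifier (r k)).

Let G := g \_ D.

Let mG : measurable_fun [set: R * R] G.
Proof. exact: (measurable_restrictT g mD).1 sg.1. Qed.

Let iG : area.-integrable setT (EFin \o (fun y => G y ^+ 2)).
Proof. by have := (Lfun2P area mD g).2 sg; exact: Lfun2_integrable_sqr. Qed.

Let GM p : ~ box M0 p -> G p = 0.
Proof. by move=> Mp; rewrite /G patchE memNset// => /DM. Qed.

Lemma mollifyE k x : mollify k x =
  \int[area]_y (G y * kernel (s k) (r k) (e1 k) (e2 k) x y).
Proof.
rewrite /mollify /conv Rintegral_mkcond; apply: eq_Rintegral => y _.
by rewrite /G !patchE; case: ifP => // _; rewrite mul0r.
Qed.

Let N k z := (\int[area]_(x in D)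
  ((G (sample (s k) (r k) (e1 k) (e2 k) x z) - G x) ^+ 2)%:E)%E.

Let sampleE k x z : sample (s k) (r k) (e1 k) (e2 k) x z =
  homothety (e1 k - r k * z.1) (s k) (e2 k - r k * z.2) (s k) x.
Proof. by rewrite /sample /homothety; congr (_, _); ring. Qed.

Let N_vanish z : vanish (N ^~ z).
Proof.
have c1 t u : (1 - s k) * t - r k * u @[k --> \oo] --> (0 : R).
  rewrite [X in _ --> X](_ : _ = (1 - 1) * t - 0 * u); last by ring.
  apply: cvgB; apply: cvgM => //; try exact: cvg_cst.
  by apply: cvgB => //; exact: cvg_cst.
have := perturb_L2 s1 (c1 q.1 z.1) (c1 q.2 z.2) mG iG GM M0.
apply: vanish_le; apply: nearW => k; rewrite /N.
under eq_integral do rewrite sampleE.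
apply: ge0_subset_integral => //; first exact: measurable_box.
- apply/measurable_EFinP; apply: measurable_funTS; apply: measurable_funX.
  by apply: measurable_funB => //; apply: (measurableT_comp mG); exact: measurable_homothety.
- by move=> p _; rewrite lee_fin sqr_ge0.
Qed.

Let IG : R := \int[area]_y (G y ^+ 2).

(** Bounding the square of a difference by twice the sum of the squares, where the contraction,
    of ratio at least 1/2, multiplies integrals by at most 4: 10 = 2 * 4 + 2. *)
Let N_bound k z : (N k z <= (10 * IG)%:E)%E.
Proof.
have /andP[sl su] := s_bd k.
have ss : 1 / 4 <= s k * s k by nra.
have mH : measurable_fun [set: R * R] (fun x => G (sample (s k) (r k) (e1 k) (e2 k) x z) ^+ 2).
  apply: measurable_funX; under eq_fun do rewrite sampleE.
  by apply: (measurableT_comp mG); exact: measurable_homothety.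
have mG2 : measurable_fun [set: R * R] (fun x => G x ^+ 2) by exact: measurable_funX.
have IGE : (IG%:E = \int[area]_y (G y ^+ 2)%:E)%E.
  by rewrite /IG -(fineK (integrable_fin_num measurableT iG)).
apply: (@le_trans _ _ (\int[area]_(x in D)
  (2 * G (sample (s k) (r k) (e1 k) (e2 k) x z) ^+ 2 + 2 * G x ^+ 2)%:E)%E).
  apply: area_integral_le => //.
  - apply: measurable_funX; apply: measurable_funB => //; under eq_fun do rewrite sampleE.
    by apply: (measurableT_comp mG); exact: measurable_homothety.
  - by apply: measurable_funD; exact: measurable_funM.
  - move=> x _; rewrite sqr_ge0/= -subr_ge0.
    rewrite (_ : _ - _ = (G (sample (s k) (r k) (e1 k) (e2 k) x z) + G x) ^+ 2) ?sqr_ge0//.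
    by ring.
rewrite area_integralD//; try exact: measurable_funM; try (by move=> p _; rewrite mulr_ge0// sqr_ge0).
rewrite !area_integralZ//; try (by move=> p _; exact: sqr_ge0).
rewrite (_ : 10 * IG = 2 * (4 * IG) + 2 * IG); last by ring.
rewrite [leRHS]EFinD !(EFinM 2); apply: leeD; apply: lee_wpmul2l => //; last first.
  by rewrite IGE; apply: area_integral_sub => // p; exact: sqr_ge0.
apply: le_trans (area_integral_sub mD mH (fun p => sqr_ge0 _)) _.
under eq_integral do rewrite sampleE.
rewrite (@ge0_integral_homothety _ _ _ _ _ (fun p => (G p ^+ 2)%:E)); last 3 first.
- by rewrite gt_eqF//; lra.
- exact/measurable_EFinP.
- by move=> p; rewrite lee_fin sqr_ge0.
rewrite (EFinM 4) IGE lee_wpmul2r ?area_integral_ge0//; first by move=> p _; exact: sqr_ge0.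
rewrite lee_fin ger0_norm; last by lra.
by rewrite -[4]invrK lef_pV2 ?posrE; lra.
Qed.

Let measurable_sample_diff k : measurable_fun [set: (R * R) * (R * R)]
  (fun xz => (G (sample (s k) (r k) (e1 k) (e2 k) xz.1 xz.2) - G xz.1) ^+ 2).
Proof.
apply: measurable_funX; apply: measurable_funB.
  apply: (measurableT_comp mG).
  apply/measurable_fun_pair => /=; rewrite /sample /homothety /=.
    apply: measurable_funD; first apply: measurable_funM => //.
      exact: (measurableT_comp measurable_fst measurable_snd).
    apply: measurable_funD => //; apply: measurable_funM => //.
    exact: (measurableT_comp measurable_fst measurable_fst).
  apply: measurable_funD; first apply: measurable_funM => //.
    exact: (measurableT_comp measurable_snd measurable_snd).
  apply: measurable_funD => //; apply: measurable_funM => //.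
  exact: (measurableT_comp measurable_snd measurable_fst).
by apply: (measurableT_comp mG); exact: measurable_fst.
Qed.

Let measurable_N k : measurable_fun [set: R * R] (N k).
Proof.
pose F (xz : (R * R) * (R * R)) : \bar R := (\1_D xz.1 *
  (G (sample (s k) (r k) (e1 k) (e2 k) xz.1 xz.2) - G xz.1) ^+ 2)%:E.
have F0 xz : (0 <= F xz)%E by rewrite lee_fin mulr_ge0// sqr_ge0.
have mF : measurable_fun [set: (R * R) * (R * R)] F.
  apply/measurable_EFinP; apply: measurable_funM; last exact: measurable_sample_diff.
  by apply: (measurableT_comp (measurable_indic _)) => //; exact: measurable_fst.
have := (@measurable_product_tonelli2 _ _ R (@lebesgue_measure R) F F0 mF).
congr measurable_fun; apply/funext => z; rewrite /N [RHS]integral_mkcond.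
apply: eq_integral => x _; rewrite patchE /F/= indicE.
by case: (x \in D); rewrite ?mul1r ?mul0r.
Qed.

(** Averaging the square increments over the shifts first, each of which
    vanishes in the limit, by Tonelli's theorem. *)
Let mollify_le k : (\int[area]_(x in D) ((mollify k x - g x) ^+ 2)%:E <=
  \int[area]_z ((rho z)%:E * N k z))%E.
Proof.
pose F (xz : (R * R) * (R * R)) : \bar R := (\1_D xz.1 * (rho xz.2 *
  (G (sample (s k) (r k) (e1 k) (e2 k) xz.1 xz.2) - G xz.1) ^+ 2))%:E.
have F0 xz : (0 <= F xz)%E by rewrite lee_fin mulr_ge0// mulr_ge0 ?rho_ge0 ?sqr_ge0.
have mF : measurable_fun [set: (R * R) * (R * R)] F.
  apply/measurable_EFinP; apply: measurable_funM.
    by apply: (measurableT_comp (measurable_indic _)) => //; exact: measurable_fst.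
  apply: measurable_funM; last exact: measurable_sample_diff.
  apply: (measurableT_comp (smooth_measurable (@box_smooth_rho R).1)).
  exact: measurable_snd.
have FT : (\int[area]_x \int[area]_z F (x, z) = \int[area]_z \int[area]_x F (x, z))%E.
  exact: (@product_tonelli _ _ R (@lebesgue_measure R) F F0 mF).
apply: (@le_trans _ _ (\int[area]_x \int[area]_z F (x, z))%E).
  rewrite integral_mkcond; apply: ge0_le_integral; first exact: measurableT.
  - by move=> x _; rewrite patchE; case: ifP => _; [rewrite lee_fin sqr_ge0|exact: lexx].
  - apply/(measurable_restrictT _ mD); apply/measurable_EFinP; apply: measurable_funX.
    apply: measurable_funB; last exact: sg.1.
    apply: measurable_funTS; apply: smooth_measurable; apply: (conv_smooth _ _ _ mD).
      apply: (@square_integrable_rint _ _ _ area D mD g _ sg).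
      exact: le_lt_trans (area_le mD (measurable_box M0) DM) (area_box_lty M0).
    exact: box_smooth_mollifier.
  - exact: (@measurable_product_tonelli1 _ _ R (@lebesgue_measure R) F F0 mF).
  - move=> x _; rewrite patchE; case: ifPn => xD; last first.
      by apply: integral_ge0 => z _; exact: F0.
    rewrite mollifyE.
    have := @kernel_jensen _ (s k) _ (e1 k) (e2 k) (r_gt0 k) x G (g x) mG iG.
    move=> /le_trans; apply; rewrite le_eqVlt; apply/orP; left; apply/eqP.
    apply: eq_integral => z _; rewrite /F/= indicE xD mul1r.
    by rewrite [G x]patchE xD.
rewrite FT; rewrite le_eqVlt; apply/orP; left; apply/eqP; apply: eq_integral => z _.
have mz := measurableT_comp (measurable_sample_diff k) (pair2_measurable z).
rewrite /N -ge0_integralZl; [|exact: mD|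
  apply/measurable_EFinP; exact: (measurable_funTS mz)|
  by move=> x _; rewrite lee_fin sqr_ge0|by rewrite lee_fin rho_ge0].
rewrite [RHS]integral_mkcond; apply: eq_integral => x _; rewrite patchE /F/= indicE.
by case: (x \in D); rewrite ?mul1r ?mul0r// EFinM.
Qed.

(** Dominated convergence in the shift [z]: for each [z] the mean of the square increments tends
    to 0, and it is bounded independently of [z]. *)
Lemma mollify_cvg :
  \int[area]_(x in D) ((mollify k x - g x) ^+ 2) @[k --> \oo] --> (0 : R).
Proof.
apply: vanish_cvg_fine.
  by move=> k; apply: integral_ge0 => x _; rewrite lee_fin sqr_ge0.
apply: (vanish_le (nearW _ mollify_le)).
apply: cvg_vanish.
have N0 k z : (0 <= N k z)%E by apply: integral_ge0 => x _; rewrite lee_fin sqr_ge0.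
have := @dominated_cvg _ _ _ area setT measurableT
  (fun k z => (rho z)%:E * N k z)%E (cst 0%E) (fun z => (10 * IG * rho z)%:E).
rewrite integral0; apply.
- move=> k; apply: emeasurable_funM.
    by apply/measurable_EFinP; exact: (smooth_measurable (@box_smooth_rho R).1).
  exact: measurable_N.
- move=> z _; rewrite -(mule0 (rho z)%:E); apply: cvgeZl => //.
  exact: vanish_cvg.
- by [].
- apply: (rintZ measurableT); exact: rho_integrable.
- move=> k z _; rewrite gee0_abs ?mule_ge0 ?lee_fin ?rho_ge0//.
  by rewrite mulrC [leRHS]EFinM; apply: lee_wpmul2l; [rewrite lee_fin rho_ge0|exact: N_bound].
Qed.

End MollifyL2.

(** * Triangles and the divergence theorem *)

Section Triangle.
Context {R : realType}.
Implicit Types (a b c p q : R * R) (K : triangle R).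

Definition tdet a b c : R :=
  (b.1 - a.1) * (c.2 - a.2) - (b.2 - a.2) * (c.1 - a.1).

(** The affine map sending the reference triangle to the one with vertices a, b, c. *)
Definition taff a b c (x : R * R) : R * R :=
  ((b.1 - a.1) * x.1 + (c.1 - a.1) * x.2 + a.1,
   (b.2 - a.2) * x.1 + (c.2 - a.2) * x.2 + a.2).

(** The barycentric coordinates at b and c. *)
Definition baryb a b c p : R :=
  (c.2 - a.2) / tdet a b c * p.1 + (- (c.1 - a.1) / tdet a b c) * p.2 +
  ((c.1 - a.1) * a.2 - (c.2 - a.2) * a.1) / tdet a b c.

Definition baryc a b c p : R :=
  (- (b.2 - a.2) / tdet a b c) * p.1 + (b.1 - a.1) / tdet a b c * p.2 +
  ((b.2 - a.2) * a.1 - (b.1 - a.1) * a.2) / tdet a b c.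

(** Defined by inequalities between affine functions, which makes closedness and measurability
    immediate; it is the convex hull of the vertices by [hull_tri]. *)
Definition tri a b c : set (R * R) :=
  [set p | [/\ 0 <= baryb a b c p, 0 <= baryc a b c p & baryb a b c p + baryc a b c p <= 1]].

Definition otri a b c : set (R * R) :=
  [set p | [/\ 0 < baryb a b c p, 0 < baryc a b c p & baryb a b c p + baryc a b c p < 1]].

Lemma sum_ord3 (i j k : 'I_3) (F : 'I_3 -> R) : i != j -> i != k -> j != k ->
  \sum_m F m = F i + F j + F k.
Proof.
move=> ij ik jk; rewrite (bigD1 i)//= (bigD1 j)/= ?(eq_sym j)//.
rewrite (bigD1 k)/= ?(eq_sym k) ?ij ?ik ?jk// big1 ?addr0 ?addrA// => m /andP[/andP[mi mj] mk].
exfalso; move: i j k m ij ik jk mi mj mk.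
by do 4! case => [[|[|[|?]]] ?] //.
Qed.

Section Fixed.
Variables a b c : R * R.
Hypothesis D0 : tdet a b c != 0.

Lemma baryb_taff x : baryb a b c (taff a b c x) = x.1.
Proof. by move: D0; rewrite /baryb /taff /tdet/= => H; field. Qed.

Lemma baryc_taff x : baryc a b c (taff a b c x) = x.2.
Proof. by move: D0; rewrite /baryc /taff /tdet/= => H; field. Qed.

Lemma taff_bary p : taff a b c (baryb a b c p, baryc a b c p) = p.
Proof.
move: D0; rewrite /baryb /baryc /taff /tdet/= => H.
by case: p => x y /=; congr (_, _); field.
Qed.

Lemma baryb_continuous : continuous (baryb a b c).
Proof. exact: affine_continuous. Qed.

Lemma baryc_continuous : continuous (baryc a b c).
Proof. exact: affine_continuous. Qed.

Lemma open_otri : open (otri a b c).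
Proof.
rewrite (_ : otri a b c = (baryb a b c @^-1` `]0, +oo[) `&` (baryc a b c @^-1` `]0, +oo[)
  `&` ((fun p => baryb a b c p + baryc a b c p) @^-1` `]-oo, 1[)); last first.
  apply/seteqP; split => p; rewrite /otri /setI/= !in_itv/= !andbT; first by case.
  by case=> -[].
apply: openI; [apply: openI|]; apply: open_comp; try exact: interval_open.
- by move=> p _; exact: baryb_continuous.
- by move=> p _; exact: baryc_continuous.
- by move=> p _; apply: cvgD; [exact: baryb_continuous|exact: baryc_continuous].
Qed.

Lemma closed_tri : closed (tri a b c).
Proof.
rewrite (_ : tri a b c = (baryb a b c @^-1` `[0, +oo[) `&` (baryc a b c @^-1` `[0, +oo[)
  `&` ((fun p => baryb a b c p + baryc a b c p) @^-1` `]-oo, 1])); last first.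
  apply/seteqP; split => p; rewrite /tri /setI/= !in_itv/= !andbT; first by case.
  by case=> -[].
apply: closedI; [apply: closedI|]; apply: preimage_closed; try exact: interval_closed.
- by move=> p _; exact: baryb_continuous.
- by move=> p _; exact: baryc_continuous.
- by move=> p _; apply: cvgD; [exact: baryb_continuous|exact: baryc_continuous].
Qed.

Lemma measurable_tri : measurable (tri a b c).
Proof. by rewrite -[tri _ _ _]setCK; apply: measurableC; apply: open_measurable2; rewrite openC; exact: closed_tri. Qed.

Lemma otri_tri : otri a b c `<=` tri a b c.
Proof. by move=> p [? ? ?]; split; exact: ltW. Qed.

(** The difference is contained in the three lines that carry the edges. *)
Lemma area_tri_otri : area (tri a b c `\` otri a b c) = 0%E.
Proof.
pose L1 := [set p : R * R | (c.2 - a.2) / tdet a b c * p.1 + (- (c.1 - a.1) / tdet a b c) * p.2 +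
  ((c.1 - a.1) * a.2 - (c.2 - a.2) * a.1) / tdet a b c = 0].
pose L2 := [set p : R * R | (- (b.2 - a.2) / tdet a b c) * p.1 + (b.1 - a.1) / tdet a b c * p.2 +
  ((b.2 - a.2) * a.1 - (b.1 - a.1) * a.2) / tdet a b c = 0].
pose L3 := [set p : R * R | ((c.2 - a.2) / tdet a b c - (b.2 - a.2) / tdet a b c) * p.1 +
  (- (c.1 - a.1) / tdet a b c + (b.1 - a.1) / tdet a b c) * p.2 +
  (((c.1 - a.1) * a.2 - (c.2 - a.2) * a.1) / tdet a b c +
  ((b.2 - a.2) * a.1 - (b.1 - a.1) * a.2) / tdet a b c - 1) = 0].
have nz (x y : R) : x / tdet a b c = 0 -> y / tdet a b c = 0 -> x = 0 /\ y = 0.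
  by move=> /eqP + /eqP; rewrite !mulf_eq0 !invr_eq0 (negbTE D0) !orbF => /eqP -> /eqP ->.
have m12 (u v w : R) : measurable [set p : R * R | u * p.1 + v * p.2 + w = 0].
  have := smooth_measurable (smooth_affine u v w) measurableT (measurable_set1 0).
  by rewrite setTI.
have a1 : area L1 = 0%E.
  apply: area_line0; rewrite -negb_and; apply/negP => /andP[/eqP h1 /eqP h2].
  have [h3 h4] := nz _ _ h1 h2; move: D0; rewrite /tdet h3 -[c.1 - a.1]opprK h4; 
  by rewrite oppr0 !mulr0 subrr eqxx.
have a2 : area L2 = 0%E.
  apply: area_line0; rewrite -negb_and; apply/negP => /andP[/eqP h1 /eqP h2].
  have [h3 h4] := nz _ _ h1 h2; move: D0; rewrite /tdet h4 -[b.2 - a.2]opprK h3.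
  by rewrite oppr0 !mul0r subrr eqxx.
have a3 : area L3 = 0%E.
  apply: area_line0; rewrite -negb_and; apply/negP => /andP[/eqP h1 /eqP h2].
  rewrite -mulrBl in h1; rewrite -mulrDl in h2.
  have [h3 h4] := nz _ _ h1 h2; move: D0; rewrite /tdet.
  have -> : c.2 - a.2 = b.2 - a.2 by lra.
  have -> : c.1 - a.1 = b.1 - a.1 by lra.
  by rewrite [X in _ - X]mulrC subrr eqxx.
have mL1 : measurable L1 by exact: m12.
have mL2 : measurable L2 by exact: m12.
have mL3 : measurable L3 by exact: m12.
have mL23 : measurable (L2 `|` L3) by exact: measurableU.
have mU : measurable (L1 `|` (L2 `|` L3)) by exact: measurableU.
apply/eqP; rewrite eq_le measure_ge0 andbT.
apply: (@le_trans _ _ (area (L1 `|` (L2 `|` L3)))).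
  apply: area_le => //.
    by apply: measurableD; [exact: measurable_tri|apply: open_measurable2; exact: open_otri].
  move=> p [[h1 h2 h3] h4].
  have [e1|e1] := eqVneq (baryb a b c p) 0; first by left.
  have [e2|e2] := eqVneq (baryc a b c p) 0; first by right; left.
  have [e3|e3] := eqVneq (baryb a b c p + baryc a b c p) 1.
    right; right; rewrite /L3/=; move: e3; rewrite /baryb /baryc => e3.
    by apply/eqP; rewrite -subr_eq0 -[X in _ - X](subrr 1) -[X in _ - (X - _)]e3; apply/eqP; ring.
  by exfalso; apply: h4; split; rewrite lt_neqAle ?h1 ?h2 ?h3 ?andbT// eq_sym.
apply: le_trans (area_setU mL1 mL23) _.
rewrite a1 add0e; apply: le_trans (area_setU mL2 mL3) _.
by rewrite a2 a3 adde0.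
Qed.

End Fixed.

Lemma hull_tri K i j k : i != j -> i != k -> j != k -> tdet (K i) (K j) (K k) != 0 ->
  hull K = tri (K i) (K j) (K k).
Proof.
move=> ij ik jk D0; apply/seteqP; split => p.
  move=> [l [l0 l1 p1 p2]].
  move: p1 p2 l1; rewrite !(sum_ord3 _ ij ik jk) => p1 p2 l1.
  have -> : p = taff (K i) (K j) (K k) (l j, l k).
    by case: p p1 p2 => x y /= -> ->; rewrite /taff/=; congr (_, _); rewrite -[l i](addrK (l j + l k)) addrA l1; ring.
  rewrite /tri/= baryb_taff// baryc_taff//=; split => //.
  by rewrite -l1 -addrA lerDr.
move=> [b0 c0 bc1]; set x := baryb _ _ _ p in b0 bc1; set y := baryc _ _ _ p in c0 bc1.
pose l m := if m == i then 1 - x - y else if m == j then x else y.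
have li : l i = 1 - x - y by rewrite /l eqxx.
have lj : l j = x by rewrite /l eq_sym (negbTE ij) eqxx.
have lk : l k = y by rewrite /l ![k == _]eq_sym (negbTE ik) (negbTE jk).
exists l; rewrite !(sum_ord3 _ ij ik jk) li lj lk; split.
- by move=> m; rewrite /l; case: ifP => _; [lra|case: ifP].
- by ring.
- by rewrite -[in LHS](taff_bary D0 p) -/x -/y /taff/=; ring.
- by rewrite -[in LHS](taff_bary D0 p) -/x -/y /taff/=; ring.
Qed.

Lemma tdet_neq0 K i j k : i != j -> i != k -> j != k -> nondegenerate_triangle K ->
  tdet (K i) (K j) (K k) != 0.
Proof.
rewrite /nondegenerate_triangle => ij ik jk.
have E : tdet (K 0) (K 1) (K 2%:R) = (K 1).1 * (K 2%:R).2 - (K 1).2 * (K 2%:R).1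
  - (K 1).1 * (K 0).2 + (K 1).2 * (K 0).1 + (K 0).2 * (K 2%:R).1 - (K 0).1 * (K 2%:R).2.
  by rewrite /tdet; ring.
move=> D0; apply: contra D0 => /eqP; rewrite -/(tdet _ _ _).
have v0 : forall m : 'I_3, [\/ m = 0, m = 1 | m = 2%:R].
  by case=> [[|[|[|//]]] ?]; [apply: Or31|apply: Or32|apply: Or33]; exact: val_inj.
move: ij ik jk; rewrite -/(tdet (K 0) (K 1) (K 2%:R)).
by case: (v0 i) (v0 j) (v0 k) => -> [] -> [] -> // _ _ _; rewrite /tdet => H; apply/eqP; lra.
Qed.

End Triangle.

Section LineDerivative.
Context {R : realType}.
Implicit Types (F : R * R -> R) (p : R * R).

Lemma MVT_inside (f : R -> R) (x y : R) : (forall z, derivable f z 1) ->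
  exists2 c, `|c - x| <= `|y - x| & f y - f x = derive1 f c * (y - x).
Proof.
move=> df.
have key u v : u < v -> exists2 c, u < c < v & f v - f u = derive1 f c * (v - u).
  move=> uv.
  have [||c cuv E] := @MVT R f (derive1 f) u v uv.
  - by move=> z _; rewrite derive1E; exact: DeriveDef.
  - apply: continuous_subspaceT => z.
    exact/differentiable_continuous/derivable1_diffP.
  - by exists c => //; move: cuv; rewrite in_itv.
have [xy|yx|->] := ltgtP x y.
- have [c /andP[c1 c2] E] := key x y xy; exists c => //.
  by rewrite !gtr0_norm ?subr_gt0//; lra.
- have [c /andP[c1 c2] E] := key y x yx; exists c; last first.
    by rewrite -opprB E; ring.
  by rewrite !ltr0_norm ?subr_lt0//; lra.
- by exists y; rewrite !subrr ?normr0// mulr0.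
Qed.

(** Continuity of the partial derivatives yields differentiability along lines:
    an increment is split into one in each variable. *)
Lemma is_derive_line F p (u v t : R) : smooth F ->
  is_derive t (1 : R) (fun t => F (p.1 + t * u, p.2 + t * v))
    (u * partial 0 F (p.1 + t * u, p.2 + t * v) + v * partial 1 F (p.1 + t * u, p.2 + t * v)).
Proof.
move=> sF; set x := p.1 + t * u; set y := p.2 + t * v.
set d := u * _ + v * _.
pose q h := h^-1 *: ((fun t => F (p.1 + t * u, p.2 + t * v)) (h *: 1 + t) - F (x, y)).
have H : q h @[h --> 0^'] --> d.
  apply/cvgrPdist_le => e e0.
  pose B := `|u| + `|v| + 1.
  have B0 : 0 < B by rewrite ltr_wpDl// addr_ge0.
  have eB : 0 < e / B by rewrite divr_gt0.
  have cont i : exists2 dl : R, 0 < dl & forall x' y' : R, `|x' - x| < dl -> `|y' - y| < dl ->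
      `|partial i F (x', y') - partial i F (x, y)| <= e / B.
    have cP : {for (x, y), continuous (partial i F)}.
      exact: (smooth_continuous (smooth_partial i sF)).
    move/cvgrPdist_le : cP => /(_ _ eB) [[U V] /= [/nbhs_ballP[d1 /= d10 d1U] /nbhs_ballP[d2 /= d20 d2V]] UV].
    exists (Num.min d1 d2); first by rewrite lt_min d10.
    move=> x' y'; rewrite !lt_min => /andP[h1 _] /andP[_ h2].
    rewrite distrC; apply: (UV (x', y')); split; [apply: d1U|apply: d2V].
      by rewrite /ball/= distrC.
    by rewrite /ball/= distrC.
  have [dl0 dl00 H0] := cont 0; have [dl1 dl10 H1] := cont 1.
  have d0 : 0 < Num.min dl0 dl1 / B by rewrite divr_gt0// lt_min dl00.
  near=> h.
  have h0 : h != 0 by near: h; exact: nbhs_dnbhs_neq.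
  have hB : `|h| * B < Num.min dl0 dl1.
    rewrite -ltr_pdivlMr//; near: h; exact: dnbhs0_lt.
  have hu : `|h * u| <= `|h| * B.
    by rewrite normrM ler_wpM2l// /B -addrA lerDl addr_ge0.
  have hv : `|h * v| <= `|h| * B.
    by rewrite normrM ler_wpM2l// /B addrAC lerDr addr_ge0.
  have [c1 c1x E1] := MVT_inside x (x + h * u) (fun z => smooth_has_partial 0 (z, y + h * v) sF).
  have [c2 c2y E2] := MVT_inside y (y + h * v) (fun z => smooth_has_partial 1 (x, z) sF).
  have -> : q h = u * partial 0 F (c1, y + h * v) + v * partial 1 F (x, c2).
    rewrite /q /GRing.scale/= mulr1.
    have -> : (p.1 + (h + t) * u, p.2 + (h + t) * v) = (x + h * u, y + h * v).
      by rewrite /x /y; congr (_, _); ring.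
    have -> : F (x + h * u, y + h * v) - F (x, y) =
       (F (x + h * u, y + h * v) - F (x, y + h * v)) + (F (x, y + h * v) - F (x, y)) by ring.
    rewrite E1 E2 ![_ + h * _ - _]addrAC !subrr !add0r.
    rewrite -[derive1 _ c1]/(partial 0 F (c1, y + h * v)) -[derive1 _ c2]/(partial 1 F (x, c2)).
    by field.
  rewrite /d (_ : _ - _ = u * (partial 0 F (x, y) - partial 0 F (c1, y + h * v)) +
      v * (partial 1 F (x, y) - partial 1 F (x, c2))); last by ring.
  rewrite (le_trans (ler_normD _ _))// !normrM.
  have b1 : `|partial 0 F (x, y) - partial 0 F (c1, y + h * v)| <= e / B.
    rewrite distrC; apply: H0.
      apply: le_lt_trans c1x _; rewrite addrAC subrr add0r.
      by apply: le_lt_trans hu _; move: hB; rewrite lt_min => /andP[].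
    rewrite addrAC subrr add0r.
    by apply: le_lt_trans hv _; move: hB; rewrite lt_min => /andP[].
  have b2 : `|partial 1 F (x, y) - partial 1 F (x, c2)| <= e / B.
    rewrite distrC; apply: H1; first by rewrite subrr normr0.
    apply: le_lt_trans c2y _; rewrite addrAC subrr add0r.
    by apply: le_lt_trans hv _; move: hB; rewrite lt_min => /andP[].
  apply: (@le_trans _ _ (`|u| * (e / B) + `|v| * (e / B))).
    by apply: lerD; rewrite ler_wpM2l.
  rewrite -mulrDl mulrCA ger_pMr// ler_pdivrMr// mul1r /B lerDl//.
by apply: DeriveDef; [apply/cvg_ex; exists d|apply: cvg_lim].
Unshelve. all: by end_near. Qed.

End LineDerivative.

Section Green.
Context {R : realType}.
Notation mu := (@lebesgue_measure R).
Implicit Types (a b c p q : R * R) (F : R * R -> R).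

Definition ref_tri : set (R * R) := [set x | [/\ 0 <= x.1, 0 <= x.2 & x.1 + x.2 <= 1]].

Lemma ge0_integral_taff a b c (g : R * R -> \bar R) : tdet a b c != 0 ->
  measurable_fun [set: R * R] g -> (forall p, 0 <= g p)%E ->
  (\int[area]_p g p = `|tdet a b c|%:E * \int[area]_x g (taff a b c x))%E.
Proof.
move=> D0 mg g0.
have DE : (b.1 - a.1) * (c.2 - a.2) - (c.1 - a.1) * (b.2 - a.2) = tdet a b c.
  by rewrite /tdet [(c.1 - _) * _]mulrC.
have D1 : (b.1 - a.1) * (c.2 - a.2) - (c.1 - a.1) * (b.2 - a.2) != 0 by rewrite DE.
rewrite (ge0_integral_area_affine a.1 a.2 D1 mg g0) DE muleA -EFinM.
by rewrite mulfV ?normr_eq0// mul1e.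
Qed.

Lemma measurable_taff a b c : measurable_fun [set: R * R] (taff a b c).
Proof. exact: measurable_affine2. Qed.

Lemma integrable_taff a b c (f : R * R -> \bar R) : tdet a b c != 0 ->
  area.-integrable setT f -> area.-integrable setT (f \o taff a b c).
Proof.
move=> D0 /integrableP[mf fi]; apply/integrableP; split.
  exact: (measurableT_comp mf (measurable_taff a b c)).
move: fi; rewrite (ge0_integral_taff D0)//; last first.
  by apply: measurableT_comp => //; exact: mf.
apply: contraTT; rewrite -!leNgt !leye_eq => /eqP ->.
by rewrite gt0_muley// lte_fin normr_gt0.
Qed.

Lemma integral_taff a b c (f : R * R -> \bar R) : tdet a b c != 0 ->
  area.-integrable setT f ->
  (\int[area]_p f p = `|tdet a b c|%:E * \int[area]_x f (taff a b c x))%E.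
Proof.
move=> D0 intf; have mf := measurable_int _ intf.
rewrite integralE [in RHS]integralE.
rewrite (ge0_integral_taff D0 (measurable_funepos mf)); last by move=> p; exact: funepos_ge0.
rewrite (ge0_integral_taff D0 (measurable_funeneg mf)); last by move=> p; exact: funeneg_ge0.
have i2 := integrable_taff D0 intf.
have fn := integrable_neg_fin_num measurableT i2.
have df : (`|tdet a b c|%:E : \bar R) \is a fin_num by [].
have -> : (\int[area]_x f^\+ (taff a b c x) = \int[area]_x (f \o taff a b c)^\+ x)%E.
  by apply: eq_integral => x _; rewrite !funeposE.
have -> : (\int[area]_x f^\- (taff a b c x) = \int[area]_x (f \o taff a b c)^\- x)%E.
  by apply: eq_integral => x _; rewrite !funenegE.
apply/esym; apply: (muleBr df).
by apply: fin_num_adde_defl; rewrite fin_numN.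
Qed.

Lemma measurable_ref_tri : measurable ref_tri.
Proof.
have D0 : tdet ((0, 0) : R * R) (1, 0) (0, 1) != 0 by rewrite /tdet/= !subr0 mulr1 mul0r subr0 oner_neq0.
rewrite (_ : ref_tri = tri (0, 0) (1, 0) (0, 1)); first exact: measurable_tri.
apply/seteqP; split => p; rewrite /tri /ref_tri /baryb /baryc /tdet/=;
  by rewrite !(subr0, mulr1, mul0r, mulr0, addr0, add0r, oppr0, mul1r, divr1, invr1).
Qed.

Lemma Rintegral_tri a b c F : tdet a b c != 0 ->
  area.-integrable (tri a b c) (EFin \o F) ->
  \int[area]_(p in tri a b c) F p =
  `|tdet a b c| * \int[area]_(x in ref_tri) F (taff a b c x).
Proof.
move=> D0 iF.
have iF' : area.-integrable setT ((EFin \o F) \_ (tri a b c)).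
  by apply/(integrable_restrict area (measurable_tri a b c) measurableT); rewrite setTI.
have i2 := integrable_taff D0 iF'.
have E : ((EFin \o F) \_ (tri a b c)) \o taff a b c = (EFin \o (F \o taff a b c)) \_ ref_tri.
  apply/funext => x /=; rewrite !patchE /=.
  suff -> : (taff a b c x \in tri a b c) = (x \in ref_tri) by [].
  by apply/idP/idP => /set_mem h; apply/mem_set; move: h;
    rewrite /tri /ref_tri/= baryb_taff// baryc_taff.
rewrite /Rintegral integral_mkcond (integral_taff D0 iF') fineM//.
  by congr (_ * fine _); rewrite [RHS]integral_mkcond -E.
exact: (integrable_fin_num measurableT i2).
Qed.

Lemma tri_box a b c : tdet a b c != 0 -> exists M, tri a b c `<=` box M.
Proof.
move=> D0; exists (`|b.1 - a.1| + `|c.1 - a.1| + `|a.1| + (`|b.2 - a.2| + `|c.2 - a.2| + `|a.2|)).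
move=> p; rewrite -{2}(taff_bary D0 p) => -[x0 y0 xy].
set x := baryb _ _ _ p in x0 xy *; set y := baryc _ _ _ p in y0 xy *.
have key (u v w : R) : `|u * x + v * y + w| <= `|u| + `|v| + `|w|.
  rewrite (le_trans (ler_normD _ _))// lerD2r (le_trans (ler_normD _ _))// !normrM.
  by rewrite (ger0_norm x0) (ger0_norm y0); apply: lerD; rewrite ler_piMr//; lra.
apply/boxP; split; rewrite /taff/=.
  by apply: le_trans (key _ _ _) _; rewrite lerDl !addr_ge0.
by apply: le_trans (key _ _ _) _; rewrite lerDr !addr_ge0.
Qed.

Lemma tri_bounded a b c F : tdet a b c != 0 -> continuous F ->
  exists2 C : R, 0 <= C & forall p, tri a b c p -> `|F p| <= C.
Proof.
move=> D0 cF; have [M HM] := tri_box D0; have [C C0 HC] := continuous_box_bounded M cF.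
by exists C => // p /HM; exact: HC.
Qed.

Lemma area_tri_lty a b c : tdet a b c != 0 -> (area (tri a b c) < +oo)%E.
Proof.
move=> D0; have [M HM] := tri_box D0; apply: le_lt_trans (area_box_lty M).
by apply: area_le => //; [exact: measurable_tri|exact: measurable_box].
Qed.

Lemma continuous_tri_integrable a b c F : tdet a b c != 0 -> continuous F ->
  area.-integrable (tri a b c) (EFin \o F).
Proof.
move=> D0 cF; have [C _ HC] := tri_bounded D0 cF.
apply: measurable_bounded_integrable; first exact: measurable_tri.
- exact: area_tri_lty.
- exact: (measurable_funTS (continuous_measurable_fun2 cF)).
- exists C; split; first exact: num_real.
  by move=> x nx p Tp /=; rewrite (le_trans (HC p Tp))// ltW.
Qed.

Lemma tdet_ref : tdet ((0, 0) : R * R) (1, 0) (0, 1) != 0.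
Proof. by rewrite /tdet/= !subr0 mulr1 mul0r subr0 oner_neq0. Qed.

Lemma ref_triE : ref_tri = tri (0, 0) (1, 0) (0, 1).
Proof.
apply/seteqP; split => p; rewrite /tri /ref_tri /baryb /baryc /tdet/=;
  by rewrite !(subr0, mulr1, mul0r, mulr0, addr0, add0r, oppr0, mul1r, divr1, invr1).
Qed.

Lemma taff_continuous a b c : continuous (taff a b c).
Proof.
move=> p; apply: (@cvg_pair _ _ _ _ (nbhs ((b.1 - a.1) * p.1 + (c.1 - a.1) * p.2 + a.1))
  (nbhs ((b.2 - a.2) * p.1 + (c.2 - a.2) * p.2 + a.2))); exact: affine_continuous.
Qed.

Lemma line_integral F p (u v x : R) : smooth F -> 0 <= x ->
  (\int[mu]_(t in `[0%R, x]) (u * partial 0 F (p.1 + t * u, p.2 + t * v) +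
     v * partial 1 F (p.1 + t * u, p.2 + t * v))%:E =
   (F (p.1 + x * u, p.2 + x * v))%:E - (F p)%:E)%E.
Proof.
move=> sF; have dL t := is_derive_line p u v t sF.
set L := fun t => F (p.1 + t * u, p.2 + t * v) in dL *.
set k := fun t => u * partial 0 F (p.1 + t * u, p.2 + t * v) + v * partial 1 F (p.1 + t * u, p.2 + t * v).
have L0 : L 0 = F p by rewrite /L !mul0r !addr0 -surjective_pairing.
rewrite le_eqVlt => /orP[/eqP <-|x0].
  by rewrite set_itv1 integral_set1 !mul0r !addr0 -surjective_pairing subee.
have cL t : {for t, continuous L}.
  by have [+ _] := dL t; move=> /derivable1_diffP/differentiable_continuous.
have cline : continuous (fun t : R => (p.1 + t * u, p.2 + t * v)).
  move=> t; apply: (@cvg_pair _ _ _ _ (nbhs (p.1 + t * u)) (nbhs (p.2 + t * v)));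
    by apply: cvgD; [exact: cvg_cst|apply: cvgM; [exact: cvg_id|exact: cvg_cst]].
have ck : continuous k.
  have c i : continuous (fun t : R => partial i F (p.1 + t * u, p.2 + t * v)).
    move=> t; apply: (@continuous_comp _ _ _ (fun t : R => (p.1 + t * u, p.2 + t * v)) (partial i F)).
      exact: cline.
    exact: (smooth_continuous (smooth_partial i sF)).
  by move=> t; apply: cvgD; apply: cvgM; try exact: cvg_cst; exact: c.
rewrite -L0 -[F (_, _)]/(L x); apply: continuous_FTC2 => //.
- exact: continuous_subspaceT.
- split.
  + by move=> t _; have [] := dL t.
  + by apply: cvg_at_right_filter; exact: cL.
  + by apply: cvg_at_left_filter; exact: cL.
- by move=> t _; rewrite derive1E; have [_ ->] := dL t.
Qed.

Lemma continuous_segment_integrable p q F : continuous F ->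
  mu.-integrable `[0, 1] (EFin \o (fun t => F (on_segment p q t))).
Proof.
move=> cF; apply: continuous_compact_integrable; first exact: segment_compact.
apply: continuous_subspaceT => t.
apply: (@continuous_comp _ _ _ (on_segment p q) F); last exact: cF.
apply: (@cvg_pair _ _ _ _ (nbhs (p.1 + t * (q.1 - p.1))) (nbhs (p.2 + t * (q.2 - p.2))));
  by apply: cvgD; [exact: cvg_cst|apply: cvgM; [exact: cvg_id|exact: cvg_cst]].
Qed.

(** The divergence theorem for a field parallel to the edge from a to b: in the
    reference triangle this is the fundamental theorem of calculus on slices. *)
Lemma green_tri a b c F : tdet a b c != 0 -> smooth F ->
  \int[area]_(p in tri a b c)
     ((b.1 - a.1) * partial 0 F p + (b.2 - a.2) * partial 1 F p) =
  `|tdet a b c| * (\int[mu]_(t in `[0, 1]) F (on_segment b c t) -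
                   \int[mu]_(t in `[0, 1]) F (on_segment a c t)).
Proof.
move=> D0 sF.
set h := fun p => (b.1 - a.1) * partial 0 F p + (b.2 - a.2) * partial 1 F p.
have ch : continuous h.
  move=> p; apply: cvgD; apply: cvgM; try exact: cvg_cst;
  exact: (smooth_continuous (smooth_partial _ sF)).
have cF := smooth_continuous sF.
rewrite (Rintegral_tri D0); last exact: continuous_tri_integrable.
congr (_ * _); rewrite -RintegralB//; try exact: continuous_segment_integrable.
pose k := (EFin \o (h \o taff a b c)) \_ ref_tri.
have ik : area.-integrable setT k.
  apply/(integrable_restrict area measurable_ref_tri measurableT); rewrite setTI ref_triE.
  apply: (continuous_tri_integrable tdet_ref) => p.
  by apply: continuous_comp; [exact: taff_continuous|exact: ch].
rewrite /Rintegral; congr fine; rewrite integral_mkcond -/k.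
rewrite -(integral21_prod_meas1 ik) [RHS]integral_mkcond; apply: eq_integral => y _.
rewrite patchE; case: ifPn => [/set_mem/=|yn]; last first.
  apply: integral0_eq => x _; rewrite /k patchE; case: ifPn => // /set_mem[/= x0 y0 xy].
  by move/negP: yn; case; apply/mem_set; rewrite /= in_itv/= y0; lra.
rewrite in_itv/= => /andP[y0 y1].
transitivity (\int[mu]_(x in `[0%R, (1 - y)%R]) (h (taff a b c (x, y)))%:E)%E.
  rewrite [RHS]integral_mkcond; apply: eq_integral => x _; rewrite /k !patchE.
  suff -> : ((x, y) \in ref_tri) = (x \in [set` `[0, 1 - y]]) by [].
  apply/idP/idP => /set_mem H; apply/mem_set; move: H; rewrite /= in_itv/=.
    by case=> /= x0 _ xy; rewrite x0; lra.
  by move=> /andP[x0 xy]; split => //=; lra.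
have := line_integral (a.1 + y * (c.1 - a.1), a.2 + y * (c.2 - a.2)) (b.1 - a.1) (b.2 - a.2) sF
  (_ : 0 <= 1 - y).
rewrite subr_ge0 => /(_ y1) /= E; transitivity (
  (F (a.1 + y * (c.1 - a.1) + (1 - y) * (b.1 - a.1), a.2 + y * (c.2 - a.2) + (1 - y) * (b.2 - a.2)))%:E
   - (F (a.1 + y * (c.1 - a.1), a.2 + y * (c.2 - a.2)))%:E)%E.
  rewrite -E; apply: eq_integral => x _; rewrite /h /taff/=.
  have -> : (b.1 - a.1) * x + (c.1 - a.1) * y + a.1 = a.1 + y * (c.1 - a.1) + x * (b.1 - a.1) by ring.
  by have -> : (b.2 - a.2) * x + (c.2 - a.2) * y + a.2 = a.2 + y * (c.2 - a.2) + x * (b.2 - a.2) by ring.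
rewrite -EFinB; congr (_ - _)%:E; congr F; rewrite /on_segment; congr (_, _); ring.
Qed.

End Green.

(** * Completeness in square mean *)

Section L2Complete.
Context d (T : measurableType d) (R : realType).
Variables (mu : {measure set T -> \bar R}) (D : set T).
Hypothesis mD : measurable D.
Hypothesis Dfin : (mu D < +oo)%E.

Lemma limn_einf_le (u : (\bar R)^nat) (l : \bar R) : (forall n, (u n <= l)%E) ->
  (limn_einf u <= l)%E.
Proof.
move=> ul; rewrite limn_einf_lim; apply: lime_le; first exact: is_cvg_einfs.
apply: nearW => n; apply: le_trans (ul n); apply: ereal_inf_lbound.
by exists n => //=.
Qed.

(** Riesz and Fischer. Along a subsequence whose increments have square means at most 4^-j the
    sum of the absolute increments is integrable, hence finite almost everywhere, so the
    subsequence converges there; Fatou's lemma bounds the distance to the limit. *)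
Lemma square_integrable_complete (h : nat -> T -> R) :
  (forall k, square_integrable mu D (h k)) ->
  (forall e : R, 0 < e -> exists N, forall k l, (N <= k)%N -> (N <= l)%N ->
     \int[mu]_(x in D) ((h k x - h l x) ^+ 2) <= e) ->
  exists2 g, square_integrable mu D g &
    \int[mu]_(x in D) ((h k x - g x) ^+ 2) @[k --> \oo] --> (0 : R).
Proof.
move=> sh ch.
have mh k := (sh k).1.
have [nn Hnn] : exists nn : nat -> nat, forall j k l, (nn j <= k)%N -> (nn j <= l)%N ->
    \int[mu]_(x in D) ((h k x - h l x) ^+ 2) <= (4^-1) ^+ j.
  have H j : exists N, forall k l, (N <= k)%N -> (N <= l)%N ->
    \int[mu]_(x in D) ((h k x - h l x) ^+ 2) <= (4^-1 : R) ^+ j.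
    by apply: ch; rewrite exprn_gt0// invr_gt0.
  by exists (fun j => sval (cid (H j))) => j; exact: (svalP (cid (H j))).
pose m j := (\sum_(i < j.+1) nn i + j)%N.
have mS j : (m j <= m j.+1)%N by rewrite /m [X in (_ <= X + _)%N]big_ord_recr /= leq_add ?leq_addr.
have nm j i : (j <= i)%N -> (nn j <= m i)%N.
  move=> ji; have jlt : (j < i.+1)%N by [].
  by rewrite /m (bigD1 (Ordinal jlt))//= -!addnA leq_addr.
pose f j x := `|h (m j.+1) x - h (m j) x|.
have sf j : square_integrable mu D (f j).
  have [m1 m2] := square_integrableB mD (sh (m j.+1)) (sh (m j)).
  split; first by apply: measurableT_comp.
  by under [_ \o _]eq_fun do rewrite /= real_normK ?num_real//.
have mf j := (sf j).1.
pose A := fine (mu D).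
have AE : mu D = A%:E by rewrite /A fineK// ge0_fin_numE.
have A0 : 0 <= A by rewrite fine_ge0.
have intf j : \int[mu]_(x in D) f j x <= (A + 1) * (2^-1) ^+ j.
  have s1 := square_integrable_cst1 mD Dfin.
  have := cauchy_schwarz mD (sf j) s1.
  under eq_Rintegral do rewrite mulr1.
  under [X in _ <= _ * X]eq_Rintegral do rewrite expr1n.
  rewrite Rintegral_cst// mul1r -/A.
  have -> : \int[mu]_(x in D) f j x ^+ 2 = \int[mu]_(x in D) ((h (m j.+1) x - h (m j) x) ^+ 2).
    by apply: eq_Rintegral => x _; rewrite real_normK ?num_real.
  have b : \int[mu]_(x in D) ((h (m j.+1) x - h (m j) x) ^+ 2) <= (4^-1) ^+ j.
    by apply: Hnn; exact: nm.
  move=> c; rewrite -(@ler_pXn2r _ 2)// ?nnegrE.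
  - apply: le_trans c _; rewrite exprMn -exprM mulnC exprM.
    have -> : (2^-1 : R) ^+ 2 = 4^-1 by field.
    rewrite mulrC; apply: ler_pM => //; first by apply: Rintegral_ge0 => x _; exact: sqr_ge0.
    nra.
  - by apply: Rintegral_ge0 => x _; rewrite normr_ge0.
  - by rewrite mulr_ge0 ?exprn_ge0 ?invr_ge0// addr_ge0.
pose S x : \bar R := (\sum_(0 <= j <oo) (f j x)%:E)%E.
have mS' : measurable_fun D S.
  by apply: ge0_emeasurable_sum => [j x Dx _|j _]; [rewrite lee_fin normr_ge0|exact/measurable_EFinP].
have Sfin : (\int[mu]_(x in D) S x < +oo)%E.
  rewrite /S integral_nneseries//; last 2 first.
  - by move=> j; exact/measurable_EFinP.
  - by move=> j x _; rewrite lee_fin normr_ge0.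
  apply: (@le_lt_trans _ _ (\sum_(0 <= j <oo) ((A + 1) * (2^-1) ^+ j)%:E)%E).
    apply: lee_nneseries => [j _ _|j _].
      by apply: integral_ge0 => x _; rewrite lee_fin normr_ge0.
    rewrite -(fineK (integrable_fin_num mD (square_integrable_rint mD Dfin (sf j)))).
    by rewrite lee_fin intf.
  have /cvg_lim -> // : (\sum_(0 <= j < n) ((A + 1) * (2^-1) ^+ j)%:E)%E @[n --> \oo] -->
      ((A + 1) / (1 - 2^-1))%:E.
    have h2 : `|2^-1 : R| < 1 by rewrite ger0_norm ?invr_ge0// invf_lt1// ltr1n.
    have := @cvg_geometric_series _ (A + 1) _ h2.
    rewrite /geometric /series /= => c.
    apply: cvg_EFin; first by apply: nearW => n; rewrite sumEFin.
    by rewrite /comp; under eq_fun do rewrite sumEFin /=.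
  exact: ltry.
pose E := D `&` [set x | (S x < +oo)%E].
have mE : measurable E.
  have mI : measurable [set y : \bar R | (y < +oo)%E].
    rewrite (_ : [set y | _] = ~` [set +oo%E]); first by apply: measurableC; exact: emeasurable_set1.
    by apply/seteqP; split => y /=; rewrite ltey => /eqP.
  exact: (mS' mD _ mI).
have ED : E `<=` D by move=> x [].
have aeE : {ae mu, forall x, D x -> E x}.
  have iS : mu.-integrable D S.
    apply/integrableP; split => //.
    rewrite (_ : (\int[mu]_(x in D) `|S x|)%E = (\int[mu]_(x in D) S x)%E); first exact: Sfin.
    by apply: eq_integral => x _; rewrite gee0_abs//; apply: nneseries_ge0 => j _ _; rewrite lee_fin normr_ge0.
  have := integrable_ae mD iS; apply: filterS => x Sx Dx; split => //=.
  by have := Sx Dx; rewrite fin_numE => /andP[_]; rewrite ltey.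
have cE x : E x -> cvgn (fun j => h (m j) x).
  move=> [Dx Sx].
  have c1 : cvgn [normed series (fun j => h (m j.+1) x - h (m j) x)].
    apply: nondecreasing_is_cvgn.
      by apply: nondecreasing_series => j _ _; exact: normr_ge0.
    exists (fine (S x)) => _ [n _ <-].
    have S0 : (0 <= S x)%E by apply: nneseries_ge0 => j _ _; rewrite lee_fin normr_ge0.
    rewrite -lee_fin fineK; last by rewrite ge0_fin_numE.
    rewrite /series /= -sumEFin; apply: nneseries_lim_ge => j _ _.
    by rewrite lee_fin normr_ge0.
  have := normed_cvg c1.
  rewrite (_ : series _ = fun n => h (m n) x - h (m 0%N) x); last first.
    by apply/funext => n; rewrite /series /= telescope_sumr.
  move=> c2; rewrite (_ : (fun j => _) = (fun j => (h (m j) x - h (m 0%N) x) + h (m 0%N) x)).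
    by apply: is_cvgD => //; exact: is_cvg_cst.
  by apply/funext => j; rewrite subrK.
pose g x := limn (fun j => h (m j) x * \1_E x).
have cg x : h (m j) x * \1_E x @[j --> \oo] --> g x.
  have [Ex|Ex] := pselect (E x).
    have E1 : (\1_E x : R) = 1 by rewrite indicE mem_set.
    rewrite /g (_ : (fun j => _) = fun j => h (m j) x); first exact: cE.
    by apply/funext => j; rewrite E1 mulr1.
  have E1 : (\1_E x : R) = 0 by rewrite indicE memNset.
  rewrite /g (_ : (fun j => _) = fun=> 0); first by rewrite lim_cst//; exact: cvg_cst.
  by apply/funext => j; rewrite E1 mulr0.
have mhE j : measurable_fun D (fun x => h (m j) x * \1_E x).
  by apply: measurable_funM => //; exact: measurable_indic.
have mg : measurable_fun D g.
  by apply: (@measurable_fun_cvg _ _ _ D (fun j x => h (m j) x * \1_E x)) => // x _; exact: cg.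
have key (e : R) : 0 < e -> exists N, forall k, (N <= k)%N ->
    (\int[mu]_(x in D) ((h k x - g x) ^+ 2)%:E <= e%:E)%E.
  move=> e0; have [N HN] := ch e e0; exists N => k Nk.
  pose u j x := ((h k x - h (m (j + N)%N) x * \1_E x) ^+ 2)%:E.
  have mu_ j : measurable_fun D (u j).
    by apply/measurable_EFinP; apply: measurable_funX; exact: measurable_funB.
  have u0 j x : D x -> (0 <= u j x)%E by move=> _; rewrite lee_fin sqr_ge0.
  have := fatou mu mD mu_ u0.
  rewrite (_ : (\int[mu]_(x in D) limn_einf (u ^~ x))%E =
     (\int[mu]_(x in D) ((h k x - g x) ^+ 2)%:E)%E); last first.
    apply: eq_integral => x _.
    have c : u j x @[j --> \oo] --> ((h k x - g x) ^+ 2)%:E.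
      apply: cvg_EFin; first exact: nearW.
      rewrite /= expr2; under eq_fun do rewrite /u /= expr2.
      have c1 : h k x - h (m (j + N)%N) x * \1_E x @[j --> \oo] --> h k x - g x.
        apply: cvgB; first exact: cvg_cst.
        by rewrite (cvg_shiftn N (fun j => h (m j) x * \1_E x)); exact: cg.
      exact: cvgM.
    by rewrite is_cvg_limn_einfE; [exact/cvg_lim|apply/cvg_ex; eexists; exact: c].
  move=> /le_trans; apply; apply: limn_einf_le => j.
  have E2 : (\int[mu]_(x in D) u j x = \int[mu]_(x in D) ((h k x - h (m (j + N)%N) x) ^+ 2)%:E)%E.
    apply: ae_eq_integral => //.
      by apply/measurable_EFinP; apply: measurable_funX; exact: measurable_funB.
    apply: filterS aeE => x HE Dx; rewrite /u indicE mem_set ?mulr1//; exact: HE.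
  have si := square_integrableB mD (sh k) (sh (m (j + N)%N)).
  rewrite E2 -(fineK (integrable_fin_num mD si.2)) lee_fin; apply: HN => //.
  by rewrite /m (leq_trans (leq_addl j N))// leq_addl.
have sg : square_integrable mu D g.
  have [N HN] := key 1 ltr01.
  have sd : square_integrable mu D (fun x => h N x - g x).
    split; first exact: measurable_funB.
    apply/integrableP; split; first by apply/measurable_EFinP; apply: measurable_funX; exact: measurable_funB.
    under eq_integral do rewrite /= ger0_norm ?sqr_ge0//.
    by apply: le_lt_trans (HN N (leqnn N)) _; exact: ltry.
  have := square_integrableB mD (sh N) sd.
  by congr square_integrable; apply/funext => x; rewrite subKr.
exists g => //.
apply: vanish_cvg_fine; first by move=> k; apply: integral_ge0 => x _; rewrite lee_fin sqr_ge0.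
by move=> e e0; have [N HN] := key e e0; exists N.
Qed.

End L2Complete.

(** * The trace inequality *)

Section TraceInequality.
Context {R : realType}.
Implicit Types (a b c p q : R * R) (f : R * R -> R).
Local Notation mu := (@lebesgue_measure R).

Lemma tdet_swap a b c : tdet a c b = - tdet a b c.
Proof. by rewrite /tdet; ring. Qed.

Lemma baryb_swap a b c p : baryb a c b p = baryc a b c p.
Proof. by rewrite /baryb /baryc tdet_swap invrN; ring. Qed.

Lemma baryc_swap a b c p : baryc a c b p = baryb a b c p.
Proof. by rewrite /baryb /baryc tdet_swap invrN; ring. Qed.

Lemma tri_swap a b c : tri a c b = tri a b c.
Proof.
by apply/seteqP; split => p; rewrite /tri/= (baryb_swap a b) (baryc_swap a b) => -[h1 h2 h3]; split => //;
  by move: h3; rewrite addrC.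
Qed.

Lemma smooth_baryb a b c : smooth (baryb a b c).
Proof. exact: smooth_affine. Qed.

Lemma partial_affine (u v w : R) i p :
  partial i (fun p : R * R => u * p.1 + v * p.2 + w) p = if i == 0 then u else v.
Proof.
have : is_derive (coord i p) (1 : R) (slice i (fun p : R * R => u * p.1 + v * p.2 + w) p)
   (if i == 0 then u else v).
  rewrite (_ : slice _ _ _ = (fun t => (if i == 0 then u else v) * t +
    (if i == 0 then v * p.2 + w else u * p.1 + w))); first exact: is_derive_affine.
  by apply/funext => t; exact: affine_slice.
by move/is_derive_partial => [].
Qed.

Lemma continuous_on_segment p q f : continuous f -> continuous (fun t => f (on_segment p q t)).
Proof.
move=> cf t; apply: (@continuous_comp _ _ _ (on_segment p q) f); last exact: cf.
apply: (@cvg_pair _ _ _ _ (nbhs (p.1 + t * (q.1 - p.1))) (nbhs (p.2 + t * (q.2 - p.2))));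
  by apply: cvgD; [exact: cvg_cst|apply: cvgM; [exact: cvg_id|exact: cvg_cst]].
Qed.

Lemma continuous_sqr (T : topologicalType) (g : T -> R) : continuous g -> continuous (fun t => g t ^+ 2).
Proof. by move=> cg t; under eq_fun do rewrite expr2; apply: cvgM; exact: cg. Qed.

Lemma continuous_mul (T : topologicalType) (g h : T -> R) : continuous g -> continuous h ->
  continuous (fun t => g t * h t).
Proof. by move=> cg ch t; apply: cvgM; [exact: cg|exact: ch]. Qed.

(** The divergence theorem applied to the square of [f] times the barycentric
    coordinate at [b], which vanishes on the edge from [a] to [c]. *)
Lemma weighted_trace_inequality a b c f : tdet a b c != 0 -> smooth f ->
  `|tdet a b c| * \int[mu]_(t in `[0, 1]) ((1 - t) * f (on_segment b c t) ^+ 2) <=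
  2 * \int[area]_(p in tri a b c) (f p ^+ 2) +
  2 * (b.1 - a.1) ^+ 2 * \int[area]_(p in tri a b c) (partial 0 f p ^+ 2) +
  2 * (b.2 - a.2) ^+ 2 * \int[area]_(p in tri a b c) (partial 1 f p ^+ 2).
Proof.
move=> D0 sf.
have sb := smooth_baryb a b c.
have sf2 : smooth (fun p => f p * f p) by exact: smoothM.
have sF : smooth (fun p => baryb a b c p * (f p * f p)) by exact: smoothM.
have G := green_tri D0 sF.
have E1 : \int[mu]_(t in `[0, 1])
   (baryb a b c (on_segment b c t) * (f (on_segment b c t) * f (on_segment b c t))) =
   \int[mu]_(t in `[0, 1]) ((1 - t) * f (on_segment b c t) ^+ 2).
  apply: eq_Rintegral => t _; rewrite -expr2; congr (_ * _).
  by move: D0; rewrite /baryb /on_segment /tdet/= => ?; field.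
have E2 : \int[mu]_(t in `[0, 1])
   (baryb a b c (on_segment a c t) * (f (on_segment a c t) * f (on_segment a c t))) = 0.
  transitivity (\int[mu]_(t in `[0, 1]) (0 : R)); last by rewrite /Rintegral integral0.
  apply: eq_Rintegral => t _.
  by rewrite (_ : baryb a b c _ = 0) ?mul0r//; move: D0; rewrite /baryb /on_segment /tdet/= => ?; field.
rewrite E1 E2 subr0 in G; rewrite -G {G E1 E2}.
have cf := smooth_continuous sf.
have c0 := smooth_continuous (smooth_partial 0 sf).
have c1 := smooth_continuous (smooth_partial 1 sf).
have mt : measurable (tri a b c) by exact: measurable_tri.
have isq (g : R * R -> R) : continuous g -> area.-integrable (tri a b c) (EFin \o (fun p => g p ^+ 2)).
  by move=> cg; apply: continuous_tri_integrable => //; exact: continuous_sqr.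
rewrite -!RintegralZl//; [|exact: isq..].
have i1 := @rintZ _ _ _ area _ mt 2 _ (isq _ cf).
have i2 := @rintZ _ _ _ area _ mt (2 * (b.1 - a.1) ^+ 2) _ (isq _ c0).
have i3 := @rintZ _ _ _ area _ mt (2 * (b.2 - a.2) ^+ 2) _ (isq _ c1).
rewrite -RintegralD//; rewrite -RintegralD//; last exact: rintD.
apply: le_Rintegral => //.
- apply: continuous_tri_integrable => // p; apply: cvgD; apply: cvgM; try exact: cvg_cst;
  exact: (smooth_continuous (smooth_partial _ sF)).
- by apply: rintD => //; exact: rintD.
move=> p [b0 c0' bc1].
have pF i : partial i (fun p => baryb a b c p * (f p * f p)) p =
    partial i (baryb a b c) p * f p ^+ 2 + baryb a b c p * (2 * f p * partial i f p).
  have [_ ->] := partialM (smooth_has_partial i p sb) (smooth_has_partial i p sf2).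
  have [_ ->] := partialM (smooth_has_partial i p sf) (smooth_has_partial i p sf).
  by rewrite expr2; congr (_ + _ * _); ring.
rewrite !pF !partial_affine/=.
have -> : (b.1 - a.1) * ((c.2 - a.2) / tdet a b c * f p ^+ 2 + baryb a b c p * (2 * f p * partial 0 f p)) +
   (b.2 - a.2) * (- (c.1 - a.1) / tdet a b c * f p ^+ 2 + baryb a b c p * (2 * f p * partial 1 f p)) =
   f p ^+ 2 + baryb a b c p * (2 * f p * ((b.1 - a.1) * partial 0 f p + (b.2 - a.2) * partial 1 f p)).
  by move: (baryb _ _ _ _) D0 => l; rewrite /tdet => D0; field.
have b1 : baryb a b c p <= 1 by lra.
move: (baryb a b c p) b0 b1 => l l0 l1.
move: (f p) (partial 0 f p) (partial 1 f p) (b.1 - a.1) (b.2 - a.2) => x y z u v.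
have h : l * (2 * x * (u * y + v * z)) <= x ^+ 2 + (u * y + v * z) ^+ 2.
  have : 0 <= (x - (u * y + v * z)) ^+ 2 by exact: sqr_ge0.
  have : 0 <= (x + (u * y + v * z)) ^+ 2 by exact: sqr_ge0.
  by move: (u * y + v * z) => w; nra.
have : 0 <= (u * y - v * z) ^+ 2 by exact: sqr_ge0.
by nra.
Qed.

(** Adding the weighted inequalities for the two orientations of the edge removes the weight. *)
Lemma trace_inequality a b c : tdet a b c != 0 -> exists2 C : R, 0 <= C &
  forall f, smooth f -> \int[mu]_(t in `[0, 1]) (f (on_segment b c t) ^+ 2) <=
    C * (\int[area]_(p in tri a b c) (f p ^+ 2) +
         \sum_(i < 2) \int[area]_(p in tri a b c) (partial i f p ^+ 2)).
Proof.
move=> D0; have D0' : tdet a c b != 0 by rewrite tdet_swap oppr_eq0.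
pose C := 4 + 2 * (b.1 - a.1) ^+ 2 + 2 * (b.2 - a.2) ^+ 2 + 2 * (c.1 - a.1) ^+ 2 + 2 * (c.2 - a.2) ^+ 2.
have C0 : 0 <= C by rewrite /C !addr_ge0// mulr_ge0// sqr_ge0.
exists (`|tdet a b c|^-1 * C); first by rewrite mulr_ge0 ?invr_ge0.
move=> f sf; rewrite -mulrA -ler_pdivrMl ?invr_gt0 ?normr_gt0// invrK.
have cf := smooth_continuous sf.
have H1 := weighted_trace_inequality D0 sf.
have H2 := weighted_trace_inequality D0' sf.
rewrite tri_swap tdet_swap normrN in H2.
have E : \int[mu]_(t in `[0, 1]) ((1 - t) * f (on_segment c b t) ^+ 2) =
    \int[mu]_(t in `[0, 1]) (t * f (on_segment b c t) ^+ 2).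
  rewrite (@Rintegration_by_substitution_onem R _ 1) ?lexx ?ler01//; last first.
    apply: continuous_subspaceT; apply: (@continuous_mul R).
      by move=> t; apply: cvgB; [exact: cvg_cst|exact: cvg_id].
    by apply: (@continuous_sqr R); exact: continuous_on_segment.
  rewrite /unstable.onem subrr; apply: eq_Rintegral => t _; rewrite subKr; congr (_ * f _ ^+ 2).
  by rewrite /on_segment; congr (_, _); ring.
rewrite E {E} in H2.
have ci (g : R -> R) : continuous g -> mu.-integrable `[0, 1] (EFin \o (fun t => g t * f (on_segment b c t) ^+ 2)).
  move=> cg; apply: continuous_compact_integrable; first exact: segment_compact.
  apply: continuous_subspaceT; apply: (@continuous_mul R) => //.
  by apply: (@continuous_sqr R); exact: continuous_on_segment.
have -> : \int[mu]_(t in `[0, 1]) (f (on_segment b c t) ^+ 2) =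
    \int[mu]_(t in `[0, 1]) ((1 - t) * f (on_segment b c t) ^+ 2) +
    \int[mu]_(t in `[0, 1]) (t * f (on_segment b c t) ^+ 2).
  rewrite -RintegralD//.
  - by apply: eq_Rintegral => t _; ring.
  - by apply: ci => t; apply: cvgB; [exact: cvg_cst|exact: cvg_id].
  - by apply: ci => t; exact: cvg_id.
rewrite mulrDr; apply: le_trans (lerD H1 H2) _.
rewrite big_ord_recl big_ord1 [lift _ _](_ : _ = 1); last exact/val_inj.
set I0 := \int[area]_(p in _) (f p ^+ 2); set I1 := \int[area]_(p in _) _; set I2 := \int[area]_(p in _) _.
have [] : [/\ 0 <= I0, 0 <= I1 & 0 <= I2] by split; apply: Rintegral_ge0 => p _; exact: sqr_ge0.
move: I0 I1 I2 => x y z x0 y0 z0; rewrite /C.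
move: (sqr_ge0 (b.1 - a.1)) (sqr_ge0 (b.2 - a.2)) (sqr_ge0 (c.1 - a.1)) (sqr_ge0 (c.2 - a.2)).
move: ((b.1 - a.1) ^+ 2) ((b.2 - a.2) ^+ 2) ((c.1 - a.1) ^+ 2) ((c.2 - a.2) ^+ 2).
move=> u v w s u0 v0 w0 s0; rewrite -subr_ge0.
rewrite (_ : _ - _ = (2 * (u + v + w + s)) * x + (4 + 2 * v + 2 * s) * y + (4 + 2 * u + 2 * w) * z); last by ring.
by repeat (first [done | apply: addr_ge0 | apply: mulr_ge0]).
Qed.

End TraceInequality.

(** * Weak derivatives *)

Section WeakDerivative.
Context {R : realType}.
Implicit Types (D E : set (R * R)) (u v w f g phi psi : R * R -> R) (i j : 'I_2) (p x : R * R).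

Lemma Rintegral_vanish_outside D E f : D `<=` E -> (forall p, ~ D p -> f p = 0) ->
  \int[area]_(p in D) f p = \int[area]_(p in E) f p.
Proof.
move=> DE f0; rewrite Rintegral_mkcond [RHS]Rintegral_mkcond; apply: eq_Rintegral => p _.
rewrite !patchE; case: ifPn => [/set_mem Dp|/negP Dp].
  by rewrite mem_set//; exact: DE.
by rewrite f0 ?if_same// => Dp'; apply: Dp; exact: mem_set.
Qed.

Lemma partial_near f g i p : {near p, f =1 g} -> partial i f p = partial i g p.
Proof.
move=> fg; rewrite !partialE !derive1E; apply: near_eq_derive.
have cs : (if i == 0 then (t, p.2) else (p.1, t)) @[t --> coord i p] --> p.
  rewrite /coord; case: (i == 0); rewrite [X in _ --> X]surjective_pairing.
    by apply: (@cvg_pair _ _ _ _ (nbhs p.1) (nbhs p.2)); [exact: cvg_id|exact: cvg_cst].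
  by apply: (@cvg_pair _ _ _ _ (nbhs p.1) (nbhs p.2)); [exact: cvg_cst|exact: cvg_id].
have H : \forall t \near coord i p, f (if i == 0 then (t, p.2) else (p.1, t)) =
    g (if i == 0 then (t, p.2) else (p.1, t)) := cs _ fg.
by apply: filterS H => t; rewrite /slice /=; case: (i == 0).
Qed.

Lemma compact_box (M : R) : compact (box M).
Proof. by apply: compact_setX; exact: segment_compact. Qed.

Lemma test_functionI D (C : set (R * R)) f (M : R) : smooth f -> closed C -> C `<=` D ->
  C `<=` box M -> (forall p, ~ C p -> f p = 0) -> test_function D f.
Proof.
move=> sf cC CD CM f0.
have SC : closure [set p | f p != 0] `<=` C.
  rewrite [X in _ `<=` X]((closure_id _).1 cC); apply: closure_subset => p /=.
  by move=> fp; apply: contrapT => /f0 h; rewrite h eqxx in fp.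
split => //; last exact: subset_trans CD.
apply: (@subclosed_compact _ _ (box M)); [exact: closed_closure|exact: compact_box|].
exact: subset_trans CM.
Qed.

Lemma test_function_subset D E f : D `<=` E -> test_function D f -> test_function E f.
Proof. by move=> DE [? ? ?]; split => //; exact: subset_trans DE. Qed.

Lemma test_function_eq0 D f p : test_function D f -> ~ D p -> f p = 0.
Proof.
move=> [_ _ fD]; apply: contra_notP => /eqP fp; apply: fD; exact: subset_closure.
Qed.

Lemma test_function_partial D i f : test_function D f -> test_function D (partial i f).
Proof.
move=> [sf cf fD]; pose C := closure [set p | f p != 0].
have p0 p : ~ C p -> partial i f p = 0.
  move=> Cp; have -> : partial i f p = partial i (fun=> 0) p.
    apply: partial_near.
    have : nbhs p (~` C) by apply: open_nbhs_nbhs; split => //; apply: closed_openC; exact: closed_closure.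
    apply: filterS => x Cx; apply/eqP; apply: contrapT => /negP fx; apply: Cx.
    exact: subset_closure.
  have [] := @partial_scale R 0 (fun=> 0) i p; first exact: smooth_has_partial (smooth_cst _).
  by move=> _; under eq_fun do rewrite mul0r; rewrite mul0r.
have SC : closure [set p | partial i f p != 0] `<=` C.
  rewrite [X in _ `<=` X]((closure_id _).1 (@closed_closure _ _)).
  apply: closure_subset => p /= fp; apply: contrapT => /p0 h; by rewrite h eqxx in fp.
split; [exact: smooth_partial| |exact: subset_trans fD].
by apply: (@subclosed_compact _ _ C) => //; exact: closed_closure.
Qed.

Lemma test_functionM D f g : smooth f -> test_function D g -> test_function D (fun p => f p * g p).
Proof.
move=> sf [sg cg gD]; pose C := closure [set p | g p != 0].
have SC : closure [set p | f p * g p != 0] `<=` C.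
  by apply: closure_subset => p /=; apply: contra_neq => ->; rewrite mulr0.
split; [exact: smoothM| |exact: subset_trans gD].
by apply: (@subclosed_compact _ _ C) => //; exact: closed_closure.
Qed.

Global Instance ae_area_filter : Filter (almost_everywhere (@area R)).
Proof. exact: (@ae_filter_ringOfSetsType _ _ _ area). Qed.

Section Bounded.
Variables (D : set (R * R)) (M : R).
Hypothesis mD : measurable D.
Hypothesis DM : D `<=` box M.

Lemma area_lty_bounded : (area D < +oo)%E.
Proof.
apply: le_lt_trans (area_box_lty M); apply: area_le => //; exact: measurable_box.
Qed.

Lemma continuous_square_integrable f : continuous f -> square_integrable area D f.
Proof.
move=> cf; have [C _ HC] := continuous_box_bounded M cf.
apply: (@bounded_square_integrable _ _ _ area D mD f C area_lty_bounded).
  by apply: (@measurable_funS _ _ _ _ setT) => //; exact: continuous_measurable_fun2.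
by move=> p /DM; exact: HC.
Qed.

Lemma smooth_square_integrable f : smooth f -> square_integrable area D f.
Proof. by move=> /smooth_continuous; exact: continuous_square_integrable. Qed.

Lemma mul_smooth_integrable u f : square_integrable area D u -> smooth f ->
  area.-integrable D (EFin \o (fun p => u p * f p)).
Proof.
by move=> su sf; apply: (@square_integrable_mul _ _ _ area D mD _ _ su); exact: smooth_square_integrable.
Qed.

(** A test function and its derivatives vanish on the edges of a large triangle containing [D]. *)
Lemma Rintegral_partial_test i f : test_function D f -> \int[area]_(p in D) partial i f p = 0.
Proof.
move=> tf; have [sf _ _] := tf.
pose N := `|M| + 1; have N0 : 0 < N by rewrite ltr_wpDl.
have MN : M < N by rewrite (le_lt_trans (ler_norm M))// ltrDl.
pose a : R * R := (- N, - N); pose b : R * R := (3 * N, - N); pose c : R * R := (- N, 3 * N).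
have dE : tdet a b c = 16 * N ^+ 2 by rewrite /tdet /a /b /c/=; ring.
have d0 : tdet a b c != 0 by rewrite dE mulf_neq0// ?expf_neq0// gt_eqF.
have bE p : baryb a b c p = (p.1 + N) / (4 * N).
  by rewrite /baryb dE /a /b /c/=; field; rewrite gt_eqF.
have cE p : baryc a b c p = (p.2 + N) / (4 * N).
  by rewrite /baryc dE /a /b /c/=; field; rewrite gt_eqF.
have DT : D `<=` tri a b c.
  move=> p /DM/boxP[]; rewrite !ler_norml => /andP[p1 p2] /andP[p3 p4].
  rewrite /tri/= bE cE -mulrDl; split.
  - by rewrite divr_ge0//; lra.
  - by rewrite divr_ge0//; lra.
  - by rewrite ler_pdivrMr ?mul1r; lra.
have f0 p : N <= p.1 \/ N <= p.2 \/ p.1 = - N \/ p.2 = - N -> f p = 0.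
  move=> h; apply: (test_function_eq0 tf) => /DM/boxP[]; rewrite !ler_norml => /andP[p1 p2] /andP[p3 p4].
  by move: h => [|[|[|]]] ?; lra.
rewrite (Rintegral_vanish_outside DT); last first.
  by move=> p; apply: test_function_eq0; exact: test_function_partial.
have E0 (p q : R * R) : (forall t, f (on_segment p q t) = 0) ->
    \int[@lebesgue_measure R]_(t in `[0, 1]) f (on_segment p q t) = 0.
  move=> h; transitivity (\int[@lebesgue_measure R]_(t in `[0, 1]) (0 : R)).
    by apply: eq_Rintegral => t _; exact: h.
  by rewrite /Rintegral integral0.
have h1 t : f (on_segment b c t) = 0.
  apply: f0; rewrite /on_segment/=.
  have [th|th] := leP t (1/2); [left|right; left]; nra.
have h2 t : f (on_segment a c t) = 0 by apply: f0; right; right; left; rewrite /on_segment/=; ring.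
have h3 t : f (on_segment a b t) = 0 by apply: f0; right; right; right; rewrite /on_segment/=; ring.
have h4 t : f (on_segment c b t) = 0.
  apply: f0; rewrite /on_segment/=.
  have [th|th] := leP t (1/2); [right; left|left]; nra.
have ic j : area.-integrable (tri a b c) (EFin \o partial j f).
  by apply: continuous_tri_integrable => //; exact: smooth_continuous (smooth_partial _ sf).
have mt := measurable_tri a b c.
have [i0|i1] := eqVneq i 0.
  have := green_tri d0 sf; rewrite !E0// subrr mulr0.
  rewrite (_ : (fun p => _) = (fun p => (4 * N) * partial i f p)).
    rewrite RintegralZl// ?i0//; move/eqP; rewrite mulf_eq0 (gt_eqF (_ : 0 < 4 * N))//=; first by move/eqP.
    by rewrite mulr_gt0.
  by apply/funext => p; rewrite i0 /a /b/=; ring.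
have {}i1 : i = 1 by apply/val_inj; move: i i1 => [[|[|?]] ?].
have d0' : tdet a c b != 0 by rewrite tdet_swap oppr_eq0.
have := green_tri d0' sf; rewrite !E0// subrr mulr0 tri_swap.
rewrite (_ : (fun p => _) = (fun p => (4 * N) * partial i f p)).
  rewrite RintegralZl// ?i1//; move/eqP; rewrite mulf_eq0 (gt_eqF (_ : 0 < 4 * N))//=; first by move/eqP.
  by rewrite mulr_gt0.
by apply/funext => p; rewrite i1 /a /c/=; ring.
Qed.

(** Integration by parts: the product of a smooth function and a test function is a test
    function, whose derivatives have integral zero. *)
Lemma smooth_weak_partial i f : smooth f -> weak_partial D i f (partial i f).
Proof.
move=> sf phi tp; have [sp _ _] := tp.
have := Rintegral_partial_test i (test_functionM sf tp).
have -> : partial i (fun p => f p * phi p) = fun p => partial i f p * phi p + f p * partial i phi p.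
  by apply/funext => p; have [] := partialM (smooth_has_partial i p sf) (smooth_has_partial i p sp).
rewrite RintegralD//.
- by move/eqP; rewrite addrC addr_eq0 => /eqP.
- by apply: mul_smooth_integrable => //; apply: smooth_square_integrable; exact: smooth_partial.
- by apply: mul_smooth_integrable; [exact: smooth_square_integrable|exact: smooth_partial].
Qed.

Lemma weak_partialB i u v u' v' : square_integrable area D u -> square_integrable area D v ->
  square_integrable area D u' -> square_integrable area D v' ->
  weak_partial D i u v -> weak_partial D i u' v' ->
  weak_partial D i (fun p => u p - u' p) (fun p => v p - v' p).
Proof.
move=> su sv su' sv' w w' phi tp; have [sp _ _] := tp.
have h (x y : R * R -> R) f : square_integrable area D x -> square_integrable area D y -> smooth f ->
    \int[area]_(p in D) ((x p - y p) * f p) =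
    \int[area]_(p in D) (x p * f p) - \int[area]_(p in D) (y p * f p).
  move=> sx sy sf; rewrite -RintegralB//; [|exact: mul_smooth_integrable..].
  by apply: eq_Rintegral => p _; rewrite mulrBl.
rewrite !h//; last exact: smooth_partial.
by rewrite (w _ tp) (w' _ tp) opprB opprK addrC.
Qed.

Lemma weak_partial_ae i u u' v : square_integrable area D u -> square_integrable area D u' ->
  {ae area, forall p, D p -> u p = u' p} -> weak_partial D i u v -> weak_partial D i u' v.
Proof.
move=> su su' uu w phi tp; have [sp _ _] := tp.
have sp' := smooth_partial i sp.
rewrite -(w _ tp); apply: (@ae_eq_Rintegral _ _ _ area D mD).
- exact: rint_measurable (mul_smooth_integrable su' sp').
- exact: rint_measurable (mul_smooth_integrable su sp').
- by apply: filterS uu => p h Dp; rewrite h.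
Qed.

End Bounded.

(** Test functions on the smaller set are test functions on the larger one and vanish outside
    the smaller one. *)
Lemma weak_partial_subset D E i u v : D `<=` E -> weak_partial E i u v -> weak_partial D i u v.
Proof.
move=> DE w phi tp; have tE := test_function_subset DE tp.
have h f psi : test_function D psi -> \int[area]_(p in D) (f p * psi p) = \int[area]_(p in E) (f p * psi p).
  by move=> tpsi; apply: Rintegral_vanish_outside => // p /(test_function_eq0 tpsi) ->; rewrite mulr0.
by rewrite !h// ?w//; exact: test_function_partial.
Qed.

End WeakDerivative.

(** * Mollification on a triangle *)

(** In the application [D] is the interior of the closed triangle. *)
Section Approximation.
Context {R : realType}.
Variables (a b c : R * R) (D : set (R * R)).
Hypothesis D0 : tdet a b c != 0.
Hypothesis oD : open D.
Hypothesis otriD : otri a b c `<=` D.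
Hypothesis Dtri : D `<=` tri a b c.
Implicit Types (u v w g f : R * R -> R) (i j : 'I_2) (p x y : R * R) (k : nat).

Let mD : measurable D := open_measurable2 oD.

Lemma between_bounded : exists M, D `<=` box M.
Proof. by have [M HM] := tri_box D0; exists M; exact: subset_trans HM. Qed.

Lemma between_lty : (area D < +oo)%E.
Proof. by have [M DM] := between_bounded; exact: area_lty_bounded DM. Qed.

Lemma between_null : area (tri a b c `\` D) = 0%E.
Proof.
apply/eqP; rewrite eq_le; apply/andP; split; last exact: measure_ge0.
rewrite -(area_tri_otri D0); apply: area_le.
- by apply: measurableD; [exact: measurable_tri|exact: mD].
- by apply: measurableD; [exact: measurable_tri|apply: open_measurable2; exact: open_otri].
- by move=> p [Tp Dp]; split => // /otriD.
Qed.

Lemma Rintegral_between f : continuous f ->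
  \int[area]_(p in tri a b c) f p = \int[area]_(p in D) f p.
Proof.
move=> cf; rewrite /Rintegral; congr fine.
have mN : measurable (tri a b c `\` D).
  by apply: measurableD; [exact: measurable_tri|exact: mD].
rewrite (@negligible_integral _ _ _ area (tri a b c) (tri a b c `\` D)) //.
- rewrite setDD (_ : tri a b c `&` D = D)//.
  by apply/seteqP; split => [p []//|p Dp]; split => //; exact: Dtri.
- exact: measurable_tri.
- exact: continuous_tri_integrable.
- exact: between_null.
Qed.

(** The functions below are mollified after a contraction towards the centroid,
    so that the mollifying kernels at the points of the closed triangle are
    compactly supported inside it. *)
Definition centroid : R * R := ((a.1 + b.1 + c.1) / 3, (a.2 + b.2 + c.2) / 3).

(** A Lipschitz constant of the barycentric coordinates for the sup norm; the summand 1 makes it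
    positive. *)
Definition slope : R :=
  1 + (`|(c.2 - a.2) / tdet a b c| + `|- (c.1 - a.1) / tdet a b c|) +
  (`|- (b.2 - a.2) / tdet a b c| + `|(b.1 - a.1) / tdet a b c|).

Definition shrink k : R := 1 - (k.+2%:R)^-1.

(** The contraction raises the barycentric coordinates to at least k.+2^-1 / 3, while over this
    distance those at [b] and [c] vary by at most k.+2^-1 / 12, hence the third by twice that. *)
Definition radius k : R := (k.+2%:R)^-1 / (12 * slope).

Definition approx g k : R * R -> R := mollify D g centroid shrink radius k.

Lemma slope_gt0 : 0 < slope.
Proof. by rewrite /slope -addrA ltr_wpDr// !addr_ge0. Qed.

Lemma shrink_itv k : 1 / 2 <= shrink k <= 1.
Proof.
have h : (k.+2%:R : R)^-1 <= 2^-1 by rewrite lef_pV2 ?posrE// ler_nat.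
have h' : 0 <= (k.+2%:R : R)^-1 by rewrite invr_ge0.
rewrite /shrink; move: (k.+2%:R^-1) h h' => e h h'.
by apply/andP; split; lra.
Qed.

Lemma radius_gt0 k : 0 < radius k.
Proof. by rewrite /radius divr_gt0// ?invr_gt0// mulr_gt0// slope_gt0. Qed.

Lemma cvg_invS2 : (k.+2%:R : R)^-1 @[k --> \oo] --> (0 : R).
Proof.
have := @cvg_harmonic R; rewrite /harmonic => h.
by rewrite -(cvg_shiftS (fun k => k.+1%:R^-1 : R)) in h.
Qed.

Lemma cvg_shrink : shrink k @[k --> \oo] --> (1 : R).
Proof.
rewrite -[X in _ --> X](subr0 (1 : R)); apply: cvgB; [exact: cvg_cst|exact: cvg_invS2].
Qed.

Lemma cvg_radius : radius k @[k --> \oo] --> (0 : R).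
Proof.
rewrite -[X in _ --> X](mul0r ((12 * slope)^-1)); apply: cvgM; [exact: cvg_invS2|exact: cvg_cst].
Qed.

Lemma approx_cvg g : square_integrable area D g ->
  \int[area]_(x in D) ((approx g k x - g x) ^+ 2) @[k --> \oo] --> (0 : R).
Proof.
have [M DM] := between_bounded; move=> sg.
exact: (mollify_cvg mD DM sg centroid shrink_itv radius_gt0 cvg_shrink cvg_radius).
Qed.

Lemma between_integrable g : square_integrable area D g -> area.-integrable D (EFin \o g).
Proof. by move=> sg; apply: (@square_integrable_rint _ _ _ area D mD _ between_lty). Qed.

Lemma smooth_approx g k : square_integrable area D g -> smooth (approx g k).
Proof.
move=> sg; apply: conv_smooth => //; first exact: between_integrable.
by apply: box_smooth_mollifier; exact: radius_gt0.
Qed.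

(** A closed subset of the open triangle that will contain the supports of the kernels. *)
Definition core (e : R) : set (R * R) :=
  [set p | [/\ e <= baryb a b c p, e <= baryc a b c p & baryb a b c p + baryc a b c p <= 1 - e]].

Lemma closed_core e : closed (core e).
Proof.
rewrite (_ : core e = (baryb a b c @^-1` `[e, +oo[) `&` (baryc a b c @^-1` `[e, +oo[)
  `&` ((fun p => baryb a b c p + baryc a b c p) @^-1` `]-oo, 1 - e])); last first.
  apply/seteqP; split => p; rewrite /core /setI/= !in_itv/= !andbT; first by case.
  by case=> -[].
apply: closedI; [apply: closedI|]; apply: preimage_closed; try exact: interval_closed.
- by move=> p _; exact: baryb_continuous.
- by move=> p _; exact: baryc_continuous.
- by move=> p _; apply: cvgD; [exact: baryb_continuous|exact: baryc_continuous].
Qed.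

Lemma core_otri e : 0 < e -> core e `<=` otri a b c.
Proof.
move=> e0 p [h1 h2 h3]; split; [exact: lt_le_trans h1|exact: lt_le_trans h2|].
by rewrite (le_lt_trans h3)// ltrBlDr ltrDl.
Qed.

Definition contract k x : R * R :=
  (shrink k * x.1 + (1 - shrink k) * centroid.1, shrink k * x.2 + (1 - shrink k) * centroid.2).

Lemma affine_near (u v w r : R) p y : `|p.1 - y.1| < r -> `|p.2 - y.2| < r ->
  `|(u * p.1 + v * p.2 + w) - (u * y.1 + v * y.2 + w)| <= (`|u| + `|v|) * r.
Proof.
move=> h1 h2; rewrite (_ : _ - _ = u * (p.1 - y.1) + v * (p.2 - y.2)); last by ring.
rewrite (le_trans (ler_normD _ _))// !normrM mulrDl lerD// ler_wpM2l//; exact: ltW.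
Qed.

Lemma kernel_core k x y : tri a b c x ->
  `|(contract k x).1 - y.1| < radius k -> `|(contract k x).2 - y.2| < radius k ->
  core (k.+2%:R^-1 / 6) y.
Proof.
move=> [x1 x2 x3] h1 h2.
have e0 : 0 < (k.+2%:R : R)^-1 by rewrite invr_gt0.
have /andP[s0 s1'] := shrink_itv k.
have bE : baryb a b c (contract k x) = shrink k * baryb a b c x + k.+2%:R^-1 / 3.
  rewrite /contract /shrink; move: (k.+2%:R^-1) D0 => e.
  by rewrite /baryb /centroid /tdet/= => ?; field.
have cE : baryc a b c (contract k x) = shrink k * baryc a b c x + k.+2%:R^-1 / 3.
  rewrite /contract /shrink; move: (k.+2%:R^-1) D0 => e.
  by rewrite /baryc /centroid /tdet/= => ?; field.
have rs : slope * radius k = k.+2%:R^-1 / 12.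
  by rewrite /radius; move: (k.+2%:R^-1) => e; field; rewrite gt_eqF// slope_gt0.
have bL : `|baryb a b c (contract k x) - baryb a b c y| <= k.+2%:R^-1 / 12.
  apply: le_trans (affine_near _ _ _ h1 h2) _; rewrite -rs ler_wpM2r//; first exact/ltW/radius_gt0.
  by rewrite /slope -addrA (addrC 1) -addrA lerDl addr_ge0// addr_ge0.
have cL : `|baryc a b c (contract k x) - baryc a b c y| <= k.+2%:R^-1 / 12.
  apply: le_trans (affine_near _ _ _ h1 h2) _; rewrite -rs ler_wpM2r//; first exact/ltW/radius_gt0.
  by rewrite /slope lerDr addr_ge0// addr_ge0.
move: bL cL; rewrite bE cE !ler_norml => /andP[b1 b2] /andP[c1 c2].
have sb : 0 <= shrink k * baryb a b c x by rewrite mulr_ge0//; lra.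
have sc : 0 <= shrink k * baryc a b c x by rewrite mulr_ge0//; lra.
have sbc : shrink k * baryb a b c x + shrink k * baryc a b c x <= 1 - k.+2%:R^-1.
  by rewrite -mulrDr -/(shrink k) ler_piMr//; lra.
move: b1 b2 c1 c2 sb sc sbc e0; move: (_ * baryb _ _ _ _) (_ * baryc _ _ _ _) (k.+2%:R^-1).
by move=> X Y e *; split; lra.
Qed.

Let ker k x y : R := mollifier (radius k) (homothety ((1 - shrink k) * centroid.1 - y.1) (shrink k)
  ((1 - shrink k) * centroid.2 - y.2) (shrink k) x).

Lemma kerE k x y : ker k x y = (mollifier (radius k) \o homothety (contract k x).1 (-1) (contract k x).2 (-1)) y.
Proof. by rewrite /ker /homothety/= /contract/=; move: (shrink k) (mollifier _) => s m; congr (m (_, _)); ring. Qed.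

Lemma ker_eq0 k x y : tri a b c x -> ~ core (k.+2%:R^-1 / 6) y -> ker k x y = 0.
Proof.
move=> Tx Cy; rewrite kerE /=; apply: mollifier_eq0; first exact: radius_gt0.
move=> [h1 h2]; apply: Cy; apply: (kernel_core Tx).
- by move: h1; rewrite /homothety/= mulN1r addrC.
- by move: h2; rewrite /homothety/= mulN1r addrC.
Qed.

Lemma ker_test k x : tri a b c x -> test_function D (ker k x).
Proof.
move=> Tx; have [M DM] := between_bounded.
have e0 : 0 < (k.+2%:R : R)^-1 / 6 by rewrite divr_gt0// invr_gt0.
have CD : core (k.+2%:R^-1 / 6) `<=` D by apply: subset_trans (core_otri e0) otriD.
apply: (@test_functionI _ _ (core (k.+2%:R^-1 / 6)) _ M).
- rewrite (_ : ker k x = (mollifier (radius k) \o homothety (contract k x).1 (-1) (contract k x).2 (-1))).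
    by apply: smooth_homothety; have [] := box_smooth_mollifier (radius_gt0 k).
  by apply/funext => y; exact: kerE.
- exact: closed_core.
- exact: CD.
- exact: subset_trans DM.
- by move=> y; exact: ker_eq0.
Qed.

Lemma approxE g k x : approx g k x = \int[area]_(y in D) (g y * ker k x y).
Proof. by []. Qed.

(** On the closed triangle mollification commutes with weak derivatives, up to the
    contraction factor, as the kernels are test functions. *)
Lemma partial_approx u v i k x : square_integrable area D u -> weak_partial D i u v ->
  tri a b c x -> partial i (approx u k) x = shrink k * approx v k x.
Proof.
move=> su wuv Tx.
have [_ E] := @conv_partial _ D u (shrink k) ((1 - shrink k) * centroid.1)
  ((1 - shrink k) * centroid.2) mD (between_integrable su) _ i x (box_smooth_mollifier (radius_gt0 k)).
rewrite [LHS]E; congr (_ * _).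
have := wuv _ (ker_test k Tx); rewrite -approxE => W.
apply: oppr_inj; rewrite -W -mulN1r /conv.
have [sm _] := box_smooth_mollifier (radius_gt0 k).
rewrite -RintegralZl//; last first.
  apply: conv_integrable; [exact: mD|exact: between_integrable|].
  by apply: box_smooth_partial; exact: box_smooth_mollifier (radius_gt0 k).
apply: eq_Rintegral => y _; rewrite mulrCA; congr (_ * _).
rewrite (_ : ker k x = (mollifier (radius k) \o homothety (contract k x).1 (-1) (contract k x).2 (-1))); last first.
  by apply/funext => z; exact: kerE.
have [_ ->] := partial_homothety (smooth_has_partial i (homothety (contract k x).1 (-1) (contract k x).2 (-1) y) sm).
rewrite if_same; congr (_ * partial _ _ _).
rewrite /homothety /contract/=; move: (shrink k) => t; congr (_, _); ring.
Qed.

(** Mollification recovers a function from its integrals against test functions. *)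
Lemma weak_eq0 v : square_integrable area D v ->
  (forall phi, test_function D phi -> \int[area]_(p in D) (v p * phi p) = 0) ->
  {ae area, forall p, D p -> v p = 0}.
Proof.
move=> sv v0; apply: (@square_integral_eq0 _ _ _ area D mD) => //.
have := approx_cvg sv.
rewrite (_ : (fun k => _) = (fun=> \int[area]_(x in D) (v x ^+ 2))).
  by move=> h; apply: (cvg_unique _ (cvg_cst _) h) => //; exact: Rhausdorff.
apply/funext => k; apply: eq_Rintegral => x /set_mem Dx.
by rewrite approxE v0 ?sub0r ?sqrrN//; apply: ker_test; exact: Dtri.
Qed.

Lemma weak_partial_unique i u v w : square_integrable area D v -> square_integrable area D w ->
  weak_partial D i u v -> weak_partial D i u w -> {ae area, forall p, D p -> v p = w p}.
Proof.
move=> sv sw uv uw.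
have : {ae area, forall p, D p -> v p - w p = 0}.
  apply: weak_eq0; first exact: (@square_integrableB _ _ _ area D mD).
  move=> phi tp; have [sp _ _] := tp; have [M DM] := between_bounded.
  under eq_Rintegral do rewrite mulrBl.
  rewrite RintegralB//; [|exact: (mul_smooth_integrable mD DM)..].
  by apply/eqP; rewrite subr_eq0 -eqr_opp -(uv _ tp) (uw _ tp).
by apply: filterS => p h Dp; apply/eqP; rewrite -subr_eq0 h.
Qed.

(** Since weak derivatives are unique up to null sets, [wpartial] can be computed from any
    weak derivative. *)
Lemma wpartialP i u v : square_integrable area D v -> weak_partial D i u v ->
  [/\ square_integrable area D (wpartial D i u), weak_partial D i u (wpartial D i u)
    & {ae area, forall p, D p -> wpartial D i u p = v p}].
Proof.
move=> sv uv.
have [s w] : square_integrable area D (wpartial D i u) /\ weak_partial D i u (wpartial D i u).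
  have [] := @xgetPex _ (fun=> 0) [set v | L2 D v /\ weak_partial D i u v].
    by exists v; split => //; apply/(Lfun2P area mD).
  by move=> /(Lfun2P area mD).
by split => //; exact: (weak_partial_unique s sv w uv).
Qed.

(** The kernels are probability densities that concentrate at [x], and they only see the values
    of [u] on the triangle. *)
Lemma approx_cvg_point u x : square_integrable area D u -> tri a b c x ->
  {within tri a b c, continuous u} -> approx u k x @[k --> \oo] --> u x.
Proof.
move=> su Tx cu; apply/cvgrPdist_le => e e0.
have cux := (subspace_continuousP _ _).1 cu x Tx.
have /nbhs_ballP[d /= d0 Hd] : \forall y \near x, tri a b c y -> `|u x - u y| < e.
  exact: ((cvgrPdist_lt _ _).1 cux e e0).
have kc1 : (contract k x).1 @[k --> \oo] --> x.1.
  rewrite /contract/= -[X in _ --> X](_ : 1 * x.1 + (1 - 1) * centroid.1 = x.1); last by ring.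
  apply: cvgD; apply: cvgM; try exact: cvg_cst; first exact: cvg_shrink.
  by apply: cvgB; [exact: cvg_cst|exact: cvg_shrink].
have kc2 : (contract k x).2 @[k --> \oo] --> x.2.
  rewrite /contract/= -[X in _ --> X](_ : 1 * x.2 + (1 - 1) * centroid.2 = x.2); last by ring.
  apply: cvgD; apply: cvgM; try exact: cvg_cst; first exact: cvg_shrink.
  by apply: cvgB; [exact: cvg_cst|exact: cvg_shrink].
have d2 : 0 < d / 2 by rewrite divr_gt0.
near=> k.
have h1 : `|x.1 - (contract k x).1| < d / 2 by near: k; exact: (cvgrPdist_lt _ _).1 kc1 _ d2.
have h2 : `|x.2 - (contract k x).2| < d / 2 by near: k; exact: (cvgrPdist_lt _ _).1 kc2 _ d2.
have h3 : radius k < d / 2.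
  have := radius_gt0 k; have : `|0 - radius k| < d / 2 by near: k; exact: (cvgrPdist_lt _ _).1 cvg_radius _ d2.
  by rewrite sub0r normrN => /(le_lt_trans (ler_norm _)).
have [M DM] := between_bounded.
have tk := ker_test k Tx; have [sk _ _] := tk.
have ck := @mul_smooth_integrable _ _ _ mD DM _ _ (smooth_square_integrable mD DM (smooth_cst 1)) sk.
have ik : area.-integrable D (EFin \o ker k x) by move: ck; under [_ \o _]eq_fun do rewrite /= mul1r.
have k0 y : 0 <= ker k x y by exact: mollifier_ge0.
have mass : \int[area]_(y in D) ker k x y = 1.
  rewrite (Rintegral_vanish_outside (@subsetT _ D)); last by move=> y; exact: test_function_eq0 tk.
  by rewrite /Rintegral (kernel_mass _ _ _ (radius_gt0 k)).
have iu := mul_smooth_integrable mD DM su sk.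
have -> : u x - approx u k x = \int[area]_(y in D) ((u x - u y) * ker k x y).
  rewrite approxE; under [RHS]eq_Rintegral do rewrite mulrBl.
  rewrite RintegralB//; last exact: (@rintZ _ _ _ area D mD).
  by rewrite RintegralZl// mass mulr1.
have id : area.-integrable D (EFin \o (fun y => (u x - u y) * ker k x y)).
  have := @rintB _ _ _ area D mD _ _ (@rintZ _ _ _ area D mD (u x) _ ik) iu.
  by under [_ \o _]eq_fun do rewrite /= -mulrBl.
apply: (le_trans (@le_normr_Rintegral _ _ _ area D _ mD id)).
rewrite -[leRHS]mulr1 -mass -RintegralZl//.
apply: le_Rintegral => //; [exact: integrable_norm id|exact: (@rintZ _ _ _ area D mD)|].
move=> y Dy; rewrite normrM (ger0_norm (k0 y)).
have [->|ky] := eqVneq (ker k x y) 0; first by rewrite !mulr0.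
rewrite ler_wpM2r//; apply: ltW; apply: Hd; last exact: Dtri.
have [g1 g2] : `|(contract k x).1 - y.1| < radius k /\ `|(contract k x).2 - y.2| < radius k.
  apply: contrapT => h; move/eqP: ky; apply; rewrite kerE /=; apply: mollifier_eq0; first exact: radius_gt0.
  by rewrite /homothety/= !mulN1r ![- _ + _]addrC.
split; rewrite /ball/=.
  rewrite (_ : x.1 - y.1 = (x.1 - (contract k x).1) + ((contract k x).1 - y.1)); last by ring.
  apply: le_lt_trans (ler_normD _ _) _; lra.
rewrite (_ : x.2 - y.2 = (x.2 - (contract k x).2) + ((contract k x).2 - y.2)); last by ring.
apply: le_lt_trans (ler_normD _ _) _; lra.
Unshelve. all: by end_near.
Qed.

End Approximation.

(** * Traces and mean values on the edges *)

Section Traces.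
Context {R : realType}.
Variable T : triangle R.
Hypothesis nT : nondegenerate_triangle T.
Implicit Types (u v w f g : R * R -> R) (m n : 'I_2) (p q x y : R * R) (k l : nat) (i j : 'I_3).
Local Notation mu := (@lebesgue_measure R).

Let D := inner T.

Lemma inner_between i j h : i != j -> i != h -> j != h ->
  [/\ tdet (T i) (T j) (T h) != 0, open D, otri (T i) (T j) (T h) `<=` D
    & D `<=` tri (T i) (T j) (T h)].
Proof.
move=> ij ih jh; have d0 := tdet_neq0 ij ih jh nT.
have hE := hull_tri ij ih jh d0.
split => //; first exact: open_interior.
- move=> p op; rewrite /D /inner hE.
  have : nbhs p (otri (T i) (T j) (T h)) by apply: open_nbhs_nbhs; split => //; exact: open_otri.
  by apply: filterS; exact: otri_tri.
- by rewrite /D /inner hE; exact: interior_subset.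
Qed.

(** The bound on an edge comes from the triangle as seen from the opposite vertex. *)
Lemma third i j : i != j -> exists2 h, i != h & j != h.
Proof.
case: i => [[|[|[|i]]] Hi] //; case: j => [[|[|[|j]]] Hj] // _;
  by first [by exists 0 | by exists 1 | by exists 2%:R].
Qed.

Let mD : measurable D.
Proof. by apply: open_measurable2; exact: open_interior. Qed.

Lemma inner_bounded : exists M, D `<=` box M.
Proof.
have [d0 oD oo ot] := @inner_between 0 1 2%:R isT isT isT.
exact: between_bounded d0 ot.
Qed.

(** The squared distance of [f] to [v] in [H1], given the weak partial derivatives [dv] of [v]. *)
Definition h1_dist v (dv : 'I_2 -> R * R -> R) f : R :=
  \int[area]_(p in D) ((f p - v p) ^+ 2) +
  \sum_(m < 2) \int[area]_(p in D) ((partial m f p - dv m p) ^+ 2).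

Lemma h1_dist_ge0 v dv f : 0 <= h1_dist v dv f.
Proof.
by apply: addr_ge0; [|apply: sumr_ge0 => m _]; apply: Rintegral_ge0 => p _; exact: sqr_ge0.
Qed.

Lemma continuous_combination (S : topologicalType) (x y : R) (f g : S -> R) :
  continuous f -> continuous g -> continuous (fun t => x * f t + y * g t).
Proof.
by move=> cf cg t; apply: cvgD; apply: cvgM; [exact: cvg_cst|exact: cf|exact: cvg_cst|exact: cg].
Qed.

Lemma double_sum (x y : R) (F G : 'I_2 -> R) :
  2 * x + 2 * y + \sum_m (2 * F m + 2 * G m) = 2 * ((x + \sum_m F m) + (y + \sum_m G m)).
Proof. by rewrite big_split/= -!mulr_sumr; ring. Qed.

Section OneFunction.
Variables (v : R * R -> R) (dv : 'I_2 -> R * R -> R).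
Hypothesis sv : square_integrable area D v.
Hypothesis sdv : forall m, square_integrable area D (dv m).
Hypothesis wv : forall m, weak_partial D m v (dv m).

(** The weak derivatives of the difference are the differences of the derivatives, up to null
    sets. *)
Lemma H1norm2E f : smooth f -> H1norm2 D (f \- v) = h1_dist v dv f.
Proof.
move=> sf; rewrite /H1norm2 /h1_dist; congr (_ + _); apply: eq_bigr => m _.
have [M DM] := inner_bounded.
have [d0 oD oo ot] := @inner_between 0 1 2%:R isT isT isT.
have sm : square_integrable area D (fun p => partial m f p - dv m p).
  apply: (@square_integrableB _ _ _ area D mD); last exact: sdv.
  by apply: (smooth_square_integrable mD DM); exact: smooth_partial.
have wm : weak_partial D m (f \- v) (fun p => partial m f p - dv m p).
  apply: (weak_partialB mD DM); [| |exact: sv|exact: sdv| |exact: wv].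
  - exact: (smooth_square_integrable mD DM).
  - by apply: (smooth_square_integrable mD DM); exact: smooth_partial.
  - exact: (smooth_weak_partial mD DM).
have [s1 w1 e1] := wpartialP d0 oD oo ot sm wm.
apply: (@ae_eq_Rintegral _ _ _ area D mD).
- exact: measurable_funX s1.1.
- exact: measurable_funX sm.1.
- by apply: filterS e1 => p h Dp; rewrite h.
Qed.

Variables i j : 'I_3.
Hypothesis ij : i != j.

(** The trace inequality for the difference of [f] and [g]. *)
Lemma edge_sub_bound : exists2 C : R, 0 <= C & forall f g, smooth f -> smooth g ->
  \int[mu]_(t in `[0, 1]) ((f (on_segment (T i) (T j) t) - g (on_segment (T i) (T j) t)) ^+ 2) <=
  C * (h1_dist v dv f + h1_dist v dv g).
Proof.
have [M DM] := inner_bounded.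
have [h ih jh] := third ij.
have [d0 oD oo ot] : [/\ tdet (T h) (T i) (T j) != 0, open D, otri (T h) (T i) (T j) `<=` D
    & D `<=` tri (T h) (T i) (T j)] by apply: inner_between => //; rewrite eq_sym.
have [C C0 HC] := trace_inequality d0.
exists (2 * C); first by rewrite mulr_ge0.
move=> f g sf sg; have := HC _ (smoothB sf sg).
have sub (f' g' v' : R * R -> R) : smooth f' -> smooth g' -> square_integrable area D v' ->
    \int[area]_(p in tri (T h) (T i) (T j)) ((f' p - g' p) ^+ 2) <=
    2 * \int[area]_(p in D) ((f' p - v' p) ^+ 2) + 2 * \int[area]_(p in D) ((g' p - v' p) ^+ 2).
  move=> sf' sg' sv'; rewrite (Rintegral_between d0 oD oo ot); last first.
    by apply: continuous_sqr; exact: smooth_continuous (smoothB sf' sg').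
  have -> : \int[area]_(p in D) ((f' p - g' p) ^+ 2) =
      \int[area]_(p in D) ((f' p - v' p - (g' p - v' p)) ^+ 2).
    by apply: eq_Rintegral => p _; congr (_ ^+ 2); ring.
  by apply: (@square_integral_sub _ _ _ area D mD); apply: (@square_integrableB _ _ _ area D mD) => //; exact: (smooth_square_integrable mD DM).
move=> /le_trans; apply.
rewrite (mulrC 2) -mulrA ler_wpM2l// /h1_dist.
have pB m : partial m (fun p => f p - g p) = fun p => partial m f p - partial m g p.
  apply/funext => p.
  have [_ ] := partialD (smooth_has_partial m p sf) (smooth_has_partial m p (smooth_scale (-1) sg)).
  have [_ ->] := partial_scale (-1) (smooth_has_partial m p sg).
  by rewrite mulN1r => <-; congr (partial m _ p); apply/funext => z; rewrite mulN1r.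
have h0 := sub f g v sf sg sv.
have h1 m : \int[area]_(p in tri (T h) (T i) (T j)) (partial m (fun p => f p - g p) p ^+ 2) <=
    2 * \int[area]_(p in D) ((partial m f p - dv m p) ^+ 2) +
    2 * \int[area]_(p in D) ((partial m g p - dv m p) ^+ 2).
  by rewrite pB; apply: sub; [exact: smooth_partial|exact: smooth_partial|exact: sdv].
have h2 := ler_sum (index_enum 'I_2) (fun m (_ : true) => h1 m).
apply: le_trans (lerD h0 h2) _.
by rewrite double_sum.
Qed.

Variable phi : nat -> R * R -> R.
Hypothesis sphi : forall k, smooth (phi k).
Hypothesis cphi : h1_dist v dv (phi k) @[k --> \oo] --> (0 : R).

Let segf (f : R * R -> R) t := f (on_segment (T i) (T j) t).

Let m01 : measurable (`[0%R, 1%R] : set R).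
Proof. exact: measurable_itv. Qed.

Let fin01 : (mu (`[0%R, 1%R] : set R) < +oo)%E.
Proof. by rewrite lebesgue_measure_itv/= lte_fin ltr01 oppr0 adde0 ltry. Qed.

Lemma segf_square_integrable f : smooth f -> square_integrable mu `[0%R, 1%R] (segf f).
Proof.
move=> sf; split; last first.
  have cf2 : continuous (fun p => f p ^+ 2) by apply: continuous_sqr; exact: smooth_continuous.
  exact: continuous_segment_integrable cf2.
apply: (@rint_measurable _ _ _ mu).
by apply: continuous_segment_integrable; exact: smooth_continuous.
Qed.

(** The restrictions to the edge form a Cauchy sequence by the trace inequality. *)
Lemma trace_exists : exists2 g, square_integrable mu `[0%R, 1%R] g &
  \int[mu]_(t in `[0, 1]) ((segf (phi k) t - g t) ^+ 2) @[k --> \oo] --> (0 : R).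
Proof.
have [C C0 HC] := edge_sub_bound.
apply: (@square_integrable_complete _ _ _ mu _ m01 fin01 (fun k => segf (phi k))); first by move=> k; exact: segf_square_integrable.
move=> e e0; pose d := e / (2 * (C + 1)).
have d0 : 0 < d by rewrite divr_gt0// mulr_gt0// ltr_wpDl.
have [N _ HN] := (cvgrPdist_lt _ _).1 cphi _ d0.
exists N => k l Nk Nl; apply: le_trans (HC _ _ (sphi k) (sphi l)) _.
have b k' : (N <= k')%N -> h1_dist v dv (phi k') <= d.
  by move=> /HN; rewrite /= sub0r normrN ger0_norm ?h1_dist_ge0// => /ltW.
apply: (@le_trans _ _ (C * (d + d))); first by rewrite ler_wpM2l// lerD// b.
rewrite /d (_ : _ * _ = e * (C / (C + 1))); last by field; rewrite gt_eqF// ltr_wpDl.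
apply: ler_piMr; first exact: ltW.
by rewrite ler_pdivrMr ?ltr_wpDl// mul1r lerDl.
Qed.

(** The integral of the trace is the limit of the integrals over the edge of any
    smooth functions converging in [H1]: the trace is continuous in [H1]. *)
Lemma trace_integral_cvg :
  square_integrable mu `[0%R, 1%R] (trace T (T i) (T j) v) /\
  \int[mu]_(t in `[0, 1]) segf (phi k) t @[k --> \oo] -->
    \int[mu]_(t in `[0, 1]) trace T (T i) (T j) v t.
Proof.
have [g sg cg] := trace_exists.
have [] := @xgetPex _ (fun=> 0) (is_trace T (T i) (T j) v).
  exists g; split; first exact/(Lfun2P mu m01).
  exists phi; split => //.
  by under eq_fun do rewrite H1norm2E//.
rewrite -/(trace T (T i) (T j) v) => /(Lfun2P mu m01) st [psi [spsi cpsi ctr]].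
move: cpsi; under eq_fun do rewrite H1norm2E//; move=> cpsi.
split => //; apply: (@cvg_Rintegral_L2 _ _ _ mu _ m01 (fun k => segf (phi k))) => //.
  by move=> k; exact: segf_square_integrable.
have [C C0 HC] := edge_sub_bound.
apply: (@squeeze_cvgr _ _ _ _ (fun=> 0) (fun k => 2 * (C * (h1_dist v dv (phi k) + h1_dist v dv (psi k))) +
   2 * \int[mu]_(t in `[0, 1]) ((segf (psi k) t - trace T (T i) (T j) v t) ^+ 2))).
- apply: nearW => k; apply/andP; split; first by apply: Rintegral_ge0 => t _; exact: sqr_ge0.
  rewrite (_ : \int[mu]_(t in `[0, 1]) ((segf (phi k) t - trace T (T i) (T j) v t) ^+ 2) =
    \int[mu]_(t in `[0, 1]) (((segf (phi k) t - segf (psi k) t) +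
       (segf (psi k) t - trace T (T i) (T j) v t)) ^+ 2)); last first.
    by apply: eq_Rintegral => t _; rewrite addrA subrK.
  apply: le_trans (@square_integral_add _ _ _ mu _ m01 _ _ _ _) _.
  + by apply: (@square_integrableB _ _ _ mu _ m01); exact: segf_square_integrable.
  + by apply: (@square_integrableB _ _ _ mu _ m01) => //; exact: segf_square_integrable.
  + by rewrite lerD2r ler_wpM2l//; exact: HC.
- exact: cvg_cst.
- rewrite -[X in _ --> X](_ : 2 * (C * (0 + 0)) + 2 * 0 = 0 :> R); last by rewrite addr0 !mulr0 addr0.
  apply: cvgD; apply: cvgM; try exact: cvg_cst; last exact: ctr.
  by apply: cvgM; [exact: cvg_cst|exact: cvgD cphi cpsi].
Qed.

End OneFunction.

Section Orthogonality.
Variables (u : R * R -> R) (W : 'I_2 -> R * R -> R) (H : 'I_2 -> 'I_2 -> R * R -> R).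
Hypothesis su : square_integrable area D u.
Hypothesis sW : forall m, square_integrable area D (W m).
Hypothesis sH : forall m n, square_integrable area D (H m n).
Hypothesis wW : forall m, weak_partial D m u (W m).
Hypothesis wH : forall m n, weak_partial D n (W m) (H m n).
Hypothesis cu : {within hull T, continuous u}.

Let a := T 0.
Let b := T 1.
Let c := T 2%:R.
Let d0 : tdet a b c != 0.
Proof. by have [] := @inner_between 0 1 2%:R isT isT isT. Qed.
Let oD : open D.
Proof. exact: open_interior. Qed.
Let oo : otri a b c `<=` D.
Proof. by have [] := @inner_between 0 1 2%:R isT isT isT. Qed.
Let ot : D `<=` tri a b c.
Proof. by have [] := @inner_between 0 1 2%:R isT isT isT. Qed.
Let hE : hull T = tri a b c.
Proof. exact: (@hull_tri _ T 0 1 2%:R isT isT isT d0). Qed.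

Let w m := wpartial D m u.

(** The derivative chosen by [wpartial] has the same weak derivatives as [W m], from which it
    differs on a null set. *)
Lemma gradient_facts m : [/\ square_integrable area D (w m), weak_partial D m u (w m)
  & forall n, weak_partial D n (w m) (H m n)].
Proof.
have [M DM] := inner_bounded.
have [s1 w1 e1] := wpartialP d0 oD oo ot (sW m) (wW m).
split => // n; apply: (weak_partial_ae mD DM (sW m) s1) => //.
by apply: filterS e1 => p h Dp; rewrite h.
Qed.

Let phi m k := approx a b c D (w m) k.

Lemma smooth_phi m k : smooth (phi m k).
Proof. by have [s _ _] := gradient_facts m; exact: smooth_approx. Qed.

Lemma shrink_approx_cvg g : square_integrable area D g ->
  \int[area]_(p in D) ((shrink k * approx a b c D g k p - g p) ^+ 2) @[k --> \oo] --> (0 : R).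
Proof.
move=> sg; have [M DM] := inner_bounded.
have sa k : square_integrable area D (approx a b c D g k).
  by apply: (smooth_square_integrable mD DM); exact: smooth_approx.
apply: (@squeeze_cvgr _ _ _ _ (fun=> 0) (fun k =>
   2 * \int[area]_(p in D) ((approx a b c D g k p - g p) ^+ 2) +
   2 * ((shrink k - 1) ^+ 2 * \int[area]_(p in D) (g p ^+ 2)))).
- apply: nearW => k; apply/andP; split; first by apply: Rintegral_ge0 => t _; exact: sqr_ge0.
  have s1 : square_integrable area D (fun p => approx a b c D g k p - g p).
    exact: (@square_integrableB _ _ _ area D mD).
  rewrite (_ : \int[area]_(p in D) ((shrink k * approx a b c D g k p - g p) ^+ 2) =
     \int[area]_(p in D) ((shrink k * (approx a b c D g k p - g p) + (shrink k - 1) * g p) ^+ 2)); last first.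
    by apply: eq_Rintegral => p _; move: (shrink k) (approx _ _ _ _ _ _ _) => s x; congr (_ ^+ 2); ring.
  apply: le_trans (@square_integral_add _ _ _ area _ mD _ _ _ _) _.
  + exact: (@square_integrableZ _ _ _ area D mD).
  + exact: (@square_integrableZ _ _ _ area D mD).
  have e (t : R) f : square_integrable area D f ->
      \int[area]_(p in D) ((t * f p) ^+ 2) = t ^+ 2 * \int[area]_(p in D) (f p ^+ 2).
    by move=> sf; rewrite -RintegralZl//; [apply: eq_Rintegral => p _; rewrite exprMn|exact: sf.2].
  rewrite !e// lerD2r ler_wpM2l//; apply: ler_piMl.
    by apply: Rintegral_ge0 => p _; exact: sqr_ge0.
  have /andP[h1 h2] := @shrink_itv R k; rewrite expr_le1//.
  by apply: le_trans h1; rewrite divr_ge0.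
- exact: cvg_cst.
- set I := \int[area]_(p in D) (g p ^+ 2).
  rewrite -[X in _ --> X](_ : 2 * 0 + 2 * ((1 - 1) * (1 - 1) * I) = 0 :> R); last by rewrite subrr !mul0r !mulr0 addr0.
  apply: cvgD; apply: cvgM; try exact: cvg_cst; first exact: (approx_cvg d0 oD ot).
  apply: cvgM; last exact: cvg_cst.
  have h : shrink k - 1 @[k --> \oo] --> (1 - 1 : R) by apply: cvgB; [exact: cvg_shrink|exact: cvg_cst].
  rewrite (_ : (fun k => _ ^+ 2) = (fun k => (shrink k - 1) * (shrink k - 1))); last by apply/funext => k; rewrite expr2.
  exact (cvgM h h).
Qed.

Lemma phi_cvg m : h1_dist (w m) (H m) (phi m k) @[k --> \oo] --> (0 : R).
Proof.
have [s1 _ w2] := gradient_facts m.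
rewrite /h1_dist -[X in _ --> X](_ : 0 + \sum_(n < 2) 0 = 0 :> R); last by rewrite big1 ?addr0.
apply: cvgD; first exact: (approx_cvg d0 oD ot).
have key n : \int[area]_(p in D) ((partial n (phi m k) p - H m n p) ^+ 2) @[k --> \oo] --> (0 : R).
  rewrite (_ : (fun k => _) = (fun k => \int[area]_(p in D) ((shrink k * approx a b c D (H m n) k p - H m n p) ^+ 2))).
    exact: shrink_approx_cvg.
  apply/funext => k; apply: eq_Rintegral => p /set_mem Dp.
  by rewrite (partial_approx d0 oD oo ot _ s1 (w2 n)) //; exact: ot.
rewrite (_ : (fun k => \sum_(n < 2) _) = (fun k => \int[area]_(p in D) ((partial 0 (phi m k) p - H m 0 p) ^+ 2) +
   \int[area]_(p in D) ((partial 1 (phi m k) p - H m 1 p) ^+ 2))).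
  by rewrite big_ord_recl big_ord1; exact: cvgD (key 0) (key 1).
by apply/funext => k; rewrite big_ord_recl big_ord1 [lift _ _](_ : _ = 1)//; exact/val_inj.
Qed.

Let X i j m := \int[mu]_(t in `[0, 1]) trace T (T i) (T j) (w m) t.

Lemma edge_mean_cvg i j m : i != j ->
  square_integrable mu `[0%R, 1%R] (trace T (T i) (T j) (w m)) /\
  \int[mu]_(t in `[0, 1]) phi m k (on_segment (T i) (T j) t) @[k --> \oo] --> X i j m.
Proof.
move=> ij; have [s1 _ w2] := gradient_facts m.
exact: (trace_integral_cvg s1 (sH m) w2 ij (smooth_phi m) (phi_cvg m)).
Qed.

Lemma hull_vertex i : hull T (T i).
Proof.
exists (fun j => (j == i)%:R); split; first by move=> j; rewrite ler0n.
- by rewrite (bigD1 i)//= eqxx big1 ?addr0// => j /negbTE ->.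
- by rewrite (bigD1 i)//= eqxx mul1r big1 ?addr0// => j /negbTE ->; rewrite mul0r.
- by rewrite (bigD1 i)//= eqxx mul1r big1 ?addr0// => j /negbTE ->; rewrite mul0r.
Qed.

Lemma hull_on_segment i j t : i != j -> 0 <= t <= 1 -> hull T (on_segment (T i) (T j) t).
Proof.
move=> ij /andP[t0 t1]; have [h ih jh] := third ij.
have dh := tdet_neq0 ij ih jh nT.
rewrite (hull_tri ij ih jh dh).
have e1 : baryb (T i) (T j) (T h) (on_segment (T i) (T j) t) = t.
  by move: dh; rewrite /baryb /on_segment /tdet/= => ?; field.
have e2 : baryc (T i) (T j) (T h) (on_segment (T i) (T j) t) = 0.
  by move: dh; rewrite /baryc /on_segment /tdet/= => ?; field.
by split; rewrite ?e1 ?e2 ?addr0.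
Qed.

(** The fundamental theorem of calculus along the edge, for the mollifications of [u]: on the
    closed triangle their gradients are the mollified gradients times the contraction factor. *)
Lemma tangential_mean i j : i != j ->
  ((T j).1 - (T i).1) * X i j 0 + ((T j).2 - (T i).2) * X i j 1 = u (T j) - u (T i).
Proof.
move=> ij; pose p := T i; pose q := T j.
have [_ c0] := edge_mean_cvg 0 ij; have [_ c1] := edge_mean_cvg 1 ij.
pose uk k := approx a b c D u k.
have suk k : smooth (uk k) by exact: smooth_approx.
have E k : shrink k * ((q.1 - p.1) * \int[mu]_(t in `[0, 1]) phi 0 k (on_segment p q t) +
    (q.2 - p.2) * \int[mu]_(t in `[0, 1]) phi 1 k (on_segment p q t)) = uk k q - uk k p.
  have := line_integral p (q.1 - p.1) (q.2 - p.2) (suk k) (@ler01 R).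
  rewrite !mul1r !subrKC -!surjective_pairing -EFinB => /(congr1 fine) /= <-.
  have i0 := continuous_segment_integrable p q (smooth_continuous (smooth_phi 0 k)).
  have i1 := continuous_segment_integrable p q (smooth_continuous (smooth_phi 1 k)).
  have m01 : measurable (`[0%R, 1%R] : set R) by exact: measurable_itv.
  have L1 := @Rintegral_linear _ _ _ mu _ m01 (shrink k * (q.1 - p.1)) (shrink k * (q.2 - p.2)) _ _ i0 i1.
  apply: (etrans (etrans _ (esym L1))).
    have aux (s x y x' y' : R) : s * (x * x' + y * y') = s * x * x' + s * y * y' by ring.
    exact: aux.
  apply: eq_Rintegral => t /set_mem/=; rewrite in_itv/= => t01.
  have Tt : tri a b c (on_segment p q t) by rewrite -hE; exact: hull_on_segment.
  have [_ w0 _] := gradient_facts 0; have [_ w1 _] := gradient_facts 1.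
  rewrite -[(_, _)]/(on_segment p q t).
  have aux (s x y x' y' : R) : s * x * x' + s * y * y' = x * (s * x') + y * (s * y') by ring.
  rewrite (partial_approx d0 oD oo ot _ su w0 Tt) (partial_approx d0 oD oo ot _ su w1 Tt).
  exact: aux.
have L : shrink k * ((q.1 - p.1) * \int[mu]_(t in `[0, 1]) phi 0 k (on_segment p q t) +
    (q.2 - p.2) * \int[mu]_(t in `[0, 1]) phi 1 k (on_segment p q t)) @[k --> \oo] -->
    1 * ((q.1 - p.1) * X i j 0 + (q.2 - p.2) * X i j 1).
  apply: cvgM; first exact: cvg_shrink.
  by apply: cvgD; apply: cvgM; try exact: cvg_cst; [exact: c0|exact: c1].
have cuv x : hull T x -> uk k x @[k --> \oo] --> u x.
  by move=> Tx; apply: (approx_cvg_point d0 oD oo ot) => //; rewrite -hE.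
have L' : uk k q - uk k p @[k --> \oo] --> u q - u p.
  by apply: cvgB; apply: cuv; exact: hull_vertex.
move: L; under eq_fun do rewrite E; rewrite mul1r => L.
exact: (cvg_unique (@Rhausdorff R) L L').
Qed.

Lemma flux_mean i j : i != j ->
  edge_flux T (T i) (T j) u = ((T j).2 - (T i).2) * X i j 0 + ((T i).1 - (T j).1) * X i j 1.
Proof.
move=> ij; have [s0 _] := edge_mean_cvg 0 ij; have [s1 _] := edge_mean_cvg 1 ij.
have m01 : measurable (`[0%R, 1%R] : set R) by exact: measurable_itv.
have f01 : (mu (`[0%R, 1%R] : set R) < +oo)%E.
  by rewrite lebesgue_measure_itv/= lte_fin ltr01 oppr0 adde0 ltry.
have i0 := @square_integrable_rint _ _ _ mu _ m01 _ f01 s0.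
have i1 := @square_integrable_rint _ _ _ mu _ m01 _ f01 s1.
have [h ih jh] := third ij; have dh := tdet_neq0 ij ih jh nT.
have l0 : edge_length (T i) (T j) != 0.
  rewrite /edge_length sqrtr_eq0 -ltNge lt_neqAle eq_sym addr_ge0 ?sqr_ge0// andbT.
  rewrite paddr_eq0 ?sqr_ge0// !sqrf_eq0; apply: contra dh => /andP[/eqP e1 /eqP e2].
  by rewrite /tdet e1 e2 !mul0r subrr.
rewrite /edge_flux /X -(@Rintegral_linear _ _ _ mu _ m01 _ _ _ _ i0 i1).
apply: eq_Rintegral => t _; rewrite big_ord_recl big_ord1 [lift _ _](_ : _ = 1); last exact/val_inj.
rewrite /unit_normal/= -/D -/(w 0) -/(w 1).
have aux (x y s t' l : R) : l != 0 -> (s / l * x + t' / l * y) * l = s * x + t' * y by move=> ?; field.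
exact: aux.
Qed.

Lemma wpartial2_ae m n : [/\ square_integrable area D (wpartial D n (w m)),
  weak_partial D n (w m) (wpartial D n (w m))
  & {ae area, forall p, D p -> wpartial D n (w m) p = H m n p}].
Proof.
have [_ _ w2] := gradient_facts m.
exact: (wpartialP d0 oD oo ot (sH m n) (w2 n)).
Qed.

Lemma hess_prodE : hess_prod D u u = \sum_m \sum_n \int[area]_(p in D) (H m n p ^+ 2).
Proof.
have iw m n : area.-integrable D (EFin \o (fun p => wpartial D n (w m) p * wpartial D n (w m) p)).
  have [s2 _ _] := wpartial2_ae m n.
  exact: (@square_integrable_mul _ _ _ area D mD).
rewrite /hess_prod (@Rintegral_sum _ _ _ area D mD); last first.
  by move=> m; apply: (@rint_big _ _ _ area D mD) => n; exact: iw.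
apply: eq_bigr => m _; rewrite (@Rintegral_sum _ _ _ area D mD); last by move=> n; exact: iw.
apply: eq_bigr => n _; have [s2 _ e2] := wpartial2_ae m n.
apply: (@ae_eq_Rintegral _ _ _ area D mD).
- exact: rint_measurable (iw m n).
- exact: measurable_funX (sH m n).1.
- by apply: filterS e2 => p h Dp; rewrite -expr2 -/(w m) h.
Qed.

Lemma H2I : H2 D u.
Proof.
have L2P f : square_integrable area D f -> L2 D f by move=> sf; exact/(Lfun2P area mD).
split.
  by split; [exact: L2P|move=> m; exists (W m); split; [exact: L2P|exact: wW]].
move=> m; have [s1 _ w2] := gradient_facts m; split; first exact: L2P.
by move=> n; exists (H m n); split; [exact: L2P|exact: w2].
Qed.

Hypothesis u0 : forall i, u (T i) = 0.
Hypothesis flux0 : forall i j, i != j -> edge_flux T (T i) (T j) u = 0.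

(** The flux determines the mean value of the normal derivative, and the values at the
    endpoints that of the tangential derivative. *)
Lemma edge_mean_eq0 i j m : i != j -> X i j m = 0.
Proof.
move=> ij; have := flux_mean ij; rewrite flux0// => /esym e1.
have := tangential_mean ij; rewrite !u0 subrr => e2.
have [h ih jh] := third ij; have dh := tdet_neq0 ij ih jh nT.
have {dh} l0 : ((T j).1 - (T i).1) ^+ 2 + ((T j).2 - (T i).2) ^+ 2 != 0.
  rewrite paddr_eq0 ?sqr_ge0// !sqrf_eq0; apply: contra dh => /andP[/eqP e3 /eqP e4].
  by rewrite /tdet e3 e4 !mul0r subrr.
have [h0 h1] : X i j 0 = 0 /\ X i j 1 = 0.
  move: (X i j 0) (X i j 1) e1 e2 => x0 x1 e1 e2; split; apply: (mulfI l0); rewrite mulr0.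
    transitivity (((T j).1 - (T i).1) * (((T j).1 - (T i).1) * x0 + ((T j).2 - (T i).2) * x1) +
      ((T j).2 - (T i).2) * (((T j).2 - (T i).2) * x0 + ((T i).1 - (T j).1) * x1)); first by ring.
    by rewrite e1 e2 !mulr0 addr0.
  transitivity (((T j).2 - (T i).2) * (((T j).1 - (T i).1) * x0 + ((T j).2 - (T i).2) * x1) -
    ((T j).1 - (T i).1) * (((T j).2 - (T i).2) * x0 + ((T i).1 - (T j).1) * x1)); first by ring.
  by rewrite e1 e2 !mulr0 subr0.
have [->//|m1] := eqVneq m 0.
by rewrite (_ : m = 1) //; apply/val_inj; move: m m1 => [[|[|?]] ?].
Qed.

(** The divergence theorem turns the mean values of the second derivatives over the triangle
    into mean values of first derivatives over the edges. *)
Lemma hessian_mean_eq0 m n : \int[area]_(p in D) H m n p = 0.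
Proof.
have [s1 _ w2] := gradient_facts m.
have [M DM] := inner_bounded.
have gen i j h : i != j -> i != h -> j != h ->
  ((T j).1 - (T i).1) * \int[area]_(p in D) H m 0 p +
  ((T j).2 - (T i).2) * \int[area]_(p in D) H m 1 p = 0.
  move=> ij ih jh; have [d1 _ oo1 ot1] := inner_between ij ih jh.
  have hj : h != j by rewrite eq_sym.
  have cI n' : \int[area]_(p in D) partial n' (phi m k) p @[k --> \oo] --> \int[area]_(p in D) H m n' p.
    apply: (@cvg_Rintegral_L2 _ _ _ area D mD (fun k => partial n' (phi m k))).
    - exact: between_lty d0 oD ot.
    - by move=> k; apply: (smooth_square_integrable mD DM); exact: smooth_partial (smooth_phi m k).
    - exact: sH.
    rewrite (_ : (fun k => _) = (fun k => \int[area]_(p in D) ((shrink k * approx a b c D (H m n') k p - H m n' p) ^+ 2))).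
      exact: shrink_approx_cvg.
    apply/funext => k; apply: eq_Rintegral => p /set_mem Dp.
    by rewrite (partial_approx d0 oD oo ot _ s1 (w2 n')) //; exact: ot.
  have L : ((T j).1 - (T i).1) * \int[area]_(p in D) partial 0 (phi m k) p +
      ((T j).2 - (T i).2) * \int[area]_(p in D) partial 1 (phi m k) p @[k --> \oo] -->
      ((T j).1 - (T i).1) * \int[area]_(p in D) H m 0 p +
      ((T j).2 - (T i).2) * \int[area]_(p in D) H m 1 p.
    by apply: cvgD; apply: cvgM; try exact: cvg_cst; exact: cI.
  have L' : `|tdet (T i) (T j) (T h)| * (\int[mu]_(t in `[0, 1]) phi m k (on_segment (T j) (T h) t) -
      \int[mu]_(t in `[0, 1]) phi m k (on_segment (T i) (T h) t)) @[k --> \oo] -->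
      `|tdet (T i) (T j) (T h)| * (0 - 0).
    apply: cvgM; first exact: cvg_cst.
    apply: cvgB.
      by have [_ h1] := edge_mean_cvg m jh; rewrite (edge_mean_eq0 m jh) in h1; exact: h1.
    by have [_ h1] := edge_mean_cvg m ih; rewrite (edge_mean_eq0 m ih) in h1; exact: h1.
  rewrite subrr mulr0 in L'.
  apply: (cvg_unique (@Rhausdorff R) L); rewrite (_ : (fun k => _) = (fun k =>
     `|tdet (T i) (T j) (T h)| * (\int[mu]_(t in `[0, 1]) phi m k (on_segment (T j) (T h) t) -
      \int[mu]_(t in `[0, 1]) phi m k (on_segment (T i) (T h) t)))) //.
  apply/funext => k; rewrite -green_tri//; last exact: smooth_phi.
  have ck n' := smooth_continuous (smooth_partial n' (smooth_phi m k)).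
  have ik n' : area.-integrable D (EFin \o partial n' (phi m k)).
    apply: (between_integrable d0 oD ot).
    by apply: (smooth_square_integrable mD DM); exact: smooth_partial (smooth_phi m k).
  have ch := @continuous_combination _ ((T j).1 - (T i).1) ((T j).2 - (T i).2) _ _ (ck 0) (ck 1).
  rewrite (Rintegral_between d1 oD oo1 ot1 ch).
  by rewrite (@Rintegral_linear _ _ _ area D mD).
have e1 := gen 0 1 2%:R isT isT isT; have e2 := gen 0 2%:R 1 isT isT isT.
have [h0 h1] : \int[area]_(p in D) H m 0 p = 0 /\ \int[area]_(p in D) H m 1 p = 0.
  move: e1 e2; rewrite -/a -/b -/c.
  move: (\int[area]_(p in D) H m 0 p) (\int[area]_(p in D) H m 1 p) => x y e1 e2.
  split; apply: (mulfI d0); rewrite mulr0 /tdet.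
    transitivity ((c.2 - a.2) * ((b.1 - a.1) * x + (b.2 - a.2) * y) -
      (b.2 - a.2) * ((c.1 - a.1) * x + (c.2 - a.2) * y)); first by ring.
    by rewrite e1 e2 !mulr0 subr0.
  transitivity ((b.1 - a.1) * ((c.1 - a.1) * x + (c.2 - a.2) * y) -
    (c.1 - a.1) * ((b.1 - a.1) * x + (b.2 - a.2) * y)); first by ring.
  by rewrite e1 e2 !mulr0 subr0.
have [->//|n1] := eqVneq n 0.
by rewrite (_ : n = 1) //; apply/val_inj; move: n n1 => [[|[|?]] ?].
Qed.

End Orthogonality.

End Traces.

(** * Sup norms and quadratic functions on an element *)

Section SupNorm.
Context {R : realType}.
Implicit Types (D : set (R * R)) (u f : R * R -> R).

Lemma area_setT_gt0 : (0 < area [set: R * R])%E.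
Proof.
have h : (area (box 1) <= area [set: R * R])%E.
  by apply: area_le; [exact: measurable_box|exact: measurableT|].
apply: lt_le_trans h; rewrite area_box ?ler01// lte_fin exprn_gt0//.
Qed.

Lemma ess_sup_restrict_ge0 D u : (0 <= ess_sup area (abse \o (EFin \o (u \_ D))))%E.
Proof.
by apply: (@ess_sup_gee _ _ _ area _ _ area_setT_gt0); apply: nearW => x; exact: abse_ge0.
Qed.

Lemma LinfE D u : Linf D u = fine (ess_sup area (abse \o (EFin \o (u \_ D)))).
Proof. by rewrite /Linf unlock area_setT_gt0. Qed.

Lemma Linf_ge0 D u : 0 <= Linf D u.
Proof. by rewrite LinfE fine_ge0// ess_sup_restrict_ge0. Qed.

Lemma Linf_le D u (M : R) : 0 <= M -> {ae area, forall x, `|(u \_ D) x| <= M} -> Linf D u <= M.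
Proof.
move=> M0 uM; rewrite LinfE -lee_fin fineK.
  by apply/(@ess_supP _ _ _ area); apply: filterS uM => x; rewrite /= lee_fin.
rewrite ge0_fin_numE; last exact: ess_sup_restrict_ge0.
apply: (@le_lt_trans _ _ M%:E); last exact: ltry.
by apply/(@ess_supP _ _ _ area); apply: filterS uM => x; rewrite /= lee_fin.
Qed.

Lemma Linf_ae D u (M : R) : (forall x, D x -> `|u x| <= M) ->
  {ae area, forall x, `|(u \_ D) x| <= Linf D u}.
Proof.
move=> uM; have := @ess_sup_ge _ _ _ area (abse \o (EFin \o (u \_ D))).
apply: filterS => x /=; rewrite LinfE -lee_fin fineK// ge0_fin_numE; last exact: ess_sup_restrict_ge0.
apply: (@le_lt_trans _ _ `|M|%:E); last exact: ltry.
apply/(@ess_supP _ _ _ area); apply: nearW => y /=; rewrite lee_fin patchE.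
by case: ifPn => [/set_mem/uM h|_]; rewrite ?normr0//; exact: le_trans h (ler_norm _).
Qed.

(** For bounded functions the essential supremum is finite and bounds the function almost
    everywhere. *)
Lemma Linf_triangle D u f g (M : R) : (forall x, D x -> `|f x| <= M) ->
  (forall x, D x -> `|g x| <= M) -> {ae area, forall x, D x -> u x = f x + g x} ->
  Linf D u <= Linf D f + Linf D g.
Proof.
move=> fM gM ufg; apply: Linf_le; first by rewrite addr_ge0// Linf_ge0.
have [hf hg] := (Linf_ae fM, Linf_ae gM).
near=> x.
have h1 : `|(f \_ D) x| <= Linf D f by near: x.
have h2 : `|(g \_ D) x| <= Linf D g by near: x.
have h3 : D x -> u x = f x + g x by near: x.
move: h1 h2; rewrite !patchE; case: ifPn => [/set_mem Dx|_ _ _].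
  by rewrite h3// => h1 h2; apply: le_trans (ler_normD _ _) _; exact: lerD.
by rewrite normr0 addr_ge0// Linf_ge0.
Unshelve. all: by end_near.
Qed.

End SupNorm.

Section Quadratic.
Context {R : realType}.
Implicit Types p : R * R.

(** Written with affine functions only, so that smoothness and derivatives follow from the rules
    for sums and products. *)
Definition quadratic (c0 c1 c2 c3 c4 c5 : R) p : R :=
  (c1 * p.1 + c2 * p.2 + c0) +
  ((1 * p.1 + 0 * p.2 + 0) * (c3 * p.1 + c4 * p.2 + 0) +
   (0 * p.1 + 1 * p.2 + 0) * (0 * p.1 + c5 * p.2 + 0)).

Variables c0 c1 c2 c3 c4 c5 : R.
Local Notation q := (quadratic c0 c1 c2 c3 c4 c5).

Lemma smooth_quadratic : smooth q.
Proof.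
apply: smoothD; first exact: smooth_affine.
by apply: smoothD; apply: smoothM; exact: smooth_affine.
Qed.

Lemma partial_quadratic m : partial m q =
  fun p => (if m == 0 then 2 * c3 else c4) * p.1 + (if m == 0 then c4 else 2 * c5) * p.2 +
           (if m == 0 then c1 else c2).
Proof.
have sa (a b c : R) p := smooth_has_partial m p (smooth_affine a b c).
apply/funext => p.
have s1 := smoothM (smooth_affine 1 0 (0 : R)) (smooth_affine c3 c4 0).
have s2 := smoothM (smooth_affine 0 1 (0 : R)) (smooth_affine 0 c5 0).
rewrite (partialD (sa _ _ _ p) (smooth_has_partial m p (smoothD s1 s2))).2.
rewrite (partialD (smooth_has_partial m p s1) (smooth_has_partial m p s2)).2.
rewrite !(partialM (sa _ _ _ p) (sa _ _ _ p)).2 !partial_affine.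
by case: (m == 0) => /=; ring.
Qed.

Definition quadratic_hessian (m n : 'I_2) : R :=
  if n == 0 then (if m == 0 then 2 * c3 else c4) else (if m == 0 then c4 else 2 * c5).

Lemma partial2_quadratic m n p : partial n (partial m q) p = quadratic_hessian m n.
Proof. by rewrite partial_quadratic partial_affine. Qed.

End Quadratic.

Section Element.
Context {R : realType}.
Variable T : triangle R.
Hypothesis nT : nondegenerate_triangle T.
Variables (u f : R * R -> R) (W : 'I_2 -> R * R -> R) (H : 'I_2 -> 'I_2 -> R * R -> R).
Variables c0 c1 c2 c3 c4 c5 : R.
Local Notation D := (inner T).
Local Notation q := (quadratic c0 c1 c2 c3 c4 c5).
Local Notation hq := (quadratic_hessian c3 c4 c5).
Hypothesis su : square_integrable area D u.
Hypothesis sW : forall m, square_integrable area D (W m).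
Hypothesis sH : forall m n, square_integrable area D (H m n).
Hypothesis wW : forall m, weak_partial D m u (W m).
Hypothesis wH : forall m n, weak_partial D n (W m) (H m n).
Hypothesis fq : forall p, hull T p -> f p = q p.

Let mD : measurable D.
Proof. by apply: open_measurable2; exact: open_interior. Qed.

Let Dhull : D `<=` hull T := @interior_subset _ _.

Lemma eq_square_integrable (g h : R * R -> R) : (forall p, D p -> g p = h p) ->
  square_integrable area D g -> square_integrable area D h.
Proof.
move=> gh [mg ig]; split.
  by apply: (eq_measurable_fun g) => // p /set_mem; exact: gh.
apply: (@eq_integrable _ _ _ area D mD _ _ _ ig) => p /set_mem Dp /=.
by rewrite gh.
Qed.

Lemma eq_weak_partial m (g h v : R * R -> R) : (forall p, D p -> g p = h p) ->
  weak_partial D m g v -> weak_partial D m h v.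
Proof.
move=> gh w phi tp; rewrite -(w _ tp); apply: eq_Rintegral => p /set_mem Dp.
by rewrite gh.
Qed.

Let sq : square_integrable area D q.
Proof.
by have [M DM] := inner_bounded nT; exact: (smooth_square_integrable mD DM (smooth_quadratic _ _ _ _ _ _)).
Qed.

Let sdq m : square_integrable area D (partial m q).
Proof.
have [M DM] := inner_bounded nT.
exact: (smooth_square_integrable mD DM (smooth_partial m (smooth_quadratic _ _ _ _ _ _))).
Qed.

Let shq m n : square_integrable area D (fun=> hq m n).
Proof.
by have [M DM] := inner_bounded nT; exact: (smooth_square_integrable mD DM (smooth_cst _)).
Qed.

Let wdq m : weak_partial D m q (partial m q).
Proof.
have [M DM] := inner_bounded nT.
exact: (smooth_weak_partial mD DM _ (smooth_quadratic _ _ _ _ _ _)).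
Qed.

Let whq m n : weak_partial D n (partial m q) (fun=> hq m n).
Proof.
have [M DM] := inner_bounded nT.
have := smooth_weak_partial mD DM n (smooth_partial m (smooth_quadratic c0 c1 c2 c3 c4 c5)).
by congr weak_partial; apply/funext => p; exact: partial2_quadratic.
Qed.

Let W' m p := W m p - partial m q p.
Let H' m n p := H m n p - hq m n.

Let eE p : D p -> u p - q p = (u \- f) p.
Proof. by move=> /Dhull Tp /=; rewrite fq. Qed.

Let se : square_integrable area D (u \- f).
Proof. exact: (eq_square_integrable eE (@square_integrableB _ _ _ area D mD _ _ su sq)). Qed.

Let sW' m : square_integrable area D (W' m).
Proof. exact: (@square_integrableB _ _ _ area D mD). Qed.

Let sH' m n : square_integrable area D (H' m n).
Proof. exact: (@square_integrableB _ _ _ area D mD). Qed.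

Let wW' m : weak_partial D m (u \- f) (W' m).
Proof.
have [M DM] := inner_bounded nT; apply: (eq_weak_partial eE).
exact: (weak_partialB mD DM su (sW m) sq (sdq m) (wW m) (wdq m)).
Qed.

Let wH' m n : weak_partial D n (W' m) (H' m n).
Proof.
have [M DM] := inner_bounded nT.
exact: (weak_partialB mD DM (sW m) (sH m n) (sdq m) (shq m n) (wH m n) (whq m n)).
Qed.

Let Dlty : (area D < +oo)%E.
Proof. by have [M DM] := inner_bounded nT; exact: area_lty_bounded DM. Qed.

(** A Pythagorean identity: the cross terms are the second derivatives of [f], which are
    constant, times the mean values of those of [u - f]. *)
Lemma hess_pythagoras : (forall m n, hq m n * \int[area]_(p in D) (H m n p - hq m n) = 0) ->
  \sum_m \sum_n \int[area]_(p in D) (H m n p ^+ 2) =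
  hess_prod D f f + hess_prod D (u \- f) (u \- f).
Proof.
move=> cross.
have wf m : weak_partial D m f (partial m q).
  by apply: eq_weak_partial (wdq m) => p /Dhull Tp; rewrite fq.
rewrite (hess_prodE nT sdq shq wf whq) (hess_prodE nT sW' sH' wW' wH').
rewrite -big_split; apply: eq_bigr => m _; rewrite -big_split; apply: eq_bigr => n _ /=.
have i1 := @square_integrable_rint _ _ _ area D mD _ Dlty (sH' m n).
have i2 := (sH' m n).2.
have i3 := (shq m n).2.
transitivity (\int[area]_(p in D) (1 * (H' m n p ^+ 2) + (2 * hq m n) * H' m n p) +
   \int[area]_(p in D) (hq m n ^+ 2)).
  rewrite -RintegralD//.
    by apply: eq_Rintegral => p _; rewrite /H'; move: (hq m n) (H m n p) => x y; ring.
  by apply: (@rintD _ _ _ area D mD); apply: (@rintZ _ _ _ area D mD).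
rewrite (@Rintegral_linear _ _ _ area D mD _ _ _ _ i2 i1) mul1r -mulrA cross mulr0 addr0.
exact: addrC.
Qed.

Hypothesis cu : {within hull T, continuous u}.
Hypothesis e0 : forall i, u (T i) - f (T i) = 0.
Hypothesis flux0 : forall i j, i != j -> edge_flux T (T i) (T j) (u \- f) = 0.

(** The error vanishes at the vertices and has no flux through the edges. *)
Lemma interpolation_orthogonality m n : \int[area]_(p in D) (H m n p - hq m n) = 0.
Proof.
have ce : {within hull T, continuous (u \- f)}.
  apply: (@subspace_eq_continuous _ (hull T) _ (fun p => u p - q p) (u \- f)).
    by move=> p /set_mem Tp; rewrite /from_subspace /= fq.
  move=> x; apply: cvgB; first exact: cu.
  have cq : {within hull T, continuous q}.
    by apply: continuous_subspaceT; exact: smooth_continuous (smooth_quadratic _ _ _ _ _ _).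
  exact: cq.
exact: (hessian_mean_eq0 nT se sW' sH' wW' wH' ce e0 flux0).
Qed.

End Element.

(** * Summation over the triangulation *)

Section Assembly.
Context {R : realType}.
Implicit Types (u v f : R * R -> R) (p : R * R).

Lemma sum_Rintegral_disjoint_le (I : finType) (A : I -> set (R * R)) (B : set (R * R)) f :
  measurable B -> (forall i, measurable (A i)) -> (forall i, A i `<=` B) ->
  (forall i j, i != j -> A i `&` A j = set0) -> (forall p, 0 <= f p) ->
  area.-integrable B (EFin \o f) ->
  \sum_i \int[area]_(p in A i) f p <= \int[area]_(p in B) f p.
Proof.
move=> mB mA AB dA f0 fi.
have E i : \int[area]_(p in A i) f p = \int[area]_(p in B) (f \_ (A i)) p.
  rewrite Rintegral_mkcond [RHS]Rintegral_mkcond; apply: eq_Rintegral => p _.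
  rewrite [in RHS]patchE; case: ifPn => // /negP Bp; rewrite patchE memNset// => /AB Bp'.
  by apply: Bp; exact: mem_set.
have i1 i : area.-integrable B (EFin \o (f \_ (A i))).
  apply: (@rint_le _ _ _ area B mB _ f) => //.
    have mf := @rint_measurable _ _ _ area B f fi.
    apply: (@measurable_funS _ _ _ _ setT) => //.
    by apply: (measurable_restrictT f (mA i)).1; exact: (measurable_funS mB (AB i) mf).
  by move=> p _; rewrite patchE; case: ifP => _; rewrite ?normr0// ger0_norm.
under eq_bigr do rewrite E.
rewrite -(@Rintegral_sum _ _ _ area B mB _ _ i1).
apply: le_Rintegral => //; first exact: (@rint_big _ _ _ area B mB).
move=> p _; have [[i Aip]|nA] := pselect (exists i, A i p).
  rewrite (bigD1 i)//= patchE mem_set// big1 ?addr0// => j ji.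
  rewrite patchE memNset// => Ajp; have : (A j `&` A i) p by [].
  by rewrite dA.
rewrite big1// => i _; rewrite patchE memNset// => Aip; apply: nA; by exists i.
Qed.

Lemma hess_prod_ge0 D f : 0 <= hess_prod D f f.
Proof.
apply: Rintegral_ge0 => p _; apply: sumr_ge0 => i _; apply: sumr_ge0 => j _.
by rewrite -expr2 sqr_ge0.
Qed.

Lemma compact_hull (K : triangle R) : nondegenerate_triangle K -> compact (hull K).
Proof.
move=> nK; have d0 := @tdet_neq0 _ K 0 1 2%:R isT isT isT nK.
rewrite (@hull_tri _ K 0 1 2%:R isT isT isT d0).
have [M HM] := tri_box d0.
by apply: (@subclosed_compact _ _ (box M)) => //; [exact: closed_tri|exact: compact_box].
Qed.

Lemma hull_bounded (K : triangle R) u : nondegenerate_triangle K ->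
  {within hull K, continuous u} -> exists M, forall p, hull K p -> `|u p| <= M.
Proof.
move=> nK cu; have /compact_bounded[N [_ HN]] := continuous_compact cu (compact_hull nK).
exists (`|N| + 1) => p Kp; apply: (HN (`|N| + 1)); last by exists p.
by rewrite (le_lt_trans (ler_norm N))// ltrDl.
Qed.

Variables (K : triangle R) (m : nat) (Th : 'I_m -> triangle R).
Hypothesis nK : nondegenerate_triangle K.
Hypothesis tK : triangulation K Th.

Let nT T : nondegenerate_triangle (Th T).
Proof. by case: tK. Qed.

Lemma hull_element T : hull (Th T) `<=` hull K.
Proof. by case: tK => _ <- _ _ p Tp; exists T. Qed.

Lemma inner_element T : inner (Th T) `<=` inner K.
Proof. by apply: interiorS; exact: hull_element. Qed.

Lemma inner_disjoint T S : T != S -> inner (Th T) `&` inner (Th S) = set0.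
Proof. by case: tK => _ _ + _; apply. Qed.

Let measurable_inner (T : triangle R) : measurable (inner T).
Proof. by apply: open_measurable2; exact: open_interior. Qed.

(** The edges of the elements are negligible. *)
Lemma ae_inner_element : {ae area, forall p, hull K p -> exists T, inner (Th T) p}.
Proof.
have H T : {ae area, forall p, hull (Th T) p -> inner (Th T) p}.
  have [d0 oD oo ot] := @inner_between _ _ (nT T) 0 1 2%:R isT isT isT.
  exists (hull (Th T) `\` inner (Th T)); split.
  - apply: measurableD; last exact: measurable_inner.
    by rewrite (@hull_tri _ (Th T) 0 1 2%:R isT isT isT d0); exact: measurable_tri.
  - by rewrite (@hull_tri _ (Th T) 0 1 2%:R isT isT isT d0); exact: (between_null d0 oD oo).
  - by move=> p /= /not_implyP.
have := filter_forall ae_area_filter H; apply: filterS => p Hp.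
by case: tK => _ <- _ _ [T _ Tp]; exists T; exact: Hp.
Qed.

Lemma glued_inner (w : @piecewise R m) T p : inner (Th T) p -> glued Th w p = w T p.
Proof.
move=> Tp; rewrite /glued (bigD1 T)//= patchE mem_set// big1 ?addr0// => S ST.
rewrite patchE memNset// => Sp; have : (inner (Th S) `&` inner (Th T)) p by [].
by rewrite inner_disjoint.
Qed.

Lemma glued_bounded (w : @piecewise R m) :
  (forall T, exists M, forall p, hull (Th T) p -> `|w T p| <= M) ->
  exists M, forall p, `|glued Th w p| <= M.
Proof.
move=> wM; pose M T := sval (cid (wM T)).
have HM T p : hull (Th T) p -> `|w T p| <= M T by exact: (svalP (cid (wM T))).
exists (\sum_T `|M T|) => p; rewrite /glued (le_trans (ler_norm_sum _ _ _))//.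
apply: ler_sum => T _; rewrite patchE; case: ifPn => [/set_mem Tp|_]; last by rewrite normr0.
by rewrite (le_trans (HM _ _ (interior_subset Tp)))// ler_norm.
Qed.

Lemma VL_facts u : VL K u ->
  [/\ square_integrable area (inner K) u,
      forall i, square_integrable area (inner K) (wpartial (inner K) i u) /\
        weak_partial (inner K) i u (wpartial (inner K) i u)
    & forall i j, square_integrable area (inner K) (wpartial (inner K) j (wpartial (inner K) i u)) /\
        weak_partial (inner K) j (wpartial (inner K) i u) (wpartial (inner K) j (wpartial (inner K) i u))].
Proof.
have mD := measurable_inner K.
have H1P f i : H1 (inner K) f -> square_integrable area (inner K) (wpartial (inner K) i f) /\
    weak_partial (inner K) i f (wpartial (inner K) i f).
  move=> [_ /(_ i) wf]; have [] := @xgetPex _ (fun=> 0) [set v | L2 (inner K) v /\ weak_partial (inner K) i f v] wf.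
  by move=> /(Lfun2P area mD).
move=> [_ [Hu HHu] _]; split.
- by have [/(Lfun2P area mD)] := Hu.
- by move=> i; exact: H1P.
- by move=> i j; apply: H1P; exact: HHu.
Qed.

Lemma square_integrable_subset (A B : set (R * R)) f : measurable A -> measurable B ->
  A `<=` B -> square_integrable area B f -> square_integrable area A f.
Proof.
move=> mA mB AB [mf fi]; split; first exact: measurable_funS mf.
exact: (@integrableS _ _ _ area _ _ _ mB mA AB fi).
Qed.

(** If [u] vanished almost everywhere, so would its mollifications everywhere, but these converge
    to [u] at each point of the closed triangle. *)
Lemma nonzero_Linf_gt0 u : VL K u -> (exists2 p, hull K p & u p != 0) -> 0 < Linf (hull K) u.
Proof.
move=> Vu [p Kp up]; have [cu _ _] := Vu; have [su _ _] := VL_facts Vu.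
rewrite lt_neqAle Linf_ge0 andbT eq_sym; apply/eqP => L0.
have [d0 oD oo ot] := @inner_between _ _ nK 0 1 2%:R isT isT isT.
have hE := @hull_tri _ K 0 1 2%:R isT isT isT d0.
have [M uM] := hull_bounded nK cu.
have u0 : {ae area, forall x, inner K x -> u x = 0}.
  have := Linf_ae uM; apply: filterS => x + Kx.
  rewrite L0 patchE mem_set; last exact: interior_subset Kx.
  by rewrite normr_le0 => /eqP.
have := @approx_cvg_point _ _ _ _ _ d0 oD oo ot u p su.
rewrite -hE => /(_ Kp cu).
have -> : (fun k => approx (K 0) (K 1) (K 2%:R) (inner K) u k p) = fun=> 0.
  apply/funext => k; rewrite approxE.
  transitivity (\int[area]_(y in inner K) (0 : R)); last by rewrite /Rintegral integral0.
  apply: (@ae_eq_Rintegral _ _ _ area _ (measurable_inner K)).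
  - have tp : tri (K 0) (K 1) (K 2%:R) p by rewrite -hE.
    have [sk _ _] := ker_test d0 oo ot k tp.
    have [N DN] := inner_bounded nK.
    exact: rint_measurable (mul_smooth_integrable (measurable_inner K) DN su sk).
  - exact: measurable_cst.
  - by apply: filterS u0 => x h Kx; rewrite h// mul0r.
by move=> c; have := cvg_unique (@Rhausdorff R) c (cvg_cst 0) => h; rewrite h eqxx in up.
Qed.

(** The product of two barycentric coordinates. Without such a function the infimum defining
    [lambda] would be taken over the empty set, where it is 0 by convention. *)
Lemma VL_nonzero : exists u, VL K u /\ exists2 p, hull K p & u p != 0.
Proof.
have [d0 oD oo ot] := @inner_between _ _ nK 0 1 2%:R isT isT isT.
have hE := @hull_tri _ K 0 1 2%:R isT isT isT d0.
have [M DM] := inner_bounded nK.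
pose v p := baryb (K 0) (K 1) (K 2%:R) p * baryc (K 0) (K 1) (K 2%:R) p.
have sv : smooth v by apply: smoothM; exact: smooth_affine.
exists v; split.
  split; first by apply: continuous_subspaceT; exact: smooth_continuous.
    apply: (@H2I _ K nK v (fun i => partial i v) (fun i j => partial j (partial i v))).
    - exact: (smooth_square_integrable (measurable_inner K) DM).
    - by move=> i; apply: (smooth_square_integrable (measurable_inner K) DM); exact: smooth_partial.
    - by move=> i j; apply: (smooth_square_integrable (measurable_inner K) DM); do 2! apply: smooth_partial.
    - by move=> i; exact: (smooth_weak_partial (measurable_inner K) DM).
    - by move=> i j; apply: (smooth_weak_partial (measurable_inner K) DM); exact: smooth_partial.
  have v0 : v (K 0) = 0.
    by rewrite /v (_ : baryb _ _ _ _ = 0) ?mul0r// /baryb; move: d0; rewrite /tdet => ?; field.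
  have v1 : v (K 1) = 0.
    by rewrite /v (_ : baryc _ _ _ _ = 0) ?mulr0// /baryc; move: d0; rewrite /tdet => ?; field.
  have v2 : v (K 2%:R) = 0.
    by rewrite /v (_ : baryb _ _ _ _ = 0) ?mul0r// /baryb; move: d0; rewrite /tdet => ?; field.
  move=> i; case: i => [[|[|[|i]]] Hi] //.
  - by rewrite (_ : Ordinal Hi = 0)//; exact/val_inj.
  - by rewrite (_ : Ordinal Hi = 1)//; exact/val_inj.
  - by rewrite (_ : Ordinal Hi = 2%:R)//; exact/val_inj.
exists (taff (K 0) (K 1) (K 2%:R) (1 / 3, 1 / 3)).
  by rewrite hE /tri/= baryb_taff// baryc_taff//=; split; lra.
by rewrite /v baryb_taff// baryc_taff//= mulf_neq0// mul1r invr_neq0.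
Qed.

Variables (Ch : R) (u : R * R -> R).
Hypothesis Vu : VL K u.
Hypothesis errC : Linf (hull K) (glued Th (FM_error K Th u)) <= Ch * seminorm_h Th (FM_error K Th u).

Let w := FM_interpolant K Th u.
Let e := FM_error K Th u.

Let D2 i j := wpartial (inner K) j (wpartial (inner K) i u).

Let element_facts T : [/\ square_integrable area (inner (Th T)) u,
  forall i, square_integrable area (inner (Th T)) (wpartial (inner K) i u),
  forall i j, square_integrable area (inner (Th T)) (D2 i j),
  forall i, weak_partial (inner (Th T)) i u (wpartial (inner K) i u)
  & forall i j, weak_partial (inner (Th T)) j (wpartial (inner K) i u) (D2 i j)].
Proof.
have [su s1 s2] := VL_facts Vu.
have sub f : square_integrable area (inner K) f -> square_integrable area (inner (Th T)) f.
  by apply: square_integrable_subset; [exact: measurable_inner|exact: measurable_inner|exact: inner_element].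
split; first exact: sub.
- by move=> i; apply: sub; case: (s1 i).
- by move=> i j; apply: sub; case: (s2 i j).
- by move=> i; apply: (weak_partial_subset (@inner_element T)); case: (s1 i).
- by move=> i j; apply: (weak_partial_subset (@inner_element T)); case: (s2 i j).
Qed.

Let cu T : {within hull (Th T), continuous u}.
Proof. by have [cK _ _] := Vu; exact: (@continuous_subspaceW _ _ _ _ _ (@hull_element T) cK). Qed.

(** When there is no interpolant the default value zero of [w] has the same properties. *)
Lemma interpolant_cases T : exists c0 c1 c2 c3 c4 c5 : R,
  (forall p, hull (Th T) p -> w T p = quadratic c0 c1 c2 c3 c4 c5 p) /\
  forall i j, quadratic_hessian c3 c4 c5 i j *
    \int[area]_(p in inner (Th T)) (D2 i j p - quadratic_hessian c3 c4 c5 i j) = 0.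
Proof.
have [[w' Hw']|nw] := pselect (exists w', is_FM_interpolant K Th u w').
  have [] := @xgetPex _ (fun _ _ => 0) (is_FM_interpolant K Th u) (ex_intro _ w' Hw').
  rewrite -/(FM_interpolant K Th u) -/w => -[/(_ T)[c0 [c1 [c2 [c3 [c4 [c5 P]]]]]] _ _ _] e0 fl0.
  have fq p : hull (Th T) p -> w T p = quadratic c0 c1 c2 c3 c4 c5 p.
    by move=> Tp; rewrite P// /quadratic; ring.
  exists c0, c1, c2, c3, c4, c5; split => // i j.
  have [su sW sH wW wH] := element_facts T.
  by rewrite (interpolation_orthogonality (nT T) su sW sH wW wH fq (@cu T) (e0 T) (fl0 T)) mulr0.
exists 0, 0, 0, 0, 0, 0; split.
  move=> p _; rewrite /w /FM_interpolant xgetPN; last by move=> w' Hw'; apply: nw; exists w'.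
  by rewrite /quadratic; ring.
move=> i j; rewrite (_ : quadratic_hessian _ _ _ _ _ = 0) ?mul0r//.
by rewrite /quadratic_hessian mulr0 !if_same.
Qed.

Lemma hess_interpolant_le : prod_h Th w w + prod_h Th e e <= hess_prod (inner K) u u.
Proof.
have [su s1 s2] := VL_facts Vu.
have -> : hess_prod (inner K) u u = \int[area]_(p in inner K) (\sum_i \sum_j D2 i j p ^+ 2).
  by apply: eq_Rintegral => p _; apply: eq_bigr => i _; apply: eq_bigr => j _; rewrite expr2.
rewrite /prod_h -big_split /=.
have E T : hess_prod (inner (Th T)) (w T) (w T) + hess_prod (inner (Th T)) (e T) (e T) =
    \int[area]_(p in inner (Th T)) (\sum_i \sum_j D2 i j p ^+ 2).
  have [c0 [c1 [c2 [c3 [c4 [c5 [fq cross]]]]]]] := interpolant_cases T.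
  have [suT sW sH wW wH] := element_facts T.
  have mT := measurable_inner (Th T).
  rewrite -(hess_pythagoras (nT T) suT sW sH wW wH fq cross).
  rewrite (@Rintegral_sum _ _ _ area _ mT); last first.
    by move=> i; apply: (@rint_big _ _ _ area _ mT) => j; case: (sH i j).
  apply: eq_bigr => i _; rewrite (@Rintegral_sum _ _ _ area _ mT)// => j.
  by case: (sH i j).
rewrite (eq_bigr _ (fun T _ => E T)).
apply: (@sum_Rintegral_disjoint_le _ (fun T => inner (Th T))).
- exact: measurable_inner.
- by move=> T; exact: measurable_inner.
- exact: inner_element.
- exact: inner_disjoint.
- by move=> p; apply: sumr_ge0 => i _; apply: sumr_ge0 => j _; exact: sqr_ge0.
- apply: (@rint_big _ _ _ area _ (measurable_inner K)) => i.
  by apply: (@rint_big _ _ _ area _ (measurable_inner K)) => j; case: (s2 i j) => -[].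
Qed.

Lemma Linf_interpolant_le : Linf (hull K) u <= Linf (hull K) (glued Th w) + Linf (hull K) (glued Th e).
Proof.
have bw T : exists M, forall p, hull (Th T) p -> `|w T p| <= M.
  have [c0 [c1 [c2 [c3 [c4 [c5 [fq _]]]]]]] := interpolant_cases T.
  have cq : {within hull (Th T), continuous (quadratic c0 c1 c2 c3 c4 c5)}.
    by apply: continuous_subspaceT; exact: smooth_continuous (smooth_quadratic _ _ _ _ _ _).
  have [M HM] := hull_bounded (nT T) cq.
  by exists M => p Tp; rewrite fq// HM.
have be T : exists M, forall p, hull (Th T) p -> `|e T p| <= M.
  have [M HM] := bw T; have [N HN] := hull_bounded (nT T) (@cu T).
  exists (N + M) => p Tp; rewrite /e /FM_error -/w /=.
  by apply: le_trans (ler_normB _ _) _; apply: lerD; [exact: HN|exact: HM].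
have [M1 H1] := glued_bounded bw; have [M2 H2] := glued_bounded be.
apply: (@Linf_triangle _ _ _ _ _ (Num.max M1 M2)).
- by move=> p _; rewrite le_max H1.
- by move=> p _; rewrite le_max H2 orbT.
- have := ae_inner_element; apply: filterS => p H Kp; have [T Tp] := H Kp.
  by rewrite !(glued_inner _ Tp) /e /FM_error -/w /= subrKC.
Qed.

Lemma prod_h_ge0 (f : @piecewise R m) : 0 <= prod_h Th f f.
Proof. by apply: sumr_ge0 => T _; exact: hess_prod_ge0. Qed.

Let lambda_h_set := [set seminorm_h Th w ^+ 2 / Linf (hull K) (glued Th w) ^+ 2
  | w in [set w | VFM K Th w /\ exists T, exists2 p, hull (Th T) p & w T p != 0]].

Let lambda_h_lb : lbound lambda_h_set 0.
Proof. by move=> _ [w' _ <-]; apply: divr_ge0; exact: sqr_ge0. Qed.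

Lemma lambda_h_ge0 : 0 <= lambda_h K Th.
Proof.
rewrite /lambda_h -/lambda_h_set.
have [[x Sx]|S0] := pselect (exists x, lambda_h_set x).
  by apply: lb_le_inf; [exists x|exact: lambda_h_lb].
by rewrite (_ : lambda_h_set = set0) ?inf0//; apply/seteqP; split => // x Sx; apply: S0; exists x.
Qed.

(** If the sup norm is not zero, the interpolant is one of the functions over which the infimum
    is taken. *)
Lemma lambda_h_interpolant_le : lambda_h K Th * Linf (hull K) (glued Th w) ^+ 2 <= prod_h Th w w.
Proof.
have [->|L0] := eqVneq (Linf (hull K) (glued Th w)) 0; first by rewrite expr0n mulr0 prod_h_ge0.
have Vw : VFM K Th w.
  have [[w' Hw']|nw] := pselect (exists w', is_FM_interpolant K Th u w').
    by have [] := @xgetPex _ (fun _ _ => 0) (is_FM_interpolant K Th u) (ex_intro _ w' Hw').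
  exfalso; move/eqP: L0; apply; apply/le_anti; rewrite Linf_ge0 andbT.
  apply: Linf_le => //; apply: nearW => p; rewrite patchE; case: ifP => _; last by rewrite normr0.
  rewrite /glued big1 ?normr0// => T _; rewrite patchE; case: ifP => // _.
  by rewrite /w /FM_interpolant xgetPN// => w' Hw'; apply: nw; exists w'.
have nz : exists T, exists2 p, hull (Th T) p & w T p != 0.
  apply: contrapT => nz; move/eqP: L0; apply; apply/le_anti; rewrite Linf_ge0 andbT.
  apply: Linf_le => //; apply: nearW => p; rewrite patchE; case: ifP => _; last by rewrite normr0.
  rewrite /glued big1 ?normr0// => T _; rewrite patchE; case: ifPn => // /set_mem Tp.
  apply: contrapT => wp; apply: nz; exists T, p; last exact/eqP.
  exact: interior_subset Tp.
have L2 : 0 < Linf (hull K) (glued Th w) ^+ 2 by rewrite exprn_even_gt0.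
rewrite -ler_pdivlMr// -(sqr_sqrtr (prod_h_ge0 w)) -/(seminorm_h Th w).
rewrite /lambda_h -/lambda_h_set; apply: ge_inf; first by exists 0; exact: lambda_h_lb.
by exists w.
Qed.

(** Expanding the squares, the defect in this inequality is [(b - Ch * l * x) ^+ 2]. *)
Lemma combine_bounds (l x b n L a c : R) : 0 <= l -> 0 < L -> L <= x + c * b ->
  l * x ^+ 2 <= a -> a + b ^+ 2 <= n -> l / (1 + c ^+ 2 * l) <= n / L ^+ 2.
Proof.
move=> l0 L0 Lx la an.
have d0 : 0 < 1 + c ^+ 2 * l by rewrite ltr_pwDl// mulr_ge0// sqr_ge0.
rewrite ler_pdivrMr// mulrAC ler_pdivlMr ?exprn_gt0//.
have h1 : L ^+ 2 <= (x + c * b) ^+ 2 by rewrite ler_pXn2r// ?nnegrE; [exact: ltW|exact: le_trans (ltW L0) Lx].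
apply: (@le_trans _ _ (l * (x + c * b) ^+ 2)); first by rewrite ler_wpM2l.
apply: (@le_trans _ _ ((l * x ^+ 2 + b ^+ 2) * (1 + c ^+ 2 * l))).
  rewrite -subr_ge0 (_ : _ - _ = (b - c * l * x) ^+ 2); first exact: sqr_ge0.
  by ring.
by rewrite ler_pM2r//; apply: le_trans an; rewrite lerD2r.
Qed.

Lemma Rayleigh_bound : (exists2 p, hull K p & u p != 0) ->
  lambda_h K Th / (1 + Ch ^+ 2 * lambda_h K Th) <=
  H2seminorm (inner K) u ^+ 2 / Linf (hull K) u ^+ 2.
Proof.
move=> nz; rewrite /H2seminorm sqr_sqrtr ?hess_prod_ge0//.
apply: (@combine_bounds _ (Linf (hull K) (glued Th w)) (seminorm_h Th e) _ _ (prod_h Th w w)).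
- exact: lambda_h_ge0.
- exact: nonzero_Linf_gt0.
- by apply: le_trans Linf_interpolant_le _; rewrite lerD2l.
- exact: lambda_h_interpolant_le.
- by rewrite /seminorm_h sqr_sqrtr ?prod_h_ge0//; exact: hess_interpolant_le.
Qed.

End Assembly.

Theorem theorem3p1 (R : realType) (K : triangle R) (m : nat)
    (Th : 'I_m -> triangle R) (Ch : R) :
  nondegenerate_triangle K -> triangulation K Th ->
  (forall u : R * R -> R, VL K u ->
     Linf (hull K) (glued Th (FM_error K Th u)) <=
     Ch * seminorm_h Th (FM_error K Th u)) ->
  lambda K >= lambda_h K Th / (1 + Ch ^+ 2 * lambda_h K Th).
Proof.
move=> nK tK errC; apply: lb_le_inf.
  have [u Hu] := VL_nonzero nK.
  by exists (H2seminorm (inner K) u ^+ 2 / Linf (hull K) u ^+ 2), u.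
by move=> _ [u [Vu nz] <-]; apply: Rayleigh_bound => //; exact: errC.
Qed.
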